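(* Let $f:\mathbb{R}\times\mathbb{R}^+\times\mathbb{R}\to\mathbb{R}$ and let $p:\mathbb{R}\times\mathbb{R}^+\to\mathbb{R}$ satisfy $p\in L^1(\mathbb{R}\times(1,+\infty))$, $$|f(\xi,\eta,\zeta_1)-f(\xi,\eta,\zeta_2)|\le |p(\xi,\eta)|\,|\zeta_1-\zeta_2|\quad\text{for all }(\xi,\eta)\in\mathbb{R}\times\mathbb{R}^+,\ \zeta_1,\zeta_2\in\mathbb{R},$$ $$K:=\sup_{(x,y)\in\mathbb{R}\times(1,+\infty)}\int_{-\infty}^{+\infty}\int_1^{+\infty}N(x,y;\xi,\eta)|p(\xi,\eta)|\,d\eta\,d\xi<1,$$ $$L:=\left(\int_{-\infty}^{+\infty}\left[\int_1^{+\infty}\int_{-\infty}^{+\infty}\frac{\eta-1}{(x-\xi)^2+(1-\eta)^2}|p(\xi,\eta)|\,d\xi\,d\eta\right]^2dx\right)^{1/2}<+\infty.$$ Then, from measured data, the derivative $u_y(\cdot,1)$ can be approximated in the following sense: there are maps $R_\varepsilon:L^2(\mathbb{R})\to L^2(\mathbb{R})$, $0<\varepsilon<1$, depending only on $f$ and $\varepsilon$, such that the following holds. Let $\varphi\in L^1(\mathbb{R})\cap L^\infty(\mathbb{R})$ satisfy $\widehat\varphi(\zeta)e^{|\zeta|}\in L^2(\mathbb{R})$, let $u\in J$ be a solution of $u=Au$ (with datum $\varphi$), and let $\psi(x)=u_y(x,1)$, where $\widehat\psi(\zeta)e^{|\zeta|}\in L^2(\mathbb{R})$. Then there is a constant $C>0$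 independent of $\varepsilon$ such that for every $0<\varepsilon<1$ and every $\varphi_\varepsilon\in L^2(\mathbb{R})$ with $\|\varphi_\varepsilon-\varphi\|_{L^2(\mathbb{R})}<\varepsilon$, the function $\psi_\varepsilon=R_\varepsilon(\varphi_\varepsilon)\in L^2(\mathbb{R})$ satisfies $$\|\psi_\varepsilon-\psi\|_{L^2(\mathbb{R})}<C\varepsilon^{1/2}.$$
   Context: $\mathbb{R}^+=(0,+\infty)$. Fourier transform: $\widehat g(\zeta)=\frac{1}{\sqrt{2\pi}}\int_{-\infty}^{+\infty}g(x)e^{-ix\zeta}\,dx$. For $y,\eta>1$ put $$N(x,y;\xi,\eta)=-\frac1{4\pi}\ln\frac{(x-\xi)^2+(y-\eta)^2}{(x-\xi)^2+(y+\eta-2)^2},$$ so that $N_\eta(x,y;\xi,1)=\frac1\pi\frac{y-1}{(x-\xi)^2+(y-1)^2}$. For $x\in\mathbb{R}$, $y>1$ put $$Au(x,y)=\int_{-\infty}^{+\infty}N_\eta(x,y;\xi,1)\varphi(\xi)\,d\xi-\int_{-\infty}^{+\infty}\int_1^{+\infty}N(x,y;\xi,\eta)f(\xi,\eta,u(\xi,\eta))\,d\eta\,d\xi.$$ (The equation $u=Au$ is the integral form of $\Delta u=f(x,y,u)$ for $y>1$, $u(x,1)=\varphi(x)$, $u\to0$ at infinity.) The space $J$ is $$J=\Big\{u\in C(\mathbb{R}\times(1,+\infty)) : \lim_{\sqrt{x^2+y^2}\to+\infty}u(x,y)=0\Big\}.$$ $u_y(x,1)$ denotes the normal derivative on the line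 $y=1$, taken from $y>1$. *)

(* Defs.v *)
From HB Require Import structures.
From mathcomp Require Import all_boot all_order all_algebra.
From mathcomp Require Import complex.
From mathcomp Require Import all_classical all_reals all_analysis.
From mathcomp Require Import ring.

Set Implicit Arguments.
Unset Strict Implicit.
Unset Printing Implicit Defensive.

Import Order.TTheory GRing.Theory Num.Theory.
Import numFieldNormedType.Exports.

Local Open Scope classical_set_scope.
Local Open Scope ring_scope.

Notation leb R := (@lebesgue_measure R).

(* Functions on R x R^+ or on y > 1 are represented by total functions; only
   their values on that domain are ever constrained. *)

(* The space L^2(R) of classes of real functions modulo equality a.e. *)
Notation L2 R := (LspaceType2 (leb R)).

Section Defs.
Context {R : realType}.
Implicit Types (x y xi eta zeta : R) (g phi psi : R -> R) (u p : R -> R -> R)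
  (f : R -> R -> R -> R).

Definition upper : set (R * R) := [set: R] `*` `]1, +oo[.

(* Dirichlet Green function of the half-plane y > 1 (for - Laplacian). *)
Definition green x y xi eta : R :=
  - (4 * pi)^-1 *
    ln (((x - xi) ^+ 2 + (y - eta) ^+ 2) /
        ((x - xi) ^+ 2 + (y + eta - 2) ^+ 2)).

Definition green_eta x y xi eta : R := derive1 (green x y xi) eta.

Lemma green_eta1E x y xi : 1 < y ->
  green_eta x y xi 1 = pi^-1 * ((y - 1) / ((x - xi) ^+ 2 + (y - 1) ^+ 2)).
Proof.
move=> y1; have y10 : 0 < (y - 1) ^+ 2 by rewrite exprn_gt0// subr_gt0.
have a0 : 0 < (x - xi) ^+ 2 + (y - 1) ^+ 2 by rewrite ltr_wpDl// sqr_ge0.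
have pi0 : (pi : R) != 0 by rewrite gt_eqF// pi_gt0.
pose F (t : R) := (x - xi) ^+ 2 + (y - t) ^+ 2.
pose G (t : R) := (x - xi) ^+ 2 + (y + t - 2) ^+ 2.
have dF : is_derive (1 : R) (1 : R) F (- 2 * (y - 1)).
  rewrite /F; apply: is_derive_eq; rewrite /GRing.scale /=; ring.
have dG : is_derive (1 : R) (1 : R) G (2 * (y - 1)).
  rewrite /G; apply: is_derive_eq; rewrite /GRing.scale /=; ring.
have FG : G 1 = F 1 by rewrite /G /F; congr (_ + _ ^+ 2); ring.
have FG0 : 0 < F 1 / G 1 by rewrite FG divr_gt0.
have G0 : G 1 != 0 by rewrite FG gt_eqF.
have dGV : is_derive (1 : R) (1 : R) (fun t => (G t)^-1)
    (- (G 1) ^- 2 *: (2 * (y - 1))).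
  exact: is_deriveV.
have dFG : is_derive (1 : R) (1 : R) (F * (fun t => (G t)^-1))
    (F 1 *: (- (G 1) ^- 2 *: (2 * (y - 1))) + (G 1)^-1 *: (- 2 * (y - 1))).
  exact: is_deriveM.
have dln := is_derive1_ln FG0.
have dl : is_derive (1 : R) (1 : R) ((@ln R) \o (F * (fun t => (G t)^-1)))
    ((F 1 / G 1)^-1 * (F 1 *: (- (G 1) ^- 2 *: (2 * (y - 1))) +
      (G 1)^-1 *: (- 2 * (y - 1)))).
  exact: is_derive1_comp.
have := is_deriveZ (- (4 * pi)^-1 : R) dl.
move=> [_]; rewrite -derive1E /green_eta /green => h.
have -> : (fun eta => - (4 * pi)^-1 * ln (((x - xi) ^+ 2 + (y - eta) ^+ 2) /
        ((x - xi) ^+ 2 + (y + eta - 2) ^+ 2))) =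
  (- (4 * pi)^-1 : R) *: ((@ln R) \o (F * (fun t => (G t)^-1))) by [].
rewrite h /GRing.scale /=.
rewrite FG; have F0 : F 1 != 0 by rewrite gt_eqF.
rewrite -/(F 1); move: pi0; rewrite {h}; move: pi => q q0; field.
by rewrite q0 F0.
Qed.

Definition opA f phi u x y : R :=
  \int[leb R]_xi (green_eta x y xi 1 * phi xi) -
  \int[leb R]_xi \int[leb R]_(eta in `]1, +oo[)
    (green x y xi eta * f xi eta (u xi eta)).

(* u = A u on y > 1. The library integral is total, so the (absolute) convergence
   of the double integral in A u is part of the meaning of the equation. *)
Definition solution f phi u : Prop := forall x y, 1 < y ->
  (leb R \x leb R)%E.-integrable upper
    (fun z => (green x y z.1 z.2 * f z.1 z.2 (u z.1 z.2))%:E) /\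
  u x y = opA f phi u x y.

Definition spaceJ u : Prop :=
  {within upper, continuous (fun z : R * R => u z.1 z.2)} /\
  forall e : R, 0 < e -> \forall M \near +oo,
    forall x y, 1 < y -> M < Num.sqrt (x ^+ 2 + y ^+ 2) -> `|u x y| < e.

(* psi = u_y(., 1): one-sided difference quotients at y = 1, where u has the
   boundary values phi; both are only determined up to null sets. *)
Definition normal_derivative phi u psi : Prop :=
  {ae leb R, forall x,
    (u x (1 + h) - phi x) / h @[h --> 0^'+] --> psi x}.

Definition constK p : \bar R :=
  ereal_sup [set (\int[leb R]_xi \int[leb R]_(eta in `]1%R, +oo[)
    (green z.1 z.2 xi eta * `|p xi eta|)%:E)%E | z in upper].

Definition constL p : \bar R :=
  ((\int[leb R]_x
     (\int[leb R]_(eta in `]1%R, +oo[) \int[leb R]_xi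
        ((eta - 1) / ((x - xi) ^+ 2 + (1 - eta) ^+ 2) * `|p xi eta|)%:E)
     ^+ 2) `^ (2^-1)%R)%E.

(* e^{-i x zeta} = cos (x zeta) - i sin (x zeta) *)
Definition fourier g zeta : R[i] :=
  (((Num.sqrt (2 * pi))^-1)%:C *
   ((\int[leb R]_x (g x * cos (x * zeta))) -i*
    (\int[leb R]_x (g x * sin (x * zeta)))))%C.

Definition normL2 g : \bar R := ('N[leb R]_2%:E[EFin \o g])%E.

Definition L2C (G : R -> R[i]) : Prop :=
  (fun x => complex.Re (G x)) \in Lfun (leb R) 2%:E /\
  (fun x => complex.Im (G x)) \in Lfun (leb R) 2%:E.

(* G is the Fourier-Plancherel transform of g in L^2, i.e. the limit in L^2 of
   the Fourier integrals of the truncations of g (g need not be in L^1). *)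
Definition is_plancherel g (G : R -> R[i]) : Prop :=
  [/\ g \in Lfun (leb R) 2%:E, L2C G &
    normL2 (fun zeta =>
      ComplexField.Normc.normc (G zeta - fourier (g \_ `[- M, M]) zeta))
      @[M --> +oo] --> 0%E].

Definition exp_weight (G : R -> R[i]) : R -> R[i] :=
  fun zeta => (G zeta * (expR `|zeta|)%:C)%C.

End Defs.

(* Main.v *)
(* The regularization is not constructive: R_eps v is the normal derivative of a
   solution of the problem whose datum is eps-close to v and has the smallest
   possible (integer) bound n on the L^2 norm of its exponentially weighted
   Fourier transform. It then suffices to prove that the map from data to normal
   derivatives is Hoelder of exponent 1/2 on data with a common bound n.
   Let d be the difference of two such data and w that of the solutions. By
   Bessel's inequality and interpolation with the exponential weight, the Poisson
   extension of d is bounded by delta = O(eps^(1/2)) and has a normal derivative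
   of L^2 norm O(eps^(1/2)). The difference F of the source terms satisfies
   F <= |p| (delta + N[F]), whence F <= |p| delta / (1 - K) almost everywhere.
   Finally the normal derivative of N[F] is bounded by a multiple of delta times
   the function whose L^2 norm is L, up to the contribution of the strip
   y - 1 < 2 h, which tends to 0 in L^1 by Fatou's lemma. *)

Require Import Defs.
From HB Require Import structures.
From mathcomp Require Import all_boot all_order all_algebra.
From mathcomp Require Import complex.
From mathcomp Require Import all_classical all_reals all_analysis.
From mathcomp Require Import measurable_realfun.
From mathcomp Require Import ring lra.

Set Implicit Arguments.
Unset Strict Implicit.
Unset Printing Implicit Defensive.

Import Order.TTheory GRing.Theory Num.Theory.
Import numFieldNormedType.Exports.

Local Open Scope classical_set_scope.
Local Open Scope ring_scope.

(** The exponent 1/2 has a single source. Let [A] be the cosine or sine transform of [d]: its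
    squared [L^2] norm is [O(eps^2)] and its exponentially weighted [L^2] norm is bounded. Taking
    the geometric mean of the two weights, the integral of [A^2 e^{|z|}] is [O(eps)]. This one
    integral controls the [L^2] norm of [|z| A], hence the normal derivative of the Poisson
    extension, and, paired with [e^{-|z|}], the [L^1] norm of [A], hence [delta]. Bessel's
    inequality serves twice: from the line to frequencies, and back.

    The boundary value of the Poisson extension first appears as an inverse Fourier integral [U];
    the identity [U = d] is read off at each point where the difference quotient converges.

    The strip is the delicate term: its smallness in [L^1] gives no pointwise limit as [h] tends to
    0. As the limit of the quotient is known to exist, it suffices to bound the quotient along some
    sequence of values [h = 1 / (n + 1)] that depends on [x], and a vanishing lower limit provides
    one. *)

Section measurability.
Context d (T : measurableType d) {R : realType}.
Implicit Types f g : T -> R.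

(** The reciprocal is discontinuous at 0, where its value is 0. Written as [f] times the power -1 of
    [f ^+ 2], it reduces to a real power, which is measurable on the whole line; at a zero of [f]
    the factor [f] gives the right value. *)
Lemma measurable_funV f : measurable_fun setT f ->
  measurable_fun setT (fun x => (f x)^-1).
Proof.
move=> mf.
have -> : (fun x => (f x)^-1) = (fun x => f x * ((f x ^+ 2) `^ (-1))).
  apply/funext => x; have [->|fx0] := eqVneq (f x) 0.
    by rewrite invr0 mul0r.
  rewrite powR_inv1 ?sqr_ge0//; field; exact: fx0.
apply: measurable_funM => //.
apply: (measurableT_comp (measurable_powR (-1))).
exact: measurable_funX.
Qed.

Lemma measurable_fun_ln f : measurable_fun setT f ->
  measurable_fun setT (fun x => ln (f x)).
Proof. exact: measurableT_comp (@measurable_ln R). Qed.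

Lemma measurable_fun_expR f : measurable_fun setT f ->
  measurable_fun setT (fun x => expR (f x)).
Proof. exact: measurableT_comp (@measurable_expR R). Qed.

Lemma measurable_fun_cos f : measurable_fun setT f ->
  measurable_fun setT (fun x => cos (f x)).
Proof.
apply: measurableT_comp; apply: continuous_measurable_fun.
exact: continuous_cos.
Qed.

Lemma measurable_fun_sin f : measurable_fun setT f ->
  measurable_fun setT (fun x => sin (f x)).
Proof.
apply: measurableT_comp; apply: continuous_measurable_fun.
exact: continuous_sin.
Qed.

Lemma measurable_fun_norm f : measurable_fun setT f ->
  measurable_fun setT (fun x => `|f x|).
Proof. by move=> mf; exact: measurableT_comp. Qed.

Lemma measurable_fun_max f g : measurable_fun setT f -> measurable_fun setT g ->
  measurable_fun setT (fun x => Num.max (f x) (g x)).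
Proof. exact: measurable_maxr. Qed.

Lemma measurable_fun_min f g : measurable_fun setT f -> measurable_fun setT g ->
  measurable_fun setT (fun x => Num.min (f x) (g x)).
Proof. exact: measurable_minr. Qed.

End measurability.

Ltac meas := repeat first
  [ match goal with H : measurable_fun _ ?f |- measurable_fun _ ?f => exact: H end
  | match goal with
    | |- measurable_fun _ (fun=> _) => exact: measurable_cst
    | |- measurable_fun _ (fun z => z) => exact: measurable_id
    | |- measurable_fun _ (fun z => - @?f z) => apply: measurable_funN
    | |- measurable_fun _ (fun z => @?f z - @?g z) => apply: measurable_funB
    | |- measurable_fun _ (fun z => @?f z + @?g z) => apply: measurable_funD
    | |- measurable_fun _ (fun z => @?f z * @?g z) => apply: measurable_funM
    | |- measurable_fun _ (fun z => @?f z ^+ _) => apply: measurable_funX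
    | |- measurable_fun _ (fun z => (@?f z)^-1) => apply: measurable_funV
    | |- measurable_fun _ (fun z => `|@?f z|) => apply: measurable_fun_norm
    | |- measurable_fun _ (fun z => ln (@?f z)) => apply: measurable_fun_ln
    | |- measurable_fun _ (fun z => expR (@?f z)) => apply: measurable_fun_expR
    | |- measurable_fun _ (fun z => cos (@?f z)) => apply: measurable_fun_cos
    | |- measurable_fun _ (fun z => sin (@?f z)) => apply: measurable_fun_sin
    | |- measurable_fun _ (fun z => Num.max (@?f z) (@?g z)) => apply: measurable_fun_max
    | |- measurable_fun _ (fun z => Num.min (@?f z) (@?g z)) => apply: measurable_fun_min
    | |- measurable_fun _ (fun z => @?f z < @?g z) => apply: measurable_fun_ltr
    | |- measurable_fun _ (fun z => @?f z && @?g z) => apply: measurable_and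
    | |- measurable_fun _ (fun z => fst (@?f z)) => apply: (measurableT_comp measurable_fst)
    | |- measurable_fun _ (fun z => snd (@?f z)) => apply: (measurableT_comp measurable_snd)
    | H : measurable_fun setT ?f |- measurable_fun setT (fun z => ?f (@?g z)) =>
        apply: (measurableT_comp H)
    end
  | apply: measurable_fun_ifT | exact: measurable_fst | exact: measurable_snd | assumption
  | match goal with H : forall x, measurable_fun _ _ |- _ => exact: H end ].

(** * Laplace and Poisson integrals on the line *)

Section kernels.
Context {R : realType}.
Local Notation mu := (leb R).

(** The added 1 makes the integrand nonnegative, so that the fundamental theorem of calculus on a
    half-line applies before integrability is known. The instance [t = 0] then gives integrability
    and, by subtraction, the integral with the cosine alone. *)
Lemma integral_laplace_cos (h t : R) : 0 < h ->
  (\int[mu]_x (expR (- (h * `|x|)) * (1 + cos (t * x)))%:E =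
   (2 * (h^-1 + h / (h ^+ 2 + t ^+ 2)))%:E)%E.
Proof.
move=> h0.
have ht0 : 0 < h ^+ 2 + t ^+ 2 by rewrite ltr_pwDl ?sqr_ge0 ?exprn_gt0.
rewrite ge0_symfun_integralT; last 3 first.
- move=> x; rewrite mulr_ge0 ?expR_ge0// -lerBlDl sub0r; exact: cos_geN1.
- move=> x; apply: cvgM.
    apply: continuous_comp; last exact: continuous_expR.
    apply: cvgN; apply: cvgMl_tmp; exact: norm_continuous.
  apply: cvgD; first exact: cvg_cst.
  apply: continuous_comp; last exact: continuous_cos.
  apply: cvgMl_tmp; exact: cvg_id.
- by move=> x /=; rewrite normrN mulrN cosN.
rewrite -set_itvcy.
pose F x := - expR (- (h * x)) * (h^-1 + (h * cos (t * x) - t * sin (t * x)) / (h ^+ 2 + t ^+ 2)).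
pose g x := expR (- (h * x)) * (1 + cos (t * x)).
have dF x : is_derive x (1:R) F (g x).
  rewrite /F /g; apply: is_derive_eq; rewrite /GRing.scale /=.
  have h0' : h != 0 by rewrite gt_eqF.
  have ht0' : h ^+ 2 + t ^+ 2 != 0 by rewrite gt_eqF.
  by field; rewrite h0' ht0'.
have cF : continuous F.
  by move=> x; apply: differentiable_continuous; apply/derivable1_diffP; case: (dF x).
rewrite [X in (_ * X)%E](_ : _ = \int[mu]_(x in `[0%R, +oo[) (g x)%:E)%E; last first.
  apply: eq_integral => x; rewrite inE/= in_itv/= andbT => x0.
  by rewrite /g ger0_norm.
rewrite (@ge0_continuous_FTC2y _ g F 0 0).
- rewrite /F mulr0 oppr0 expR0 mulr0 cos0 sin0 mulr0 subr0 mulr1 -EFinB -EFinM.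
  by congr EFin; ring.
- move=> x _; rewrite mulr_ge0 ?expR_ge0// -lerBlDl sub0r; exact: cos_geN1.
- apply: continuous_subspaceT => x; apply: cvgM.
    apply: continuous_comp; last exact: continuous_expR.
    apply: cvgN; apply: cvgMl_tmp; exact: cvg_id.
  apply: cvgD; first exact: cvg_cst.
  apply: continuous_comp; last exact: continuous_cos.
  apply: cvgMl_tmp; exact: cvg_id.
- have e0 : expR (- (h * x)) @[x --> +oo] --> 0.
    apply: (cvg_comp (fun x => h * x) (fun x => expR (- x)) _ (@cvgr_expR R)).
    by apply: gt0_cvgMry => //; exact: cvg_id.
  pose c := h^-1 + (h + `|t|) / (h ^+ 2 + t ^+ 2).
  apply/norm_cvg0P; apply: (@squeeze_cvgr _ _ _ _ (cst 0) (fun x => expR (- (h * x)) * c)).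
  + near=> x; rewrite normr_ge0/= /F normrM normrN (ger0_norm (expR_ge0 _)).
    rewrite ler_wpM2l ?expR_ge0//= /c (le_trans (ler_normD _ _))//.
    have hi : 0 <= (h ^+ 2 + t ^+ 2)^-1 by rewrite invr_ge0 ltW.
    have hi' : 0 <= h^-1 by rewrite invr_ge0 ltW.
    rewrite (ger0_norm hi') lerD2l normrM (ger0_norm hi) ler_wpM2r//.
    rewrite (le_trans (ler_normB _ _))// !normrM (ger0_norm (ltW h0)).
    rewrite lerD// ler_piMr// ?(ltW h0)//.
      by rewrite ler_norml cos_geN1 cos_le1.
    by rewrite ler_norml sin_geN1 sin_le1.
  + exact: cvg_cst.
  + by rewrite -(mul0r c); apply: cvgMr_tmp.
- by move=> x _; case: (dF x).
- exact/cvg_at_right_filter/cF.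
- by move=> x _; rewrite derive1E; case: (dF x).
Unshelve. all: end_near.
Qed.

Lemma integral_poisson (h t : R) : 0 < h ->
  (\int[mu]_x (h / (h ^+ 2 + (t - x) ^+ 2))%:E = pi%:E)%E.
Proof.
move=> h0; pose G x : R := h / (h ^+ 2 + x ^+ 2).
have hx0 x : 0 < h ^+ 2 + x ^+ 2 by rewrite ltr_pwDl ?sqr_ge0 ?exprn_gt0.
have cG : continuous G.
  move=> x; apply: cvgM; first exact: cvg_cst.
  apply: cvgV; first by rewrite gt_eqF.
  by apply: cvgD; [exact: cvg_cst|exact: exprn_continuous].
have G0 x : 0 <= G x by rewrite divr_ge0 ?ltW.
have -> : (\int[mu]_x (h / (h ^+ 2 + (t - x) ^+ 2))%:E = \int[mu]_x (G x)%:E)%E.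
  have dt : derive1 (fun x : R => x - t) = cst 1.
    by apply/funext => x; rewrite derive1E deriveB// derive_id derive_cst subr0.
  rewrite (@increasing_ge0_integration_by_substitutionT _ (fun x => x - t) G)//.
  - apply: eq_integral => x _; rewrite dt /= /G; congr EFin.
    by rewrite [RHS]mulr1 -[t - x]opprB sqrrN.
  - by move=> x y xy; rewrite ltrD2r.
  - by rewrite dt; exact: cst_continuous.
  - by rewrite dt; exact: is_cvg_cst.
  - by rewrite dt; exact: is_cvg_cst.
  - by apply: cvg_addrr_Ny.
  - by apply: cvg_addrr.
rewrite ge0_symfun_integralT//; last by move=> x; rewrite /G/= sqrrN.
rewrite -set_itvcy.
pose F x : R := atan (x / h).
have h0' : h != 0 by rewrite gt_eqF.
have dF x : is_derive x (1:R) F (G x).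
  rewrite /F /G.
  have d1 : is_derive x (1:R) (fun x => x / h) h^-1.
    by apply: is_derive_eq; rewrite /GRing.scale /=; ring.
  have := @is_derive1_comp _ atan (fun x => x / h) _ _ _ (is_derive1_atan (x / h)) d1.
  move=> dd; apply: (is_derive_eq dd).
  have := hx0 x; rewrite /GRing.scale /= => hx.
  have hx' : h ^+ 2 + x ^+ 2 != 0 by rewrite gt_eqF.
  field. by rewrite h0' hx'.
rewrite (@ge0_continuous_FTC2y _ G F 0 (pi / 2))//.
- by rewrite /F mul0r atan0 sube0 -EFinM; congr EFin; field.
- by apply: continuous_subspaceT.
- rewrite /F; apply: (cvg_comp (fun x => x / h) atan _ (@cvgy_atan R)).
  by apply: gt0_cvgMly; [rewrite invr_gt0|exact: cvg_id].
- have cF : continuous F.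
    by move=> x; apply: differentiable_continuous; apply/derivable1_diffP; case: (dF x).
  exact/cvg_at_right_filter/cF.
- by move=> x _; rewrite derive1E; case: (dF x).
Qed.

End kernels.

(** * Cosine and sine transforms of integrable functions *)

Section trig_transform.
Context {R : realType}.
Local Notation mu := (leb R).
Implicit Types (G : R -> R) (a b h : R).

(** [cosT G - i sinT G] is the Fourier transform of [G] without the factor [1 / sqrt (2 pi)];
    keeping the two parts apart leaves only real integrals. *)
Definition cosT G x : R := \int[mu]_z (G z * cos (z * x)).
Definition sinT G x : R := \int[mu]_z (G z * sin (z * x)).

Lemma integrable_prodM d1 d2 (T1 : measurableType d1) (T2 : measurableType d2)
    (m1 : {sigma_finite_measure set T1 -> \bar R})
    (m2 : {sigma_finite_measure set T2 -> \bar R}) (G1 : T1 -> R) (G2 : T2 -> R) :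
  m1.-integrable setT (EFin \o G1) -> m2.-integrable setT (EFin \o G2) ->
  (m1 \x m2)%E.-integrable setT (fun z : T1 * T2 => (G1 z.1 * G2 z.2)%:E).
Proof.
move=> i1 i2.
have m1G : measurable_fun setT G1 by apply/measurable_EFinP; case/integrableP : i1.
have m2G : measurable_fun setT G2 by apply/measurable_EFinP; case/integrableP : i2.
apply/integrable12ltyP; first by apply/measurable_EFinP; meas.
under eq_integral => x _.
  under eq_integral => y _ do rewrite /= normrM EFinM.
  rewrite ge0_integralZl_EFin//; last by apply/measurable_EFinP; meas.
  over.
case/integrableP : i2 => _ i2.
rewrite ge0_integralZr//; last 2 first.
  by apply/measurable_EFinP; meas.
  exact: integral_ge0.
case/integrableP : i1 => _ i1.
by rewrite lte_mul_pinfty// ?integral_ge0// ge0_fin_numE ?integral_ge0.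
Qed.

Lemma le_integrableR d (T : measurableType d) (m : {measure set T -> \bar R})
    (f g : T -> R) : measurable_fun setT f -> (forall x, `|f x| <= g x) ->
  m.-integrable setT (EFin \o g) -> m.-integrable setT (EFin \o f).
Proof.
move=> mf fg; apply: le_integrable => //; first exact/measurable_EFinP.
by move=> x _ /=; rewrite lee_fin (le_trans (fg x))// ler_norm.
Qed.

Lemma integrable_mfun d (T : measurableType d) (m : {measure set T -> \bar R})
    (f : T -> R) : m.-integrable setT (EFin \o f) -> measurable_fun setT f.
Proof. by move=> /integrableP[/measurable_EFinP]. Qed.

Lemma ge0_integrableR d (T : measurableType d) (m : {measure set T -> \bar R})
    (f : T -> R) : measurable_fun setT f -> (forall x, 0 <= f x) ->
  (\int[m]_x (f x)%:E < +oo)%E -> m.-integrable setT (EFin \o f).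
Proof.
move=> mf f0 fo; apply/integrableP; split; first exact/measurable_EFinP.
rewrite (eq_integral (EFin \o f))// => x _ /=; by rewrite (ger0_norm (f0 x)).
Qed.

Lemma integrableDR d (T : measurableType d) (m : {measure set T -> \bar R})
    (f g : T -> R) : m.-integrable setT (EFin \o f) -> m.-integrable setT (EFin \o g) ->
  m.-integrable setT (EFin \o (fun x => f x + g x)).
Proof. by move=> i1 i2; exact: (integrableD measurableT i1 i2). Qed.

Lemma integrableZR d (T : measurableType d) (m : {measure set T -> \bar R})
    (f : T -> R) a : m.-integrable setT (EFin \o f) ->
  m.-integrable setT (EFin \o (fun x => a * f x)).
Proof. by move=> i1; exact: (integrableZl measurableT a i1). Qed.

Lemma ge0_le_integralR d (T : measurableType d) (m : {measure set T -> \bar R})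
    (f g : T -> R) : measurable_fun setT f -> measurable_fun setT g ->
  (forall x, 0 <= f x) -> (forall x, f x <= g x) ->
  (\int[m]_x (f x)%:E <= \int[m]_x (g x)%:E)%E.
Proof.
move=> mf mg f0 fg; apply: ge0_le_integral => //.
- by move=> x _; rewrite lee_fin.
- exact/measurable_EFinP.
- exact/measurable_EFinP.
- by move=> x _; rewrite lee_fin.
Qed.

Lemma ge0_integral_lin d (T : measurableType d) (m : {measure set T -> \bar R})
    (f g : T -> R) a b : 0 <= a -> 0 <= b ->
  measurable_fun setT f -> measurable_fun setT g ->
  (forall x, 0 <= f x) -> (forall x, 0 <= g x) ->
  (\int[m]_x (a * f x + b * g x)%:E =
   a%:E * \int[m]_x (f x)%:E + b%:E * \int[m]_x (g x)%:E)%E.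
Proof.
move=> a0 b0 mf mg f0 g0; under eq_integral do rewrite EFinD !EFinM.
have mf' : measurable_fun setT (EFin \o f) by exact/measurable_EFinP.
have mg' : measurable_fun setT (EFin \o g) by exact/measurable_EFinP.
rewrite ge0_integralD//; last 4 first.
- by move=> x _; rewrite mule_ge0 ?lee_fin.
- exact: (emeasurable_funM (measurable_cst a%:E) mf').
- by move=> x _; rewrite mule_ge0 ?lee_fin.
- exact: (emeasurable_funM (measurable_cst b%:E) mg').
by congr (_ + _)%E; rewrite ge0_integralZl_EFin// => x _; rewrite lee_fin.
Qed.

Lemma integrable_bddM d (T : measurableType d) (m : {measure set T -> \bar R})
    (f g : T -> R) (M : R) : measurable_fun setT f -> (forall x, `|f x| <= M) ->
  m.-integrable setT (EFin \o g) -> m.-integrable setT (fun x => (g x * f x)%:E).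
Proof.
move=> mf fM ig; have mg := integrable_mfun ig.
apply: (@le_integrableR _ _ _ (fun x => g x * f x) (fun x => M * `|g x|)); first by meas.
  by move=> x; rewrite normrM mulrC ler_wpM2r.
by apply: (@integrableZl _ _ _ _ _ _ M (EFin \o (fun x => `|g x|))) => //; exact: integrable_norm.
Qed.

Lemma normr_trig_le a b x : `|a * cos x + b * sin x| <= `|a| + `|b|.
Proof.
rewrite (le_trans (ler_normD _ _))// !normrM lerD// ler_piMr//.
  by rewrite ler_norml cos_geN1 cos_le1.
by rewrite ler_norml sin_geN1 sin_le1.
Qed.

Lemma integrable_trig G a b x : mu.-integrable setT (EFin \o G) ->
  mu.-integrable setT (fun z => (G z * (a * cos (z * x) + b * sin (z * x)))%:E).
Proof.
apply: (@integrable_bddM _ _ _ _ _ (`|a| + `|b|)); first by meas.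
by move=> z; exact: normr_trig_le.
Qed.

Lemma integrable_cosM G x : mu.-integrable setT (EFin \o G) ->
  mu.-integrable setT (EFin \o (fun z => G z * cos (z * x))).
Proof.
move=> iG; have := integrable_trig 1 0 x iG.
by apply: eq_integrable => // z _ /=; rewrite mul1r mul0r addr0.
Qed.

Lemma integrable_sinM G x : mu.-integrable setT (EFin \o G) ->
  mu.-integrable setT (EFin \o (fun z => G z * sin (z * x))).
Proof.
move=> iG; have := integrable_trig 0 1 x iG.
by apply: eq_integrable => // z _ /=; rewrite mul1r mul0r add0r.
Qed.

Lemma integral_trig G a b x : mu.-integrable setT (EFin \o G) ->
  (\int[mu]_z (G z * (a * cos (z * x) + b * sin (z * x)))%:E =
   (a * cosT G x + b * sinT G x)%:E)%E.
Proof.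
move=> iG.
have ic := integrable_cosM x iG; have is_ := integrable_sinM x iG.
have ica := integrableZl measurableT a ic.
have isb := integrableZl measurableT b is_.
rewrite EFinD !EFinM /cosT /sinT /Rintegral.
rewrite (fineK (integrable_fin_num measurableT ic)) (fineK (integrable_fin_num measurableT is_)).
rewrite -(integralZl measurableT ic) -(integralZl measurableT is_) -integralD//.
by apply: eq_integral => z _ /=; congr EFin; ring.
Qed.

Lemma norm_cosT_le G x : mu.-integrable setT (EFin \o G) ->
  `|cosT G x| <= \int[mu]_z `|G z|.
Proof.
move=> iG; apply: (le_trans (le_normr_Rintegral measurableT (integrable_cosM x iG))).
apply: le_Rintegral => //=.
- exact/integrable_norm/integrable_cosM.
- exact: integrable_norm.
- by move=> z _; rewrite normrM ler_piMr// ler_norml cos_geN1 cos_le1.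
Qed.

Lemma norm_sinT_le G x : mu.-integrable setT (EFin \o G) ->
  `|sinT G x| <= \int[mu]_z `|G z|.
Proof.
move=> iG; apply: (le_trans (le_normr_Rintegral measurableT (integrable_sinM x iG))).
apply: le_Rintegral => //=.
- exact/integrable_norm/integrable_sinM.
- exact: integrable_norm.
- by move=> z _; rewrite normrM ler_piMr// ler_norml sin_geN1 sin_le1.
Qed.

Lemma integrable_laplace h : 0 < h ->
  mu.-integrable setT (EFin \o (fun x => expR (- (h * `|x|)))).
Proof.
move=> h0; apply/integrableP; split; first by apply/measurable_EFinP; meas.
have := integral_laplace_cos 0 h0.
under eq_integral do rewrite mul0r cos0 mulrC EFinM.
rewrite ge0_integralZl_EFin//; last by apply/measurable_EFinP; meas.
move=> E; under eq_integral do rewrite /= ger0_norm ?expR_ge0//.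
move: E; set I := (\int[_]_x _)%E; case: I => [r||] //; first by rewrite ltry.
by rewrite gt0_muley// lte_fin.
Qed.

Lemma integral_laplace h t : 0 < h ->
  (\int[mu]_x (expR (- (h * `|x|)) * cos (t * x))%:E =
   (2 * h / (h ^+ 2 + t ^+ 2))%:E)%E.
Proof.
move=> h0; have il := integrable_laplace h0.
have ic : mu.-integrable setT (fun x => (expR (- (h * `|x|)) * cos (t * x))%:E).
  apply: (@integrable_bddM _ _ _ _ _ 1) => //; first by meas.
  by move=> x; rewrite ler_norml cos_geN1 cos_le1.
have E t' : mu.-integrable setT (fun x => (expR (- (h * `|x|)) * cos (t' * x))%:E) ->
  (\int[mu]_x (expR (- (h * `|x|)))%:E + \int[mu]_x (expR (- (h * `|x|)) * cos (t' * x))%:E =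
   (2 * (h^-1 + h / (h ^+ 2 + t' ^+ 2)))%:E)%E.
  move=> ic'; rewrite -(integral_laplace_cos t' h0) -integralD//.
  by apply: eq_integral => x _; rewrite -EFinD mulrDr mulr1.
have e0 : (\int[mu]_x (expR (- (h * `|x|)) * cos (0 * x))%:E = \int[mu]_x (expR (- (h * `|x|)))%:E)%E.
  by apply: eq_integral => x _; rewrite mul0r cos0 mulr1.
have /E : mu.-integrable setT (fun x => (expR (- (h * `|x|)) * cos (0 * x))%:E).
  by apply: eq_integrable il => // x _; rewrite mul0r cos0 mulr1.
rewrite e0 => e1; have := E _ ic; move: e1.
rewrite -(fineK (integrable_fin_num measurableT ic)) -(fineK (integrable_fin_num measurableT il)).
move=> [e1] [e2]; congr EFin; move: e2.
have -> : fine (\int[mu]_x (EFin \o (fun x => expR (- (h * `|x|)))) x) = 2 / h.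
  apply: (@mulrI _ 2); first by rewrite unitfE.
  rewrite mulr_natl mulr2n e1; field; by rewrite gt_eqF.
set I := fine _; move=> /eqP; rewrite -subr_eq0 => /eqP e2.
apply/eqP; rewrite -subr_eq0 -[X in _ == X]e2; apply/eqP; rewrite !mulrDr mulrA; ring.
Qed.

(** Fubini's theorem gives measurability in the parameter only for a kernel integrable on the plane.
    The factor [e^{-|x|}] makes the kernel integrable and is divided out afterwards. *)
Lemma measurable_trigT G : mu.-integrable setT (EFin \o G) ->
  measurable_fun setT (cosT G) /\ measurable_fun setT (sinT G).
Proof.
move=> iG; have mG := integrable_mfun iG.
have il := @integrable_laplace 1 ltr01.
have key a b : measurable_fun setT (fun x => a * cosT G x + b * sinT G x).
  have iP : (mu \x mu)%E.-integrable setT (fun z : R * R =>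
      ((expR (- (1 * `|z.1|)) * G z.2) * (a * cos (z.2 * z.1) + b * sin (z.2 * z.1)))%:E).
    apply: (@integrable_bddM _ _ (mu \x mu)%E (fun z : R * R => a * cos (z.2 * z.1) + b * sin (z.2 * z.1))
      (fun z : R * R => expR (- (1 * `|z.1|)) * G z.2) (`|a| + `|b|)).
    - by meas.
    - by move=> z; exact: normr_trig_le.
    - exact: (integrable_prodM il iG).
  have mF := measurable_fubini_F iP.
  have -> : (fun x => a * cosT G x + b * sinT G x) =
    (fun x => expR (1 * `|x|) * fine (\int[mu]_z (expR (- (1 * `|x|)) * G z *
       (a * cos (z * x) + b * sin (z * x)))%:E)%E).
    apply/funext => x.
    under eq_integral do rewrite -mulrA EFinM.
    rewrite integralZl//; last exact: integrable_trig.
    by rewrite integral_trig//= mulrA -expRD subrr expR0 mul1r.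
  apply: measurable_funM; first by meas.
  apply: (measurableT_comp _ mF). exact: fine_measurable.
split.
- have := key 1 0; congr measurable_fun; apply/funext => x; ring.
- have := key 0 1; congr measurable_fun; apply/funext => x; ring.
Qed.

(** Abel summation of the Fourier inversion integral: the factor [e^{-h|z|}] makes the double
    integral absolutely convergent, and the formula for the cosine of a difference reduces the inner
    one to [integral_laplace], that is, to twice the Poisson kernel. *)
Lemma integral_abel h G x : 0 < h -> mu.-integrable setT (EFin \o G) ->
  (\int[mu]_z (expR (- (h * `|z|)) * (cosT G z * cos (z * x) + sinT G z * sin (z * x)))%:E =
   \int[mu]_z (G z * (2 * (h / (h ^+ 2 + (x - z) ^+ 2))))%:E)%E.
Proof.
move=> h0 iG; have mG := integrable_mfun iG; have il := integrable_laplace h0.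
have iP : (mu \x mu)%E.-integrable setT (fun z : R * R =>
    ((expR (- (h * `|z.1|)) * G z.2) * (cos (z.1 * x) * cos (z.2 * z.1) + sin (z.1 * x) * sin (z.2 * z.1)))%:E).
  apply: (@integrable_bddM _ _ (mu \x mu)%E
      (fun z : R * R => cos (z.1 * x) * cos (z.2 * z.1) + sin (z.1 * x) * sin (z.2 * z.1))
      (fun z : R * R => expR (- (h * `|z.1|)) * G z.2) (1 + 1)).
  - by meas.
  - move=> z; apply: (le_trans (normr_trig_le _ _ _)).
    by apply: lerD; rewrite ler_norml ?cos_geN1 ?cos_le1 ?sin_geN1 ?sin_le1.
  - exact: (integrable_prodM il iG).
have := Fubini iP.
under eq_integral => z _.
  under eq_integral do rewrite /= -mulrA EFinM.
  rewrite integralZl//; last exact: integrable_trig.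
  rewrite integral_trig// -EFinM [X in _ * X]addrC addrC -[X in _ * (X + _)]mulrC -[X in _ * (_ + X)]mulrC.
  over.
move=> ->; apply: eq_integral => z _ /=.
have E : forall y, expR (- (h * `|y|)) * G z * (cos (y * x) * cos (z * y) + sin (y * x) * sin (z * y)) =
   G z * (expR (- (h * `|y|)) * cos ((x - z) * y)).
  by move=> y; rewrite mulrBl cosB (mulrC x y); ring.
under eq_integral do rewrite E EFinM.
rewrite integralZl//; last first.
  apply: (@integrable_bddM _ _ _ _ _ 1) => //; first by meas.
  by move=> y; rewrite ler_norml cos_geN1 cos_le1.
by rewrite (integral_laplace _ h0) -EFinM; congr EFin; rewrite -!mulrA.
Qed.

End trig_transform.

(** * Tonelli's theorem for functions in curried form *)

Section curried_tonelli.
Context d1 d2 (T1 : measurableType d1) (T2 : measurableType d2) {R : realType}.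
Variables (m1 : {sigma_finite_measure set T1 -> \bar R})
  (m2 : {sigma_finite_measure set T2 -> \bar R}).
Variable f : T1 -> T2 -> \bar R.
Hypothesis mf : measurable_fun setT (fun z : T1 * T2 => f z.1 z.2).
Hypothesis f0 : forall x y, (0 <= f x y)%E.
Local Open Scope ereal_scope.

Lemma measurable_integral2 : measurable_fun setT (fun x => \int[m2]_y f x y).
Proof. exact: (measurable_fun_fubini_tonelli_F (fun z : T1 * T2 => f z.1 z.2)). Qed.

Lemma measurable_integral1 : measurable_fun setT (fun y => \int[m1]_x f x y).
Proof. exact: (measurable_fun_fubini_tonelli_G (fun z : T1 * T2 => f z.1 z.2)). Qed.

Lemma tonelliC : \int[m1]_x \int[m2]_y f x y = \int[m2]_y \int[m1]_x f x y.
Proof. exact: (fubini_tonelli (fun z : T1 * T2 => f z.1 z.2)). Qed.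

Lemma tonelli_prod :
  \int[m1 \x m2]_z f z.1 z.2 = \int[m1]_x \int[m2]_y f x y.
Proof. exact: (fubini_tonelli1 (fun z : T1 * T2 => f z.1 z.2)). Qed.

End curried_tonelli.

(** * Bessel's inequality by Abel summation *)

Section bessel.
Context {R : realType}.
Local Notation mu := (leb R).
Implicit Types (G : R -> R) (a b h : R).
Local Open Scope ereal_scope.

Lemma limn_einf_le (u : (\bar R)^nat) (B : \bar R) :
  (forall n, u n <= B) -> limn_einf u <= B.
Proof.
move=> uB; rewrite limn_einf_lim; apply: lime_le; first exact: is_cvg_einfs.
near=> n; apply: le_trans (uB n); apply: ereal_inf_lbound.
by exists n => //=.
Unshelve. all: end_near. Qed.

Lemma limn_einf_lt (u : (\bar R)^nat) (B : \bar R) (n0 : nat) :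
  limn_einf u < B -> exists2 n, (n0 <= n)%N & u n < B.
Proof.
move=> uB; apply: contrapT => nu.
have Bu n : (n0 <= n)%N -> B <= u n.
  by move=> nn; rewrite leNgt; apply/negP => un; apply: nu; exists n.
move: uB; apply/negP; rewrite -leNgt limn_einf_lim.
apply: lime_ge; first exact: is_cvg_einfs.
near=> n; apply: le_ereal_inf_tmp => _ [m /= nm <-]; apply: Bu.
rewrite (leq_trans _ nm)//; near: n; exact: nbhs_infty_ge.
Unshelve. all: end_near. Qed.

(** [2 |G x| |G z| <= G x ^+ 2 + G z ^+ 2], and the two double integrals that result are equal by
    the symmetry of [k]. *)
Lemma schur_sym G (k : R -> R -> R) (c : R) : (0 <= c)%R ->
  (forall x z, 0 <= k x z)%R -> (forall x z, k x z = k z x) ->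
  measurable_fun setT (fun z : R * R => k z.1 z.2) ->
  (forall x, \int[mu]_z (k x z)%:E = c%:E) -> measurable_fun setT G ->
  \int[mu]_x \int[mu]_z (`|G x| * `|G z| * (2 * k x z))%:E
    <= (2 * c)%:E * \int[mu]_x (G x ^+ 2)%:E.
Proof.
move=> c0 k0 ksym mk kc mG.
have mk1 x : measurable_fun setT (k x) by exact: (measurableT_comp mk (pair1_measurable x)).
apply: (@le_trans _ _ (\int[mu]_x \int[mu]_z ((G x ^+ 2 * k x z)%:E + (G z ^+ 2 * k x z)%:E))).
  apply: ge0_le_integral => //.
  - by move=> x _; apply: integral_ge0 => z _; rewrite lee_fin !mulr_ge0.
  - apply: measurable_integral2 => /=.
      by apply/measurable_EFinP; meas.
    by move=> *; rewrite ?lee_fin !mulr_ge0.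
  - apply: measurable_integral2 => /=.
      by apply: emeasurable_funD; apply/measurable_EFinP; meas.
    by move=> *; apply: adde_ge0; rewrite lee_fin mulr_ge0 ?sqr_ge0.
  move=> x _; apply: ge0_le_integral => //.
  - by move=> z _; rewrite lee_fin !mulr_ge0.
  - by apply/measurable_EFinP; meas.
  - by apply: emeasurable_funD; apply/measurable_EFinP; meas.
  move=> z _; rewrite -EFinD lee_fin -mulrDl mulrA ler_wpM2r//.
  rewrite -(@real_normK _ (G x)) ?num_real// -(@real_normK _ (G z)) ?num_real//.
  rewrite -subr_ge0.
  rewrite [leRHS](_ : _ = (`|G x| - `|G z|) ^+ 2)%R ?sqr_ge0//; ring.
under eq_integral => x _.
  rewrite ge0_integralD//=; last 4 first.
  - by move=> z _; rewrite lee_fin mulr_ge0 ?sqr_ge0.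
  - by apply/measurable_EFinP; meas.
  - by move=> z _; rewrite lee_fin mulr_ge0 ?sqr_ge0.
  - by apply/measurable_EFinP; meas.
  over.
rewrite ge0_integralD//=; last 4 first.
- by move=> x _; apply: integral_ge0 => z _; rewrite lee_fin mulr_ge0 ?sqr_ge0.
- apply: measurable_integral2 => /=.
    by apply/measurable_EFinP; meas.
  by move=> *; rewrite ?lee_fin mulr_ge0 ?sqr_ge0.
- by move=> x _; apply: integral_ge0 => z _; rewrite lee_fin mulr_ge0 ?sqr_ge0.
- apply: measurable_integral2 => /=.
    by apply/measurable_EFinP; meas.
  by move=> *; rewrite ?lee_fin mulr_ge0 ?sqr_ge0.
have E : \int[mu]_x \int[mu]_z (G x ^+ 2 * k x z)%:E = c%:E * \int[mu]_x (G x ^+ 2)%:E.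
  rewrite -ge0_integralZl//; last 2 first.
  - by apply/measurable_EFinP; meas.
  - by move=> x _; rewrite lee_fin sqr_ge0.
  apply: eq_integral => x _.
  under eq_integral do rewrite EFinM.
  rewrite ge0_integralZl//; last 3 first.
  - by apply/measurable_EFinP; meas.
  - by move=> z _; rewrite lee_fin.
  - by rewrite lee_fin sqr_ge0.
  by rewrite kc muleC.
have -> : \int[mu]_x \int[mu]_z (G z ^+ 2 * k x z)%:E = \int[mu]_x \int[mu]_z (G x ^+ 2 * k x z)%:E.
  rewrite tonelliC; last 2 first.
  - by apply/measurable_EFinP; meas.
  - by move=> *; rewrite ?lee_fin mulr_ge0 ?sqr_ge0.
  apply: eq_integral => x _; apply: eq_integral => z _.
  by rewrite ksym.
by rewrite E mulr2n mulrDl mul1r EFinD ge0_muleDl ?lee_fin ?c0.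
Qed.

(** In each square one factor is expanded as an integral of [G]. After Fubini the other factor
    enters through its Abel mean, so [integral_abel] turns the left side into a quadratic form in
    [G] whose kernel is twice the Poisson kernel. The mass of that kernel is [2 pi] for every [h],
    so the bound does not degrade as [h] tends to 0. *)
Lemma bessel_abel G h : (0 < h)%R -> mu.-integrable setT (EFin \o G) ->
  \int[mu]_x (expR (- (h * `|x|)) * (cosT G x ^+ 2 + sinT G x ^+ 2))%:E
    <= (2 * pi)%:E * \int[mu]_x (G x ^+ 2)%:E.
Proof.
move=> h0 iG; have mG := integrable_mfun iG; have il := integrable_laplace h0.
have [mC mS] := measurable_trigT iG.
set M := (\int[mu]_z `|G z|)%R.
have bd (z x : R) : (`|cosT G x * cos (z * x) + sinT G x * sin (z * x)| <= M + M)%R.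
  by rewrite (le_trans (normr_trig_le _ _ _))// lerD ?norm_cosT_le ?norm_sinT_le.
have iP : (mu \x mu).-integrable setT (fun z : R * R =>
    ((expR (- (h * `|z.1|)) * G z.2) *
      (cosT G z.1 * cos (z.2 * z.1) + sinT G z.1 * sin (z.2 * z.1)))%:E).
  apply: (@integrable_bddM _ _ _ (mu \x mu)
      (fun z : R * R => cosT G z.1 * cos (z.2 * z.1) + sinT G z.1 * sin (z.2 * z.1))%R
      (fun z : R * R => expR (- (h * `|z.1|)) * G z.2)%R (M + M)).
  - by meas.
  - by move=> z; exact: bd.
  - exact: (integrable_prodM il iG).
have := Fubini iP.
under eq_integral => x _.
  under eq_integral do rewrite /= -mulrA EFinM.
  rewrite integralZl//; last exact: integrable_trig.
  rewrite integral_trig// -EFinM -!expr2.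
  over.
move=> ->.
pose k (x z : R) : R := (h / (h ^+ 2 + (x - z) ^+ 2))%R.
have k0 x z : (0 <= k x z)%R.
  by apply: divr_ge0; [exact: ltW|rewrite addr_ge0 ?sqr_ge0].
have mk : measurable_fun setT (fun z : R * R => k z.1 z.2) by rewrite /k; meas.
have mk1 x : measurable_fun setT (k x) by exact: (measurableT_comp mk (pair1_measurable x)).
have ksym x z : k x z = k z x by rewrite /k -[(x - z)%R]opprB sqrrN.
apply: le_trans (schur_sym (pi_ge0 R) k0 ksym mk (fun x => integral_poisson x h0) mG).
have kE x z : (h / (h ^+ 2 + (x - z) ^+ 2))%R = k x z by [].
clearbody k.
have mF := measurable_fubini_G iP.
apply: (le_trans (lee_abs _)).
apply: (le_trans (le_abse_integral _ _ mF)) => //.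
apply: ge0_le_integral => //.
- exact: measurableT_comp.
- apply: measurable_integral2 => /=.
    by apply/measurable_EFinP; meas.
  by move=> *; rewrite lee_fin !mulr_ge0.
move=> z _; rewrite /fubini_G.
under eq_integral => x _ do rewrite /= [(_ * G z)%R]mulrC -mulrA EFinM [(z * x)%R]mulrC.
rewrite integralZl//; last first.
  apply: (@integrable_bddM _ _ _ mu _ _ (M + M)%R) => //; first by meas.
  by move=> x; rewrite [(x * z)%R]mulrC; exact: bd.
rewrite (integral_abel _ h0 iG) abseM.
under eq_integral => x _ do rewrite kE.
apply: (@le_trans _ _ (`|(G z)%:E| * \int[mu]_x (`|G x| * (2 * k z x))%:E)).
  apply: lee_wpmul2l => //.
  apply: (le_trans (le_abse_integral _ _ _)) => //.
    by apply/measurable_EFinP; meas.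
  apply: ge0_le_integral => //.
  - by apply/measurable_EFinP; meas.
  - by apply/measurable_EFinP; meas.
  - by move=> x _; rewrite lee_fin normrM [`|2 * _|%R]ger0_norm// !mulr_ge0//.
rewrite -ge0_integralZl//; last 2 first.
  - by apply/measurable_EFinP; meas.
  - by move=> x _; rewrite lee_fin !mulr_ge0.
by apply: ge0_le_integral => //; last (by move=> x _; rewrite -EFinM mulrA); do ?[by apply/measurable_EFinP; meas]; move=> x _; rewrite ?lee_fin ?mule_ge0 ?lee_fin ?mulr_ge0.
Qed.

Lemma bessel_inequality G : mu.-integrable setT (EFin \o G) ->
  \int[mu]_x (cosT G x ^+ 2 + sinT G x ^+ 2)%:E <= (2 * pi)%:E * \int[mu]_x (G x ^+ 2)%:E.
Proof.
move=> iG; have [mC mS] := measurable_trigT iG.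
pose e n (x : R) : \bar R :=
  (expR (- (n.+1%:R^-1 * `|x|)) * (cosT G x ^+ 2 + sinT G x ^+ 2))%:E.
have e0 n x : 0 <= e n x by rewrite lee_fin mulr_ge0 ?expR_ge0 ?addr_ge0 ?sqr_ge0.
have me n : measurable_fun setT (e n) by apply/measurable_EFinP; meas.
have := fatou mu measurableT me (fun n x _ => e0 n x).
rewrite (_ : \int[mu]_x limn_einf (e ^~ x) = \int[mu]_x (cosT G x ^+ 2 + sinT G x ^+ 2)%:E); last first.
  apply: eq_integral => x _.
  suff /cvg_limn_einf_sup[-> _] : e n x @[n --> \oo] --> (cosT G x ^+ 2 + sinT G x ^+ 2)%:E by [].
  apply/fine_cvgP; split; first by near=> n.
  rewrite -[X in _ --> X]mul1r; apply: cvgMr_tmp.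
  rewrite -[X in _ --> X](@expR0 R); apply: continuous_cvg; first exact: continuous_expR.
  rewrite -[X in _ --> X]oppr0 -(mul0r `|x|%R); apply: cvgN; apply: cvgMr_tmp.
  exact: cvg_harmonic.
move/le_trans; apply; apply: limn_einf_le => n; apply: bessel_abel => //.
Unshelve. all: end_near. Qed.

End bessel.

(** * Consequences of an exponential weight in frequency *)

Section spectral_estimates.
Context {R : realType}.
Local Notation mu := (leb R).
Implicit Types (A B w : R -> R) (h : R).

Lemma exprn_le_expR (y : R) n : 0 <= y -> y ^+ n <= n`!%:R * expR y.
Proof.
move=> y0; case: n => [|n]; first by rewrite expr0 fact0 mul1r -expR0 ler_expR.
have f0 : (0 : R) < n.+1`!%:R by rewrite ltr0n fact_gt0.
rewrite mulrC -ler_pdivrMr//; apply: le_trans (expR_ge1Dxn n y0).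
by rewrite lerDr ler01.
Qed.

(** After multiplication by [1 + y] the claim becomes [0 <= 1 - (1 + y) e^{-y} + y ^+ 3], which
    holds because [(1 + y) e^{-y} <= 1]. *)
Lemma expRN_taylor (y : R) : 0 <= y -> `|expR (- y) - 1 + y| <= y ^+ 2.
Proof.
move=> y0; have := expR_ge1Dx (- y); have := expR_ge1Dx y; move=> h1 h2.
have e0 := expR_gt0 (- y).
have h3 : expR (- y) * (1 + y) <= 1.
  by rewrite [leLHS]mulrC -[leRHS](expRxMexpNx_1 y) ler_wpM2r// (ltW e0).
rewrite ger0_norm; last by lra.
have : (1 + y) * (expR (- y) - 1 + y) <= (1 + y) * y ^+ 2.
  rewrite -subr_ge0; rewrite [leRHS](_ : _ = 1 - expR (- y) * (1 + y) + y ^+ 3); last by ring.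
  by rewrite addr_ge0 ?subr_ge0 ?exprn_ge0.
by rewrite ler_pM2l// ltr_pwDl.
Qed.

Lemma integral_expRN : (\int[mu]_z (expR (- `|z|))%:E = 2%:E)%E.
Proof.
have := @integral_laplace R 1 0 ltr01.
under eq_integral do rewrite mul1r mul0r cos0 mulr1.
move=> ->; by rewrite expr0n/= addr0 expr1n mulr1 divr1.
Qed.

Lemma integrable_expRN : mu.-integrable setT (EFin \o (fun z => expR (- `|z|))).
Proof.
have := @integrable_laplace R 1 ltr01.
by apply: eq_integrable => // z _ /=; rewrite mul1r.
Qed.

(** With [y = |z|], the product [2 y ^+ n |A|] is at most [A^2 e^{2y} + y^{2n} e^{-2y}], and
    [y^{2n} <= (2n)! e^y] leaves an integrable majorant. *)
Lemma integrable_expR_weight A n : measurable_fun setT A ->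
  (\int[mu]_z (A z ^+ 2 * expR (2 * `|z|))%:E < +oo)%E ->
  mu.-integrable setT (EFin \o (fun z => `|z| ^+ n * A z)).
Proof.
move=> mA Q; pose c : R := ((2 * n)`!%:R).
have i1 : mu.-integrable setT (EFin \o (fun z => A z ^+ 2 * expR (2 * `|z|))).
  apply: ge0_integrableR => //; first by meas.
  by move=> z; rewrite mulr_ge0 ?sqr_ge0 ?expR_ge0.
apply: (@le_integrableR _ _ _ mu _ (fun z => A z ^+ 2 * expR (2 * `|z|) + c * expR (- `|z|))).
- by meas.
- move=> z; set y := `|z|; have y0 : 0 <= y := normr_ge0 z.
  rewrite normrM normrX normr_id -/y.
  have h1 : (y ^+ n) ^+ 2 * expR (- (2 * y)) <= c * expR (- y).
    rewrite -exprM mulnC (_ : - (2 * y) = - y + - y); last by ring.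
    rewrite expRD mulrA ler_wpM2r ?expR_ge0//.
    rewrite -(ler_pM2r (expR_gt0 y)) -mulrA -expRD addNr expR0 mulr1.
    exact: exprn_le_expR.
  have := sqr_ge0 (`|A z| * expR y - y ^+ n * expR (- y)).
  rewrite sqrrB !exprMn -!expRM_natl real_normK ?num_real// mulrACA -expRD subrr expR0 mulr1.
  rewrite mulrN.
  have := mulr_ge0 (normr_ge0 (A z)) (exprn_ge0 n y0).
  rewrite (mulrC (y ^+ n)) => h2 h3.
  have : 0 <= (A z ^+ 2) * expR (2 * y) by rewrite mulr_ge0 ?sqr_ge0 ?expR_ge0.
  have : 0 <= c * expR (-y) by rewrite mulr_ge0 ?expR_ge0.
  lra.
- apply: integrableDR => //.
  exact: (integrableZR _ integrable_expRN).
Qed.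

(** Both bounds pass through the intermediate weight: [2 e^{|z|} <= 1/r + r e^{2|z|}] makes the
    integral of [2 A^2 e^{|z|}] at most [(c + Q) r]. The first then follows from [z^2 <= 2 e^{|z|}],
    the second from the inequality of arithmetic and geometric means for [|A| e^{|z|}] and
    [s = sqrt r]. *)
Lemma spectral_interpolation A (c Q r : R) : 0 < r -> 0 <= c -> 0 <= Q ->
  measurable_fun setT A ->
  (\int[mu]_z (A z ^+ 2)%:E <= (c * r ^+ 2)%:E)%E ->
  (\int[mu]_z (A z ^+ 2 * expR (2 * `|z|))%:E <= Q%:E)%E ->
  (\int[mu]_z ((`|z| * A z) ^+ 2)%:E <= ((c + Q) * r)%:E)%E /\
  (\int[mu]_z `|A z|%:E <= ((c + Q + 1) * Num.sqrt r)%:E)%E.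
Proof.
move=> r0 c0 Q0 mA h1 h2; set s := Num.sqrt r.
have s0 : 0 < s by rewrite sqrtr_gt0.
have sr : s ^+ 2 = r by rewrite sqr_sqrtr// ltW.
have m1 : measurable_fun setT (fun z => A z ^+ 2) by meas.
have m2 : measurable_fun setT (fun z => A z ^+ 2 * expR (2 * `|z|)) by meas.
have p1 z : 0 <= A z ^+ 2 by rewrite sqr_ge0.
have p2 z : 0 <= A z ^+ 2 * expR (2 * `|z|) by rewrite mulr_ge0 ?expR_ge0.
have p3 z : 0 <= 2 * (A z ^+ 2 * expR `|z|).
  by apply: mulr_ge0 => //; apply: mulr_ge0; rewrite ?expR_ge0.
have eAM (z : R) : 2 * expR `|z| <= r^-1 + r * expR (2 * `|z|).
  rewrite -(ler_pM2l r0) mulrDr divff ?gt_eqF// expRM_natl.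
  rewrite -subr_ge0 [leRHS](_ : _ = (1 - r * expR `|z|) ^+ 2) ?sqr_ge0//; ring.
have hW : (\int[mu]_z (2 * (A z ^+ 2 * expR `|z|))%:E <= ((c + Q) * r)%:E)%E.
  apply: (@le_trans _ _ (\int[mu]_z (r^-1 * A z ^+ 2 + r * (A z ^+ 2 * expR (2 * `|z|)))%:E)%E).
    apply: ge0_le_integralR => //; [by meas|by meas|].
    move=> z; have := ler_wpM2l (p1 z) (eAM z); lra.
  rewrite ge0_integral_lin ?invr_ge0 ?(ltW r0)//.
  apply: (@le_trans _ _ (r^-1%:E * (c * r ^+ 2)%:E + r%:E * Q%:E)%E).
    by apply: leeD; apply: lee_wpmul2l => //; rewrite lee_fin ?invr_ge0 (ltW r0).
  rewrite -!EFinM -EFinD lee_fin le_eqVlt; apply/orP; left; apply/eqP; field.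
  by rewrite gt_eqF.
split.
  apply: le_trans hW; apply: ge0_le_integralR; [by meas|by meas| |].
    by move=> z; rewrite sqr_ge0.
  move=> z; rewrite exprMn [leLHS]mulrC [leRHS]mulrCA ler_wpM2l//.
  exact: (exprn_le_expR 2 (normr_ge0 z)).
apply: (@le_trans _ _ (\int[mu]_z ((2 * s)^-1 * (2 * (A z ^+ 2 * expR `|z|)) + (s / 2) * expR (- `|z|))%:E)%E).
  apply: ge0_le_integralR; [by meas|by meas| |].
    by move=> z.
  move=> z; have := sqr_ge0 (`|A z| * expR `|z| - s).
  rewrite sqrrB exprMn real_normK ?num_real// => h.
  have e0 := expR_gt0 `|z|.
  rewrite expRN -(ler_pM2r (mulr_gt0 s0 e0)).
  rewrite [leRHS](_ : _ = A z ^+ 2 * expR `|z| ^+ 2 + s ^+ 2 / 2).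
    move: h; rewrite mulr2n; nra.
  by field; rewrite !gt_eqF.
rewrite ge0_integral_lin; last 6 first.
- by rewrite invr_ge0 mulr_ge0 // ltW.
- by rewrite divr_ge0 // ltW.
- by meas.
- by meas.
- exact: p3.
- by move=> z; rewrite expR_ge0.
rewrite integral_expRN.
apply: (@le_trans _ _ ((2 * s)^-1%:E * ((c + Q) * r)%:E + (s / 2)%:E * 2%:E)%E).
  by apply: leeD => //; apply: lee_wpmul2l => //; rewrite lee_fin invr_ge0 mulr_ge0 // ltW.
rewrite -!EFinM -EFinD lee_fin -sr.
rewrite (_ : _ + _ = (c + Q) * s / 2 + s); last by field; rewrite gt_eqF.
have := mulr_ge0 (addr_ge0 c0 Q0) (ltW s0); lra.
Qed.

End spectral_estimates.

(** * Second-order expansion of the Poisson extension at the boundary *)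

Section poisson_expansion.
Context {R : realType}.
Local Notation mu := (leb R).
Implicit Types (A B w : R -> R) (h : R).

Lemma trigT_taylor A w h : 0 < h -> measurable_fun setT w ->
  (forall z, `|w z| <= 1) ->
  mu.-integrable setT (EFin \o (fun z => `|z| ^+ 0 * A z)) ->
  mu.-integrable setT (EFin \o (fun z => `|z| ^+ 1 * A z)) ->
  mu.-integrable setT (EFin \o (fun z => `|z| ^+ 2 * A z)) ->
  `|\int[mu]_z (expR (- (h * `|z|)) * A z * w z) - \int[mu]_z (A z * w z) +
     h * \int[mu]_z (`|z| * A z * w z)| <=
  h ^+ 2 * \int[mu]_z `|(`|z| ^+ 2 * A z)|.
Proof.
move=> h0 mw w1 i0 i1 i2.
have iA : mu.-integrable setT (EFin \o A).
  by apply: eq_integrable i0 => // z _ /=; rewrite expr0 mul1r.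
have mA := integrable_mfun iA.
have i0w : mu.-integrable setT (EFin \o (fun z => A z * w z)).
  exact: (@integrable_bddM _ _ _ mu _ _ 1).
have i1w : mu.-integrable setT (EFin \o (fun z => `|z| * A z * w z)).
  by apply: (@integrable_bddM _ _ _ mu w (fun z => `|z| * A z) 1) => //.
have iew : mu.-integrable setT (EFin \o (fun z => expR (- (h * `|z|)) * A z * w z)).
  apply: (@le_integrableR _ _ _ mu _ (fun z => `|A z|)); first by meas.
    move=> z; rewrite !normrM (ger0_norm (expR_ge0 _)) -mulrA.
    have e1 : expR (- (h * `|z|)) <= 1.
      by rewrite -[leRHS](@expR0 R) ler_expR oppr_le0 mulr_ge0 ?(ltW h0).
    by rewrite (le_trans (ler_piMl _ e1))// ler_piMr.
  exact: integrable_norm.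
have iN : mu.-integrable setT (EFin \o (fun z => `|(`|z| ^+ 2 * A z)|)) by exact: integrable_norm.
have ih := integrableZR h i1w.
rewrite -(RintegralZl h measurableT i1w) -(RintegralB measurableT iew i0w).
have iB : mu.-integrable setT (EFin \o (fun z => expR (- (h * `|z|)) * A z * w z - A z * w z)).
  exact: (integrableB measurableT iew i0w).
rewrite -(RintegralD measurableT iB ih) -(RintegralZl _ measurableT iN).
have iS := integrableDR iB ih.
apply: (le_trans (le_normr_Rintegral measurableT iS)).
apply: le_Rintegral => //=.
- exact: integrable_norm.
- exact: integrableZR.
move=> z _.
rewrite [X in `|X|](_ : _ = (expR (- (h * `|z|)) - 1 + h * `|z|) * A z * w z); last by ring.
have hz : 0 <= h * `|z| by rewrite mulr_ge0// ltW.
rewrite [X in _ <= _ * X]normrM (ger0_norm (sqr_ge0 _)) [leRHS]mulrA -exprMn.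
rewrite normrM (le_trans (ler_piMr _ (w1 z)))// normrM ler_wpM2r//.
exact: expRN_taylor.
Qed.

Lemma integral_trig2 A B x : mu.-integrable setT (EFin \o A) ->
  mu.-integrable setT (EFin \o B) ->
  (\int[mu]_z (A z * cos (z * x) + B z * sin (z * x))%:E =
   (cosT A x + sinT B x)%:E)%E.
Proof.
move=> iA iB; have ic := integrable_trig 1 0 x iA; have is_ := integrable_trig 0 1 x iB.
have := integralD measurableT ic is_.
rewrite (integral_trig _ _ _ iA) (integral_trig _ _ _ iB) !mul1r !mul0r addr0 add0r => e.
rewrite EFinD -e.
by apply: eq_integral => z _ /=; rewrite -EFinD; congr EFin; ring.
Qed.

Definition poissonE (d : R -> R) x h : R :=
  \int[mu]_xi (green_eta x (1 + h) xi 1 * d xi).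

Lemma poissonE_spectral d x h : 0 < h -> mu.-integrable setT (EFin \o d) ->
  mu.-integrable setT (EFin \o cosT d) -> mu.-integrable setT (EFin \o sinT d) ->
  poissonE d x h = (2 * pi)^-1 * (cosT (fun z => expR (- (h * `|z|)) * cosT d z) x +
    sinT (fun z => expR (- (h * `|z|)) * sinT d z) x).
Proof.
move=> h0 id iA iB.
have iE G : mu.-integrable setT (EFin \o G) ->
    mu.-integrable setT (EFin \o (fun z => expR (- (h * `|z|)) * G z)).
  move=> iG; have mG := integrable_mfun iG.
  apply: (@le_integrableR _ _ _ mu _ (fun z => `|G z|)); first by meas.
    move=> z; rewrite !normrM (ger0_norm (expR_ge0 _)) ler_piMl//.
    by rewrite -[leRHS](@expR0 R) ler_expR oppr_le0 mulr_ge0 ?(ltW h0).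
  exact: integrable_norm.
have := integral_abel x h0 id.
have -> : (\int[mu]_z (expR (- (h * `|z|)) *
    (cosT d z * cos (z * x) + sinT d z * sin (z * x)))%:E = \int[mu]_z
    (expR (- (h * `|z|)) * cosT d z * cos (z * x) + expR (- (h * `|z|)) * sinT d z * sin (z * x))%:E)%E.
  by apply: eq_integral => z _; congr EFin; ring.
rewrite (integral_trig2 _ (iE _ iA) (iE _ iB)) => e.
rewrite /poissonE -[X in _ = _ * X]/(fine (_%:E)) e -/(Rintegral _ _ _) -RintegralZl//.
  apply: eq_Rintegral => z _; rewrite green_eta1E; last by rewrite ltrDl.
  rewrite (_ : 1 + h - 1 = h); last by ring.
  rewrite [_ ^+ 2 + h ^+ 2]addrC.
  have p0 : (pi : R) != 0 by rewrite gt_eqF ?pi_gt0.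
  have d0 : h ^+ 2 + (x - z) ^+ 2 != 0 by rewrite gt_eqF// ltr_pwDl ?sqr_ge0 ?exprn_gt0.
  move: (pi : R) p0 => q q0; field.
  by rewrite q0 d0.
have d0 z : 0 < h ^+ 2 + (x - z) ^+ 2 by rewrite ltr_pwDl ?sqr_ge0 ?exprn_gt0.
apply: (@integrable_bddM _ _ _ mu _ _ (2 * h^-1)) => //; first by meas.
move=> z; rewrite normrM ger0_norm// ler_wpM2l// ger0_norm; last by rewrite divr_ge0 ?(ltW h0) ?(ltW (d0 z)).
rewrite ler_pdivrMr// (_ : h^-1 * _ = h + h^-1 * (x - z) ^+ 2); last by field; rewrite gt_eqF.
by rewrite lerDl mulr_ge0 ?sqr_ge0 ?invr_ge0 ?(ltW h0).
Qed.

(** Real form of the inverse Fourier integral of [A - i B] when [A] is even and [B] odd; the whole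
    factor [1 / (2 pi)] sits here because [cosT] and [sinT] carry none. *)
Definition inverseT A B x : R := (2 * pi)^-1 * (cosT A x + sinT B x).

(** On the Fourier side, moving up by [h] is multiplication by [e^{-h|z|}], which is at most 1 and
    equals [1 - h|z|] up to [(h|z|)^2]. The errors are uniform in [x]; the prefactor [1 / (2 pi)] is
    bounded by 1. *)
Lemma poissonE_expansion d :
  mu.-integrable setT (EFin \o d) ->
  (\int[mu]_z (cosT d z ^+ 2 * expR (2 * `|z|))%:E < +oo)%E ->
  (\int[mu]_z (sinT d z ^+ 2 * expR (2 * `|z|))%:E < +oo)%E ->
  (forall x h, 0 < h -> `|poissonE d x h| <= \int[mu]_z `|cosT d z| + \int[mu]_z `|sinT d z|) /\
  (exists k : R, forall x h, 0 < h ->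
     `|poissonE d x h - inverseT (cosT d) (sinT d) x +
       h * inverseT (fun z => `|z| * cosT d z) (fun z => `|z| * sinT d z) x| <= k * h ^+ 2).
Proof.
move=> id QA QB; have [mA mB] := measurable_trigT id.
have iAn n := integrable_expR_weight n mA QA.
have iBn n := integrable_expR_weight n mB QB.
have iA : mu.-integrable setT (EFin \o cosT d).
  by have := iAn 0%N; apply: eq_integrable => // z _ /=; rewrite expr0 mul1r.
have iB : mu.-integrable setT (EFin \o sinT d).
  by have := iBn 0%N; apply: eq_integrable => // z _ /=; rewrite expr0 mul1r.
have p1 : (2 * pi : R)^-1 <= 1.
  by rewrite invf_le1 ?mulr_gt0 ?pi_gt0//; have := @pi_ge2 R; lra.
have p0 : 0 <= (2 * pi : R)^-1 by rewrite invr_ge0 mulr_ge0 ?pi_ge0.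
split.
  move=> x h h0; rewrite (poissonE_spectral _ h0 id iA iB).
  rewrite normrM (ger0_norm p0).
  have e1 z : expR (- (h * `|z|)) <= 1.
    by rewrite -[leRHS](@expR0 R) ler_expR oppr_le0 mulr_ge0 ?(ltW h0).
  have bd G : mu.-integrable setT (EFin \o G) ->
     mu.-integrable setT (EFin \o (fun z => expR (- (h * `|z|)) * G z)) /\
     \int[mu]_z `|expR (- (h * `|z|)) * G z| <= \int[mu]_z `|G z|.
    move=> iG; have mG := integrable_mfun iG.
    have iE : mu.-integrable setT (EFin \o (fun z => expR (- (h * `|z|)) * G z)).
      apply: (@le_integrableR _ _ _ mu _ (fun z => `|G z|)); first by meas.
        by move=> z; rewrite !normrM (ger0_norm (expR_ge0 _)) ler_piMl.
      exact: integrable_norm.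
    split => //; apply: le_Rintegral => //=.
    - exact: integrable_norm.
    - exact: integrable_norm.
    - by move=> z _; rewrite !normrM (ger0_norm (expR_ge0 _)) ler_piMl.
  have [iA' lA] := bd _ iA; have [iB' lB] := bd _ iB.
  apply: (le_trans (ler_piMl (normr_ge0 _) p1)); apply: (le_trans (ler_normD _ _)); apply: lerD.
    exact: le_trans (norm_cosT_le _ iA') lA.
  exact: le_trans (norm_sinT_le _ iB') lB.
exists (\int[mu]_z `|(`|z| ^+ 2 * cosT d z)| + \int[mu]_z `|(`|z| ^+ 2 * sinT d z)|) => x h h0.
rewrite (poissonE_spectral _ h0 id iA iB) /inverseT.
rewrite [X in `|X|](_ : _ = (2 * pi)^-1 *
  ((cosT (fun z => expR (- (h * `|z|)) * cosT d z) x - cosT (cosT d) x + h * cosT (fun z => `|z| * cosT d z) x) +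
   (sinT (fun z => expR (- (h * `|z|)) * sinT d z) x - sinT (sinT d) x + h * sinT (fun z => `|z| * sinT d z) x))); last by ring.
rewrite normrM (ger0_norm p0) (le_trans (ler_piMl _ p1))// (le_trans (ler_normD _ _))// mulrDl lerD//.
- rewrite [leRHS]mulrC; apply: (@trigT_taylor (cosT d) (fun z => cos (z * x))) => //; first by meas.
  by move=> z; rewrite ler_norml cos_geN1 cos_le1.
- rewrite [leRHS]mulrC; apply: (@trigT_taylor (sinT d) (fun z => sin (z * x))) => //; first by meas.
  by move=> z; rewrite ler_norml sin_geN1 sin_le1.
Qed.

End poisson_expansion.

(** * Pointwise and integral bounds on the Green function *)

Section green_bounds.
Context {R : realType}.
Local Notation mu := (leb R).
Implicit Types (x y xi eta : R).

(** [V] and [W] are the squared distances from [(x, y)] to [(xi, eta)] and to its mirror image in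
    the line [y = 1]. All bounds rest on [WV]. *)
Let V x y xi eta : R := (x - xi) ^+ 2 + (y - eta) ^+ 2.
Let W x y xi eta : R := (x - xi) ^+ 2 + (y + eta - 2) ^+ 2.

Let V_ge0 x y xi eta : 0 <= V x y xi eta.
Proof. by rewrite addr_ge0 ?sqr_ge0. Qed.

Let WV x y xi eta : W x y xi eta = V x y xi eta + 4 * ((y - 1) * (eta - 1)).
Proof. by rewrite /W /V; ring. Qed.

Let hs_gt0 y eta : 1 < y -> 1 < eta -> 0 < (y - 1) * (eta - 1).
Proof. by move=> y1 e1; rewrite mulr_gt0 ?subr_gt0. Qed.

Let W_gt0 x y xi eta : 1 < y -> 1 < eta -> 0 < W x y xi eta.
Proof.
by move=> y1 e1; rewrite WV ltr_wpDl// mulr_gt0// hs_gt0.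
Qed.

Let pi4 : 0 < (4 * pi : R)^-1.
Proof. by rewrite invr_gt0 mulr_gt0 ?pi_gt0. Qed.

Let piE (a : R) : pi^-1 * a = (4 * pi)^-1 * (4 * a).
Proof. by rewrite invfM mulrACA mulVf// mul1r. Qed.

Lemma greenC x y xi eta : green x y xi eta = green xi eta x y.
Proof.
rewrite /green; congr (_ * ln (_ / _)); first by ring.
by ring.
Qed.

Let green0 x y xi eta : V x y xi eta = 0 -> green x y xi eta = 0.
Proof. by move=> v0; rewrite /green -/(V x y xi eta) v0 mul0r ln0// mulr0. Qed.

Lemma green_ge0 x y xi eta : 1 < y -> 1 < eta -> 0 <= green x y xi eta.
Proof.
move=> y1 e1; rewrite /green mulNr oppr_ge0 mulr_ge0_le0 ?(ltW pi4)//.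
apply: ln_le0; rewrite -/(V x y xi eta) -/(W x y xi eta).
rewrite ler_pdivrMr ?W_gt0// mul1r WV lerDl.
by rewrite mulr_ge0 // ltW // hs_gt0.
Qed.

(** By [WV] the ratio [W / V] is [1 + 4 (y - 1) (eta - 1) / V], and [ln (1 + t) <= t]. At the pole
    both sides are 0 by the conventions for [ln 0] and [0^-1]. The same inequality applied to
    [V / W] gives [green_ge]. *)
Lemma green_le x y xi eta : 1 < y -> 1 < eta ->
  green x y xi eta <= pi^-1 * ((y - 1) * (eta - 1) / V x y xi eta).
Proof.
move=> y1 e1; have := V_ge0 x y xi eta; rewrite le_eqVlt => /orP[/eqP v0|v0].
  by rewrite green0// -v0 invr0 !mulr0.
have hs := hs_gt0 y1 e1; have w0 := W_gt0 x xi y1 e1.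
have pn : (pi : R) != 0 by rewrite gt_eqF ?pi_gt0.
rewrite /green -/(V x y xi eta) -/(W x y xi eta) mulNr -mulrN -lnV ?posrE ?divr_gt0//.
rewrite invf_div.
have -> : W x y xi eta / V x y xi eta = 1 + 4 * ((y - 1) * (eta - 1) / V x y xi eta).
  by rewrite WV; field; rewrite gt_eqF.
have q0 : 0 < 4 * ((y - 1) * (eta - 1) / V x y xi eta) by rewrite mulr_gt0// divr_gt0.
rewrite piE ler_pM2l//; apply: le_ln1Dx; exact: lt_trans (ltrN10 _) q0.
Qed.

Lemma green_ge x y xi eta : 1 < y -> 1 < eta -> 0 < V x y xi eta ->
  pi^-1 * ((y - 1) * (eta - 1) / W x y xi eta) <= green x y xi eta.
Proof.
move=> y1 e1 v0.
have hs := hs_gt0 y1 e1; have w0 := W_gt0 x xi y1 e1.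
have pn : (pi : R) != 0 by rewrite gt_eqF ?pi_gt0.
rewrite /green -/(V x y xi eta) -/(W x y xi eta) mulNr lerNr.
have -> : V x y xi eta / W x y xi eta = 1 + - (4 * ((y - 1) * (eta - 1) / W x y xi eta)).
  have := WV x y xi eta; move/eqP; rewrite -subr_eq => /eqP <-; field; by rewrite gt_eqF.
rewrite piE -[leRHS]mulrN ler_pM2l//; apply: le_ln1Dx.
by rewrite ltrN2 mulrA ltr_pdivrMr// mul1r WV ltrDr.
Qed.

Lemma green_le_poisson e x y xi eta : 0 < e -> 1 < y -> (1 + e) * (y - 1) <= eta - 1 ->
  green x y xi eta <= ((1 + e) / e) ^+ 2 / pi *
    ((y - 1) * ((eta - 1) / ((x - xi) ^+ 2 + (1 - eta) ^+ 2))).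
Proof.
move=> e0 y1 ye; have h0 : 0 < y - 1 by rewrite subr_gt0.
have s0 : 0 < eta - 1 by apply: lt_le_trans ye; rewrite mulr_gt0// ltr_wpDl.
have e1 : 1 < eta by rewrite -subr_gt0.
have e1' : 0 < 1 + e by rewrite ltr_wpDl.
apply: (le_trans (green_le _ _ y1 e1)).
have D0 : 0 < (x - xi) ^+ 2 + (1 - eta) ^+ 2.
  by rewrite -[1 - eta]opprB sqrrN ltr_wpDl ?sqr_ge0// exprn_gt0.
have se : e / (1 + e) * (eta - 1) <= eta - y.
  rewrite mulrAC ler_pdivrMr//; move: ye; set h := y - 1; set s := eta - 1.
  by rewrite (_ : eta - y = s - h) /s /h; [nra|ring].
have q0 : 0 <= e / (1 + e) by rewrite divr_ge0 ?ltW.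
have q1 : e / (1 + e) <= 1 by rewrite ler_pdivrMr// mul1r lerDr.
have key : (e / (1 + e)) ^+ 2 * ((x - xi) ^+ 2 + (1 - eta) ^+ 2) <= V x y xi eta.
  rewrite mulrDr /V lerD//.
    by rewrite ler_piMl ?sqr_ge0// exprn_ile1.
  rewrite -[1 - eta]opprB sqrrN -exprMn -[y - eta]opprB sqrrN ler_sqr ?nnegrE//.
    by rewrite mulr_ge0// ltW.
  by apply: le_trans se; rewrite mulr_ge0// ltW.
have V0 : 0 < V x y xi eta.
  by apply: lt_le_trans key; rewrite mulr_gt0// exprn_gt0// divr_gt0.
have qD : 0 < (e / (1 + e)) ^+ 2 * ((x - xi) ^+ 2 + (1 - eta) ^+ 2).
  by rewrite mulr_gt0// exprn_gt0// divr_gt0.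
rewrite [leRHS](_ : _ = pi^-1 * ((y - 1) * (eta - 1) *
   ((e / (1 + e)) ^+ 2 * ((x - xi) ^+ 2 + (1 - eta) ^+ 2))^-1)).
  rewrite ler_wpM2l ?invr_ge0 ?pi_ge0// ler_wpM2l ?(ltW (hs_gt0 y1 e1))//.
  by rewrite lef_pV2 ?posrE.
move: (pi : R)^-1 => q; field.
by rewrite !gt_eqF.
Qed.

(** Here [4 (y - 1) (eta - 1) <= 8 (y - 1)^2 <= (3 (y - 1))^2] and [V >= (x - xi)^2]. The bound
    depends on [x] only through [xi - x], and its integral in [x] is explicit. *)
Lemma green_le_log x y xi eta : 1 < y -> 1 < eta -> eta - 1 <= 2 * (y - 1) -> x != xi ->
  green x y xi eta <= (4 * pi)^-1 * ln (1 + (3 * (y - 1)) ^+ 2 / (xi - x) ^+ 2).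
Proof.
move=> y1 e1 ey xxi; have h0 : 0 < y - 1 by rewrite subr_gt0.
have s0 : 0 < eta - 1 by rewrite subr_gt0.
have a0 : 0 < (x - xi) ^+ 2 by rewrite lt_def sqrf_eq0 subr_eq0 xxi sqr_ge0.
have v0 : 0 < V x y xi eta by rewrite ltr_pwDl// sqr_ge0.
have hs := hs_gt0 y1 e1; have w0 := W_gt0 x xi y1 e1.
rewrite /green -/(V x y xi eta) -/(W x y xi eta) mulNr -mulrN -lnV ?posrE ?divr_gt0//.
rewrite invf_div ler_pM2l// -[xi - x]opprB sqrrN.
have b0 : 0 <= (3 * (y - 1)) ^+ 2 / (x - xi) ^+ 2 by rewrite divr_ge0 ?sqr_ge0.
rewrite ler_ln ?posrE ?divr_gt0//; last by rewrite ltr_pwDl.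
rewrite ler_pdivrMr// mulrDl mul1r WV lerD2l.
apply: (@le_trans _ _ ((3 * (y - 1)) ^+ 2)); first by nra.
rewrite mulrAC ler_pdivlMr// ler_wpM2l ?sqr_ge0//.
by rewrite lerDl sqr_ge0.
Qed.

(** The logarithm is the integral over [t] in [[0, c]] of [2 t / (t^2 + (xi - x)^2)]; after Tonelli,
    the integral in [x] is twice a Poisson integral, hence [2 pi] for each [t > 0]. *)
Lemma integral_log_kernel (c xi : R) : 0 < c ->
  (\int[mu]_x (ln (1 + c ^+ 2 / (xi - x) ^+ 2))%:E <= (2 * pi * c)%:E)%E.
Proof.
move=> c0; pose k (x t : R) : R := \1_(`[0, c] : set R) t * (2 * (t / (t ^+ 2 + (xi - x) ^+ 2))).
have k0 x t : 0 <= k x t.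
  rewrite /k indicE; have [|_] := boolP (t \in _); last by rewrite mul0r.
  rewrite inE/= in_itv/= => /andP[t0 _].
  by apply: mulr_ge0 => //; apply: mulr_ge0 => //; apply: divr_ge0 => //; rewrite addr_ge0 ?sqr_ge0.
have mi : measurable_fun setT (\1_(`[0, c] : set R) : R -> R) by apply: measurable_indic.
have mk : measurable_fun setT (fun z : R * R => k z.1 z.2) by rewrite /k; meas.
have L0 x : 0 <= ln (1 + c ^+ 2 / (xi - x) ^+ 2) by rewrite ln_ge0// lerDl divr_ge0 ?sqr_ge0.
have kE x t : k x t = \1_(`[0, c] : set R) t * (2 * (t / (t ^+ 2 + (xi - x) ^+ 2))) by [].
clearbody k.
apply: (@le_trans _ _ (\int[mu]_x \int[mu]_t (k x t)%:E)%E).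
  apply: ge0_le_integral => //.
  - by move=> x _; rewrite lee_fin.
  - by apply/measurable_EFinP; meas.
  - apply: measurable_integral2 => /=; first by apply/measurable_EFinP; meas.
    by move=> *; rewrite lee_fin.
  move=> x _; have [->|xxi] := eqVneq x xi.
    by rewrite subrr expr0n/= invr0 mulr0 addr0 ln1 integral_ge0// => t _; rewrite lee_fin.
  have a0 : 0 < (xi - x) ^+ 2 by rewrite lt_def sqrf_eq0 subr_eq0 eq_sym xxi sqr_ge0.
  pose F (t : R) := ln (t ^+ 2 + (xi - x) ^+ 2).
  pose f (t : R) := 2 * (t / (t ^+ 2 + (xi - x) ^+ 2)).
  have p0 (t : R) : 0 < t ^+ 2 + (xi - x) ^+ 2 by rewrite ltr_wpDl ?sqr_ge0.
  have dF t : is_derive t (1:R) F (f t).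
    have d1 : is_derive t (1:R) (fun t => t ^+ 2 + (xi - x) ^+ 2) (2 * t).
      by apply: is_derive_eq; rewrite /GRing.scale /=; ring.
    have := @is_derive1_comp _ (@ln R) (fun t => t ^+ 2 + (xi - x) ^+ 2) _ _ _ (is_derive1_ln (p0 t)) d1.
    by move=> dd; apply: (is_derive_eq dd); rewrite /f; ring.
  have cF : continuous F.
    by move=> t; apply: differentiable_continuous; apply/derivable1_diffP; case: (dF t).
  have cf : continuous f.
    move=> t; apply: cvgM; first exact: cvg_cst.
    apply: cvgM; first exact: cvg_id.
    apply: cvgV; first by rewrite gt_eqF.
    by apply: cvgD; [exact: exprn_continuous|exact: cvg_cst].
  have := @continuous_FTC2 _ f F 0 c c0.
  have -> : (\int[mu]_(t in `[0%R, c]) (f t)%:E = \int[mu]_t (k x t)%:E)%E.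
    rewrite integral_mkcond; apply: eq_integral => t _.
    by rewrite patchE kE indicE; case: ifP => _; rewrite ?mul1r ?mul0r.
  move=> ->.
  - rewrite /F expr0n/= add0r -EFinB lee_fin -ln_div ?posrE//.
    by rewrite mulrDl divff ?gt_eqF// addrC.
  - exact: continuous_subspaceT.
  - split; [by move=> t _; case: (dF t)|exact/cvg_at_right_filter/cF|exact/cvg_at_left_filter/cF].
  - by move=> t _; rewrite derive1E; case: (dF t).
rewrite tonelliC; last 2 first.
- by apply/measurable_EFinP; meas.
- by move=> *; rewrite lee_fin.
apply: (@le_trans _ _ (\int[mu]_t ((2 * pi) * \1_(`[0, c] : set R) t)%:E)%E).
  apply: ge0_le_integral => //.
  - by move=> t _; apply: integral_ge0 => x _; rewrite lee_fin.
  - apply: measurable_integral1 => /=; first by apply/measurable_EFinP; meas.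
    by move=> *; rewrite lee_fin.
  - by apply/measurable_EFinP; meas.
  move=> t _; under eq_integral do rewrite kE.
  rewrite indicE; have [|_] := boolP (t \in _); last first.
    by under eq_integral do rewrite mul0r; rewrite integral0 mulr0.
  rewrite inE/= in_itv/= => /andP[t0 _].
  under eq_integral do rewrite mul1r.
  move: t0; rewrite le_eqVlt => /orP[/eqP <-|t0].
    under eq_integral do rewrite mul0r mulr0.
    by rewrite integral0 lee_fin mulr1 mulr_ge0 ?pi_ge0.
  have d0 x : 0 < t ^+ 2 + (xi - x) ^+ 2 by rewrite ltr_pwDl ?sqr_ge0 ?exprn_gt0.
  under eq_integral do rewrite EFinM.
  rewrite ge0_integralZl_EFin//; last 2 first.
  - by move=> x _; rewrite lee_fin divr_ge0 // ltW.
  - by apply/measurable_EFinP; meas.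
  by rewrite (integral_poisson _ t0) -EFinM mulr1.
under eq_integral do rewrite EFinM.
rewrite ge0_integralZl_EFin//; last 2 first.
- exact/measurable_EFinP.
- by rewrite mulr_ge0 ?pi_ge0.
have E : mu (`[0%R, c]%classic : set R) = c%:E.
  by rewrite lebesgue_measure_itv/= lte_fin c0 -EFinB subr0.
by rewrite integral_indic// setIT [X in (_ * X)%E]E -EFinM.
Qed.

(** The logarithmic bound holds off the null set [x = xi] and integrates to [3/2 (y - 1)]. *)
Lemma integral_green_le y xi eta : 1 < y -> 1 < eta -> eta - 1 <= 2 * (y - 1) ->
  (\int[mu]_x (green x y xi eta)%:E <= (2 * (y - 1))%:E)%E.
Proof.
move=> y1 e1 ey; have h0 : 0 < y - 1 by rewrite subr_gt0.
have L0 x : 0 <= ln (1 + (3 * (y - 1)) ^+ 2 / (xi - x) ^+ 2) by rewrite ln_ge0// lerDl divr_ge0 ?sqr_ge0.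
apply: (@le_trans _ _ (\int[mu]_x ((4 * pi)^-1 * ln (1 + (3 * (y - 1)) ^+ 2 / (xi - x) ^+ 2))%:E)%E).
  apply: ae_ge0_le_integral => //.
  - by move=> x _; rewrite lee_fin green_ge0.
  - by apply/measurable_EFinP; rewrite /green; meas.
  - by move=> x _; rewrite lee_fin mulr_ge0 // ltW.
  - by apply/measurable_EFinP; meas.
  exists [set xi]; split => //; first exact: lebesgue_measure_set1.
  move=> x /= nx; apply: contrapT => xxi; apply: nx => _.
  by rewrite lee_fin green_le_log//; apply/eqP.
under eq_integral do rewrite EFinM.
rewrite ge0_integralZl_EFin//; last 3 first.
- by move=> x _; rewrite lee_fin.
- by apply/measurable_EFinP; meas.
- exact: ltW.
apply: (@le_trans _ _ ((4 * pi)^-1%:E * (2 * pi * (3 * (y - 1)))%:E)%E).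
  by apply: lee_wpmul2l; [rewrite lee_fin ltW|apply: integral_log_kernel; rewrite mulr_gt0].
rewrite -EFinM lee_fin invfM.
have pn : (pi : R) != 0 by rewrite gt_eqF ?pi_gt0.
rewrite (_ : _ * _ = 3 / 2 * (y - 1)); last first.
  by move: (pi : R) pn => q q0; field.
by lra.
Qed.

End green_bounds.

(** * Lebesgue measure of the plane as a sigma-finite measure *)

Section plane_measure.
Context {R : realType}.
Local Notation TR := (measurableTypeR R).

(* The library declares the product as sigma-finite, but only for finite factors
   is this instance reachable by unification; hence the copy below. *)
Definition plane_measure : set (TR * TR) -> \bar R := (leb R \x leb R)%E.

HB.instance Definition _ := Measure.on plane_measure.

Let plane_measure_sigma_finite : sigma_finite setT plane_measure.
Proof.
exists (fun n => `[- n%:R, n%:R]%classic `*` `[- n%:R, n%:R]%classic).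
  apply/seteqP; split => // -[x y] _.
  pose k := (Num.trunc (`|x| + `|y|)).+1.
  have kx : `|x| + `|y| <= k%:R by rewrite ltW// truncnS_gt.
  have xn : `|x| <= k%:R by apply: le_trans kx; rewrite lerDl.
  have yn : `|y| <= k%:R by apply: le_trans kx; rewrite lerDr.
  by exists k; rewrite //= !in_itv/= -!ler_norml xn yn.
move=> n; split; first exact: measurableX.
have fin : (leb R [set` `[(- n%:R)%R, n%:R%R]] < +oo)%E.
  by rewrite lebesgue_measure_itv/=; case: ifP => // _; rewrite -EFinB ltry.
by rewrite /plane_measure product_measure1E// lte_mul_pinfty// ge0_fin_numE.
Qed.

HB.instance Definition _ := Measure_isSigmaFinite.Build _ _ _ plane_measure
  plane_measure_sigma_finite.

End plane_measure.

(** * Uniqueness for a symmetric kernel contracting a weight *)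

Section schur_uniqueness.
Context d (T : measurableType d) {R : realType}.
Variable m : {sigma_finite_measure set T -> \bar R}.
Local Open Scope ereal_scope.

(* Integrating [g <= P N[g]] against [th] and using the symmetry of [k] gives
   [I <= kappa I] for [I] the integral of [th g]. *)
Lemma schur_uniqueness (k : T -> T -> R) (P g th : T -> R) (kappa : R) :
  (forall z z', 0 <= k z z')%R -> (forall z z', k z z' = k z' z) ->
  measurable_fun setT (fun zz : T * T => k zz.1 zz.2) ->
  measurable_fun setT P -> measurable_fun setT g -> measurable_fun setT th ->
  (forall z, 0 <= P z)%R -> (forall z, 0 <= g z)%R -> (forall z, 0 <= th z)%R ->
  (kappa < 1)%R ->
  (forall z, \int[m]_z' (k z z' * (th z' * P z'))%:E <= (kappa * th z)%:E) ->
  (forall z, (g z)%:E <= (P z)%:E * \int[m]_z' (k z z' * g z')%:E) ->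
  \int[m]_z (th z * g z)%:E < +oo ->
  \int[m]_z (th z * g z)%:E = 0.
Proof.
move=> k0 ksym mk mP mg mth P0 g0 th0 k1 hk hg fin.
have mk1 z : measurable_fun setT (k z) by exact: (measurableT_comp mk (pair1_measurable z)).
set I := \int[m]_z (th z * g z)%:E.
have I0 : 0 <= I by apply: integral_ge0 => z _; rewrite lee_fin mulr_ge0.
have II : I <= kappa%:E * I.
  apply: (@le_trans _ _ (\int[m]_z \int[m]_z' (g z' * (k z' z * (th z * P z)))%:E)).
    apply: ge0_le_integral => //.
    - by move=> z _; rewrite lee_fin mulr_ge0.
    - by apply/measurable_EFinP; meas.
    - apply: measurable_integral2 => /=.
        have mk' : measurable_fun setT (fun zz : T * T => k zz.2 zz.1).
          by have -> : (fun zz : T * T => k zz.2 zz.1) = (fun zz => k zz.1 zz.2) by apply/funext => zz; rewrite ksym.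
        by apply/measurable_EFinP; meas.
      by move=> *; rewrite lee_fin !mulr_ge0.
    move=> z _.
    have -> : \int[m]_z' (g z' * (k z' z * (th z * P z)))%:E =
        (th z * P z)%:E * \int[m]_z' (k z z' * g z')%:E.
      rewrite -ge0_integralZl//; last 3 first.
      - by apply/measurable_EFinP; meas.
      - by move=> z' _; rewrite lee_fin mulr_ge0.
      - by rewrite lee_fin mulr_ge0.
      apply: eq_integral => z' _; rewrite -EFinM; congr EFin; rewrite (ksym z'); ring.
    by rewrite !EFinM -muleA; apply: lee_wpmul2l; [rewrite lee_fin|exact: hg].
  rewrite tonelliC; last 2 first.
  - have mk' : measurable_fun setT (fun zz : T * T => k zz.2 zz.1).
      by have -> : (fun zz : T * T => k zz.2 zz.1) = (fun zz => k zz.1 zz.2) by apply/funext => zz; rewrite ksym.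
    by apply/measurable_EFinP; meas.
  - by move=> *; rewrite lee_fin !mulr_ge0.
  apply: (@le_trans _ _ (\int[m]_z (kappa * (th z * g z))%:E)); last first.
    (* The sign of [kappa] is not given: a negative [kappa] forces [th = 0], because [kappa * th]
       bounds a nonnegative integral. *)
    have [kappa0|kappa0] := leP 0%R kappa.
      under eq_integral do rewrite EFinM.
      rewrite ge0_integralZl//.
      - by apply/measurable_EFinP; meas.
      - by move=> z _; rewrite lee_fin mulr_ge0.
    rewrite (eq_integral (cst 0)) ?integral0.
      have -> : I = 0; last by rewrite mule0.
      rewrite /I (eq_integral (cst 0)) ?integral0// => z _.
      have : (0 <= kappa * th z)%R.
        by rewrite -lee_fin; apply: le_trans (hk z); apply: integral_ge0 => z' _; rewrite lee_fin !mulr_ge0.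
      rewrite nmulr_rge0// => t0.
      by have -> : th z = 0%R; [apply/eqP; rewrite eq_le t0 th0|rewrite mul0r].
    move=> z _.
    have : (0 <= kappa * th z)%R.
      by rewrite -lee_fin; apply: le_trans (hk z); apply: integral_ge0 => z' _; rewrite lee_fin !mulr_ge0.
    rewrite nmulr_rge0// => t0.
    by have -> : th z = 0%R; [apply/eqP; rewrite eq_le t0 th0|rewrite mul0r mulr0].
  have kth z : (0 <= kappa * th z)%R.
    by rewrite -lee_fin; apply: le_trans (hk z); apply: integral_ge0 => z' _; rewrite lee_fin !mulr_ge0.
  apply: ge0_le_integral => //.
  - by move=> z _; apply: integral_ge0 => z' _; rewrite lee_fin !mulr_ge0.
  - apply: measurable_integral2 => /=; first by apply/measurable_EFinP; meas.
    by move=> *; rewrite lee_fin !mulr_ge0.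
  - by apply/measurable_EFinP; meas.
  move=> z _.
  under eq_integral do rewrite EFinM.
  rewrite ge0_integralZl//; last 3 first.
  - by apply/measurable_EFinP; meas.
  - by move=> z' _; rewrite lee_fin !mulr_ge0.
  - by rewrite lee_fin.
  apply: (@le_trans _ _ ((g z)%:E * (kappa * th z)%:E)).
    by apply: lee_wpmul2l; [rewrite lee_fin|exact: hk].
  by rewrite -EFinM lee_fin le_eqVlt; apply/orP; left; apply/eqP; ring.
have If : I \is a fin_num by rewrite ge0_fin_numE.
apply/eqP; rewrite eq_le I0 andbT.
move: II I0 If; case: I fin => // r _; rewrite -EFinM !lee_fin => rk r0 _; nra.
Qed.

End schur_uniqueness.

(** * Green potentials on the half-plane and a contracted weight *)

Section half_plane.
Context {R : realType}.
Local Notation mu := (leb R).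
Local Notation mu2 := (mu \x mu)%E.
Implicit Types (z : R * R) (P F : R * R -> R) (c e t : R).

(* The Green function extended by zero outside the half-plane, so that integrals
   run over the whole plane. *)
Definition greenD z z' : R :=
  if (1 < z.2) && (1 < z'.2) then green z.1 z.2 z'.1 z'.2 else 0.

Lemma greenD_ge0 z z' : 0 <= greenD z z'.
Proof. by rewrite /greenD; case: ifP => // /andP[]; exact: green_ge0. Qed.

Lemma greenDC z z' : greenD z z' = greenD z' z.
Proof. by rewrite /greenD andbC greenC. Qed.

Lemma measurable_greenD :
  measurable_fun setT (fun zz : (R * R) * (R * R) => greenD zz.1 zz.2).
Proof. by rewrite /greenD /green; meas. Qed.

Lemma measurable_greenD1 z : measurable_fun setT (greenD z).
Proof. exact: (measurableT_comp measurable_greenD (pair1_measurable z)). Qed.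

Lemma cvg_integral_strip P c : mu2.-integrable setT (EFin \o P) ->
  (forall z, z.2 <= 1 -> P z = 0) ->
  (\int[mu2]_z (if (z.2 - 1 < c * n.+1%:R^-1)%R then P z else 0%R)%:E)%E @[n --> \oo] --> 0%E.
Proof.
move=> iP Pz; have mP := integrable_mfun iP.
have -> : (0 = \int[mu2]_z (cst 0 z))%E by rewrite integral0.
have [] // := @dominated_convergence _ _ _ mu2 setT measurableT
  (fun n z => (if (z.2 - 1 < c * n.+1%:R^-1)%R then P z else 0%R)%:E) (cst 0%E) (fun z => `|P z|%:E).
- by move=> n; apply/measurable_EFinP; meas.
- apply: aeW => z _; have [z1|z1] := leP z.2 1.
    by rewrite Pz//; under eq_fun do rewrite if_same; exact: cvg_cst.
  apply: cvg_near_cst.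
  have : (c * n.+1%:R^-1) @[n --> \oo] --> (0:R).
    by rewrite -(mulr0 c); apply: cvgMl_tmp; exact: cvg_harmonic.
  move=> /cvgr_lt /(_ (z.2 - 1)) H.
  have {}H := H ltac:(by rewrite subr_gt0).
  by apply: filterS H => n H; rewrite ltNge (ltW H).
- exact: integrable_norm.
- by apply: aeW => z n _; rewrite /= lee_fin; case: ifP => // _; rewrite normr0.
Qed.

Lemma small_strip P e : mu2.-integrable setT (EFin \o P) ->
  (forall z, z.2 <= 1 -> P z = 0) -> 0 < e ->
  exists2 t, 0 < t & (\int[mu2]_z (if (z.2 - 1 < t)%R then P z else 0%R)%:E <= e%:E)%E.
Proof.
move=> iP Pz e0; have := @cvg_integral_strip P 1 iP Pz.
have /open_ereal_lt' e0' : (0 < e%:E)%E by rewrite lte_fin.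
move=> /(_ _ e0')[n _ /(_ n (leqnn n)) H].
exists (1 * n.+1%:R^-1); first by rewrite mul1r invr_gt0.
exact: ltW.
Qed.

(* A weight vanishing on the boundary line: it is contracted by [P]-potentials,
   and it is dominated near infinity by a bounded function and elsewhere by the
   Green function itself. *)
Definition depth t z : R := Num.max 0 (Num.min (z.2 - 1) t).

Lemma depth_ge0 t z : 0 <= depth t z.
Proof. by rewrite le_max lexx. Qed.

Lemma measurable_depth t : measurable_fun setT (depth t).
Proof. by rewrite /depth; meas. Qed.

Lemma depth_gt0 t z : 0 < t -> 1 < z.2 -> 0 < depth t z.
Proof. by move=> t0 z1; rewrite lt_max lt_min subr_gt0 z1 t0 orbT. Qed.

Lemma depth_le t z : 0 <= t -> depth t z <= t.
Proof. by move=> t0; rewrite ge_max t0 ge_min lexx orbT. Qed.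

Lemma depth_le2 t z : 1 < z.2 -> depth t z <= z.2 - 1.
Proof. by move=> z1; rewrite ge_max ge_min lexx subr_ge0 ltW. Qed.

(** At depth at least [t] the weight is [t], its maximum, and the factor [K] suffices. At depth
    [h < t] there are three kinds of sources. Those of depth below [(1 + e) h] cost [(1 + e) h K].
    For the deeper ones [green_le_poisson] bounds the Green function times the depth by [c h]: below
    depth [t0] the total is small because [P] has little mass there, and beyond it because the
    weight is at most [t / t0] times the depth. *)
Lemma green_depth_bound P K : mu2.-integrable setT (EFin \o P) ->
  (forall z, 0 <= P z) -> (forall z, z.2 <= 1 -> P z = 0) -> 0 <= K < 1 ->
  (forall z, (\int[mu2]_z' (greenD z z' * P z')%:E <= K%:E)%E) ->
  exists t kappa, [/\ 0 < t, kappa < 1 & forall z,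
    (\int[mu2]_z' (greenD z z' * (depth t z' * P z'))%:E <= (kappa * depth t z)%:E)%E].
Proof.
move=> iP P0 Pz /andP[K0 K1] hK; have mP := integrable_mfun iP.
(* The gap [1 - K] is shared out: one third for the factor [1 + e], one sixth for each kind of
   deeper source. The remaining third keeps [kappa] below 1. *)
pose e := (1 - K) / 3; have e0 : 0 < e by rewrite divr_gt0// subr_gt0.
pose c := ((1 + e) / e) ^+ 2 / pi.
have c0 : 0 < c.
  by rewrite divr_gt0 ?pi_gt0// exprn_gt0// divr_gt0// ltr_wpDl.
have e6 : 0 < (1 - K) / 6 by rewrite divr_gt0// subr_gt0.
have ec : 0 < (1 - K) / 6 / c by rewrite divr_gt0.
have [t0 t00 ht0] := small_strip iP Pz ec.
set n := fine (\int[mu2]_z (P z)%:E)%E.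
have nE : (\int[mu2]_z (P z)%:E = n%:E)%E by rewrite fineK//; exact: integrable_fin_num iP.
have n0 : 0 <= n by apply: fine_ge0; apply: integral_ge0 => z _; rewrite lee_fin.
(* Chosen so that [c (t / t0) n <= (1 - K) / 6]; the [+ 1] covers a vanishing total mass [n]. *)
pose t := t0 * ((1 - K) / 6 / c) / (n + 1).
have n1 : 0 < n + 1 by rewrite ltr_wpDl.
have tp : 0 < t by rewrite divr_gt0// mulr_gt0.
exists t, (K + e + (1 - K) / 6 + (1 - K) / 6); split => //; first by rewrite /e; lra.
move=> z; set kappa := (X in X * _).
have kappaK : K <= kappa by rewrite /kappa; lra.
have m1 := measurable_greenD1 z.
have md := measurable_depth t.
have mi : measurable_fun setT (fun z' : R * R => if (z'.2 - 1 < t0)%R then P z' else 0%R) by meas.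
have [z1|z1] := leP z.2 1.
  rewrite (eq_integral (cst 0%E)); last by move=> z' _; rewrite /greenD ltNge z1/= mul0r.
  by rewrite integral0 lee_fin mulr_ge0 ?depth_ge0//; apply: le_trans kappaK.
set h := z.2 - 1; have h0 : 0 < h by rewrite subr_gt0.
have [th|ht] := leP t h.
  have -> : depth t z = t.
    by rewrite /depth -/h min_r// max_r// ltW.
  apply: (@le_trans _ _ (\int[mu2]_z' (t * (greenD z z' * P z'))%:E)%E).
    apply: ge0_le_integralR; [by meas|by meas| |].
      by move=> z'; rewrite !mulr_ge0 ?greenD_ge0 ?depth_ge0.
    move=> z'; rewrite [leRHS]mulrCA ler_wpM2l ?greenD_ge0// ler_wpM2r//.
    by apply: depth_le; exact: ltW.
  under eq_integral do rewrite EFinM.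
  rewrite ge0_integralZl_EFin//; last 3 first.
  - by move=> z' _; rewrite lee_fin mulr_ge0 ?greenD_ge0.
  - by apply/measurable_EFinP; meas.
  - exact: ltW.
  apply: (@le_trans _ _ (t%:E * K%:E)%E).
    by apply: lee_wpmul2l; [rewrite lee_fin ltW|exact: hK].
  by rewrite -EFinM lee_fin mulrC ler_wpM2r// ltW.
have -> : depth t z = h.
  by rewrite /depth -/h min_l ?(ltW ht)// max_r// ltW.
have e1 : 0 <= 1 + e by rewrite addr_ge0 ?ler01 ?(ltW e0).
have ct : 0 <= c * (t / t0) by rewrite mulr_ge0 ?(ltW c0)// divr_ge0 ?(ltW tp) ?(ltW t00).
have i0 z' : 0 <= (if (z'.2 - 1 < t0)%R then P z' else 0%R) by case: ifP.
have j0 z' : 0 <= c * (if (z'.2 - 1 < t0)%R then P z' else 0%R) + (c * (t / t0)) * P z'.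
  by apply: addr_ge0; apply: mulr_ge0 => //; exact: ltW.
apply: (@le_trans _ _ (\int[mu2]_z' ((h * (1 + e)) * (greenD z z' * P z') + h * (c *
   (if (z'.2 - 1 < t0)%R then P z' else 0%R) + (c * (t / t0)) * P z'))%:E)%E).
  apply: ge0_le_integralR; [by meas|by meas| |].
    by move=> z'; rewrite !mulr_ge0 ?greenD_ge0 ?depth_ge0.
  move=> z'; have [z1'|z1'] := leP z'.2 1.
    by rewrite Pz// if_same !mulr0 !addr0 mulr0.
  set s := z'.2 - 1; have s0 : 0 < s by rewrite subr_gt0.
  have [sh|hs] := ltP s ((1 + e) * h).
    apply: (@le_trans _ _ (h * (1 + e) * (greenD z z' * P z'))).
      rewrite [leRHS]mulrCA ler_wpM2l ?greenD_ge0// ler_wpM2r//.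
      by apply: (le_trans (depth_le2 t z1')); rewrite mulrC ltW.
    by rewrite lerDl; apply: mulr_ge0; [exact: ltW|exact: j0].
  have gb := green_le_poisson z.1 z'.1 e0 z1 hs.
  have D0 : 0 < (z.1 - z'.1) ^+ 2 + (1 - z'.2) ^+ 2.
    by rewrite -[1 - z'.2]opprB sqrrN ltr_wpDl ?sqr_ge0// exprn_gt0.
  have sD : s * (s / ((z.1 - z'.1) ^+ 2 + (1 - z'.2) ^+ 2)) <= 1.
    by rewrite mulrA ler_pdivrMr// mul1r -expr2 -[1 - z'.2]opprB sqrrN lerDr sqr_ge0.
  have gs : greenD z z' * s <= c * h.
    rewrite /greenD z1 z1' /=; apply: (le_trans (ler_wpM2r (ltW s0) gb)).
    rewrite -/c -/h -/s.
    rewrite [leLHS](_ : _ = c * h * (s * (s / ((z.1 - z'.1) ^+ 2 + (1 - z'.2) ^+ 2)))); last by ring.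
    by rewrite ler_piMr// mulr_ge0// ltW.
  have g0 := greenD_ge0 z z'.
  have main : greenD z z' * depth t z' <= h * (c * (if s < t0 then 1 else 0) + c * (t / t0)).
    case: ifP => st.
      apply: (@le_trans _ _ (c * h)).
        by apply: le_trans gs; rewrite ler_wpM2l// depth_le2.
      by rewrite mulr1 [leLHS]mulrC ler_wpM2l ?(ltW h0)// lerDl.
    rewrite mulr0 add0r.
    apply: (@le_trans _ _ (greenD z z' * s * (t / t0))).
      rewrite -mulrA ler_wpM2l// (le_trans (depth_le _ (ltW tp)))//.
      rewrite mulrCA ler_pMr// ler_pdivlMr// mul1r leNgt; exact: negbT.
    rewrite [leRHS](_ : _ = c * h * (t / t0)); last by ring.
    by rewrite ler_wpM2r// divr_ge0 ?(ltW tp) ?(ltW t00).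
  rewrite mulrA; apply: (le_trans (ler_wpM2r (P0 z') main)).
  rewrite -[leLHS]add0r lerD//.
    by rewrite !mulr_ge0// ltW.
  by case: ifP => _; rewrite le_eqVlt; apply/orP; left; apply/eqP; ring.
have igP : (\int[mu2]_z' (greenD z z' * P z')%:E)%E \is a fin_num.
  rewrite ge0_fin_numE; first by apply: le_lt_trans (hK z) _; rewrite ltry.
  by apply: integral_ge0 => z' _; rewrite lee_fin mulr_ge0 ?greenD_ge0.
rewrite ge0_integral_lin//; last 5 first.
- by rewrite mulr_ge0// ltW.
- exact: ltW.
- by meas.
- by meas.
- by move=> z'; rewrite mulr_ge0 ?greenD_ge0.
rewrite ge0_integral_lin//; last by exact: ltW.
rewrite nE.
apply: (@le_trans _ _ ((h * (1 + e))%:E * K%:E + h%:E * (c%:E * ((1 - K) / 6 / c)%:E + (c * (t / t0))%:E * n%:E))%E).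
  apply: leeD; first by apply: lee_wpmul2l; [rewrite lee_fin mulr_ge0// ltW|exact: hK].
  apply: lee_wpmul2l; first by rewrite lee_fin ltW.
  apply: leeD => //; apply: lee_wpmul2l => //; first by rewrite lee_fin ltW.
rewrite -!(EFinM, EFinD) lee_fin.
have h1 : c * ((1 - K) / 6 / c) = (1 - K) / 6 by field; rewrite gt_eqF.
have h2 : c * (t / t0) * n <= (1 - K) / 6.
  have -> : c * (t / t0) * n = (1 - K) / 6 * (n / (n + 1)).
    by rewrite /t; field; rewrite !gt_eqF.
  by rewrite ler_piMr ?(ltW e6)// ler_pdivrMr// mul1r lerDl.
rewrite h1 [leRHS]mulrC -mulrA -mulrDr ler_wpM2l ?(ltW h0)//.
by rewrite /kappa /e; nra.
Qed.

End half_plane.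

(** * Pointwise bound on the difference of the source terms *)

Section uniform_bound.
Context {R : realType}.
Local Notation mu := (leb R).
Local Notation mu2 := (mu \x mu)%E.
Implicit Types (z : R * R) (P F w : R * R -> R) (K M delta t : R).

(* The pole is excluded because [ln 0 = 0] makes [green] vanish there. *)
Lemma depth_le_green (x0 M t : R) z : 1 < z.2 -> z != (x0, 2) ->
  (x0 - z.1) ^+ 2 + z.2 ^+ 2 <= M ->
  depth t z <= pi * M * greenD (x0, 2) z.
Proof.
move=> z1 zx zM.
have V0 : 0 < (x0 - z.1) ^+ 2 + (2 - z.2) ^+ 2.
  rewrite lt_def addr_ge0 ?sqr_ge0// andbT paddr_eq0 ?sqr_ge0// !sqrf_eq0 !subr_eq0.
  by apply: contra zx; case: z {z1 zM} => a b /= /andP[/eqP -> /eqP ->].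
have y1 : (1 : R) < 2 by rewrite ltr1n.
have W0 : 0 < (x0 - z.1) ^+ 2 + z.2 ^+ 2 by rewrite ltr_wpDl ?sqr_ge0// exprn_gt0 // (lt_trans ltr01).
have := green_ge y1 z1 V0; rewrite /greenD /= y1 z1 /=.
rewrite (_ : 2 + z.2 - 2 = z.2); last by ring.
rewrite (_ : 2 - 1 = 1 :> R) ?mul1r; last by ring.
move=> h; apply: (le_trans (depth_le2 t z1)).
have M0 : 0 < M by exact: lt_le_trans zM.
apply: (@le_trans _ _ (pi * M * (pi^-1 * ((z.2 - 1) / ((x0 - z.1) ^+ 2 + z.2 ^+ 2))))); last first.
  by rewrite ler_wpM2l// mulr_ge0 ?pi_ge0// ltW.
have -> : pi * M * (pi^-1 * ((z.2 - 1) / ((x0 - z.1) ^+ 2 + z.2 ^+ 2))) =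
    (z.2 - 1) * (M / ((x0 - z.1) ^+ 2 + z.2 ^+ 2)).
  have pn : (pi : R) != 0 by rewrite gt_eqF ?pi_gt0.
  by move: (pi : R) pn => q q0; field; rewrite q0 gt_eqF.
by rewrite ler_peMr ?subr_ge0 ?(ltW z1)// ler_pdivlMr// mul1r.
Qed.

(** Outside the disc of radius [M] one has [F <= P], with [P] integrable. Inside it the weight is at
    most a multiple of a Green function, whose integral against [F] is finite. *)
Lemma depth_integrable_lty P F w M t : mu2.-integrable setT (EFin \o P) ->
  measurable_fun setT F -> (forall z, 0 <= P z) -> (forall z, 0 <= F z) ->
  (forall z, z.2 <= 1 -> F z = 0) -> 0 < t ->
  (forall z, 1 < z.2 -> (\int[mu2]_z' (greenD z z' * F z')%:E < +oo)%E) ->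
  (forall z, 1 < z.2 -> F z <= P z * `|w z|) ->
  (forall z, 1 < z.2 -> M < Num.sqrt (z.1 ^+ 2 + z.2 ^+ 2) -> `|w z| <= 1) ->
  (\int[mu2]_z (depth t z * F z)%:E < +oo)%E.
Proof.
move=> iP mF P0 F0 Fz t0 hN hF hM; have mP := integrable_mfun iP.
have md := measurable_depth t.
(* For a pole of abscissa [x0] equal to 0 or 1, [(x0 - z.1)^2 + z.2^2 <= 2 + 2 M^2] on the disc. *)
pose B := pi * (2 + 2 * M ^+ 2); have B0 : 0 <= B.
  by rewrite mulr_ge0 ?pi_ge0// addr_ge0// mulr_ge0// sqr_ge0.
(* Two poles, so that every point differs from at least one of them. *)
pose z0 : R * R := (0, 2); pose z1 : R * R := (1, 2).
have m0 := measurable_greenD1 z0; have m1 := measurable_greenD1 z1.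
have p0 z : 0 <= greenD z0 z * F z by rewrite mulr_ge0 ?greenD_ge0.
have p1 z : 0 <= greenD z1 z * F z by rewrite mulr_ge0 ?greenD_ge0.
have y2 : (1 : R) < 2 by rewrite ltr1n.
apply: (@le_lt_trans _ _ (\int[mu2]_z (t * P z + 1 * (B * (greenD z0 z * F z) + B * (greenD z1 z * F z)))%:E)%E).
  apply: ge0_le_integralR; [by meas|by meas| |].
    by move=> z; rewrite mulr_ge0 ?depth_ge0.
  move=> z; have [z2|z2] := leP z.2 1.
    by rewrite Fz// !mulr0 addr0 mulr0 addr0 mulr_ge0// ltW.
  rewrite mul1r; have [zM|zM] := ltP M (Num.sqrt (z.1 ^+ 2 + z.2 ^+ 2)).
    apply: (@le_trans _ _ (t * P z)).
      apply: ler_pM => //; [exact: depth_ge0|exact: depth_le (ltW t0)|].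
      by apply: (le_trans (hF _ z2)); rewrite ler_piMr// hM.
    by rewrite lerDl addr_ge0// mulr_ge0.
  have s0 : 0 <= z.1 ^+ 2 + z.2 ^+ 2 by rewrite addr_ge0 ?sqr_ge0.
  have {}zM : z.1 ^+ 2 + z.2 ^+ 2 <= M ^+ 2.
    rewrite -(sqr_sqrtr s0) ler_sqr ?nnegrE ?sqrtr_ge0//.
    exact: le_trans (sqrtr_ge0 _) zM.
  apply: (@le_trans _ _ (B * (greenD z0 z * F z) + B * (greenD z1 z * F z))); last first.
    by rewrite lerDr mulr_ge0// ltW.
  have [zz0|zz0] := eqVneq z z0.
    apply: (@le_trans _ _ (B * (greenD z1 z * F z))); last by rewrite lerDr mulr_ge0.
    rewrite mulrA ler_wpM2r//; apply: depth_le_green => //.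
      by rewrite zz0 xpair_eqE eq_sym oner_eq0.
    move: zM; have := sqr_ge0 (1 + z.1); have := sqr_ge0 z.2; nra.
  apply: (@le_trans _ _ (B * (greenD z0 z * F z))); last by rewrite lerDl mulr_ge0.
  rewrite mulrA ler_wpM2r//; apply: depth_le_green => //.
  move: zM; have := sqr_ge0 z.1; have := sqr_ge0 z.2; nra.
rewrite ge0_integral_lin//; last 3 first.
- exact: ltW.
- by meas.
- by move=> z; rewrite addr_ge0// mulr_ge0.
rewrite ge0_integral_lin//; [|by meas|by meas].
rewrite mul1e; apply: lte_add_pinfty.
  by rewrite lte_mul_pinfty ?lee_fin ?(ltW t0)//; have /integrable_lty := iP; apply.
by apply: lte_add_pinfty; rewrite lte_mul_pinfty ?lee_fin// hN.
Qed.

(* Nothing is known on [w] near the line [y = 1], so the contraction principle for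
   the supremum norm is not available: it is replaced by a weighted L^1 argument
   on the positive part of [F - delta / (1 - K) P]. *)
Lemma contraction_uniform_bound P F w K M delta :
  mu2.-integrable setT (EFin \o P) -> (forall z, 0 <= P z) ->
  (forall z, z.2 <= 1 -> P z = 0) -> 0 <= K < 1 ->
  (forall z, (\int[mu2]_z' (greenD z z' * P z')%:E <= K%:E)%E) ->
  measurable_fun setT F -> (forall z, 0 <= F z) ->
  (forall z, z.2 <= 1 -> F z = 0) -> 0 <= delta ->
  (forall z, 1 < z.2 -> (\int[mu2]_z' (greenD z z' * F z')%:E < +oo)%E) ->
  (forall z, 1 < z.2 ->
    (`|w z|%:E <= delta%:E + \int[mu2]_z' (greenD z z' * F z')%:E)%E) ->
  (forall z, 1 < z.2 -> F z <= P z * `|w z|) ->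
  (forall z, 1 < z.2 -> M < Num.sqrt (z.1 ^+ 2 + z.2 ^+ 2) -> `|w z| <= 1) ->
  {ae mu2, forall z, F z <= delta / (1 - K) * P z}.
Proof.
move=> iP P0 Pz K01 hK mF F0 Fz d0 hN hw hF hM; have mP := integrable_mfun iP.
have [t [kappa [t0 kappa1 hd]]] := green_depth_bound iP P0 Pz K01 hK.
have /andP[K0 K1] := K01.
(* The fixed point of [c = delta + c K]: the part [c P] of [F] reproduces itself, and only the
   excess [g] is left in the inequality. *)
set c := delta / (1 - K).
have c0 : 0 <= c by rewrite divr_ge0 // subr_ge0 ltW.
pose g z := Num.max 0 (F z - c * P z).
have g0 z : 0 <= g z by rewrite le_max lexx.
have mg : measurable_fun setT g by rewrite /g; meas.
have md := measurable_depth t.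
have gF z : g z <= F z by rewrite ge_max F0 lerBlDr lerDl mulr_ge0.
have Fg z : F z <= g z + c * P z by rewrite -lerBlDr le_max lexx orbT.
have hg z : ((g z)%:E <= (P z)%:E * \int[mu2]_z' (greenD z z' * g z')%:E)%E.
  have I0 : (0 <= \int[mu2]_z' (greenD z z' * g z')%:E)%E.
    by apply: integral_ge0 => z' _; rewrite lee_fin mulr_ge0 ?greenD_ge0.
  have [gz|gz] := leP (g z) 0.
    apply: (@le_trans _ _ 0%E); first by rewrite lee_fin.
    by rewrite mule_ge0// lee_fin.
  have z1 : 1 < z.2.
    by rewrite ltNge; apply/negP => z2; move: gz; rewrite ltNge (le_trans (gF z))// Fz.
  have m1 := measurable_greenD1 z.
  have I1 : (\int[mu2]_z' (greenD z z' * F z')%:E <= (c * K)%:E + \int[mu2]_z' (greenD z z' * g z')%:E)%E.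
    apply: (@le_trans _ _ (\int[mu2]_z' (c * (greenD z z' * P z') + 1 * (greenD z z' * g z'))%:E)%E).
      apply: ge0_le_integralR; [by meas|by meas| |].
        by move=> z'; rewrite mulr_ge0 ?greenD_ge0.
      move=> z'; rewrite mul1r mulrCA -mulrDr ler_wpM2l ?greenD_ge0//.
      by rewrite addrC.
    rewrite ge0_integral_lin//; last 4 first.
    - by meas.
    - by meas.
    - by move=> z'; rewrite mulr_ge0 ?greenD_ge0.
    - by move=> z'; rewrite mulr_ge0 ?greenD_ge0.
    by rewrite mul1e [X in (_ <= X + _)%E]EFinM; apply: leeD2r; apply: lee_wpmul2l.
  have := hw z z1; have := hN z z1; move: I1 I0.
  set I := (\int[mu2]_z' (greenD z z' * g z')%:E)%E.
  set J := (\int[mu2]_z' (greenD z z' * F z')%:E)%E.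
  move=> JI I0 Jy wJ.
  have {wJ} : (`|w z|%:E <= c%:E + I)%E.
    apply: (le_trans wJ); apply: (@le_trans _ _ (delta%:E + ((c * K)%:E + I))%E); first by rewrite leeD2l.
    rewrite addeA -EFinD (_ : delta + c * K = c)// /c.
    by field; rewrite subr_eq0 gt_eqF.
  (* An infinite potential makes the right side infinite unless [P z = 0]; in that case [F z = 0],
     which contradicts [0 < g z]. *)
  case: I I0 {JI} => [r||]//= r0; last first.
    move=> _; have [P1|P1] := ltP 0 (P z); first by rewrite gt0_muley ?leey.
    exfalso; move: gz; rewrite /g lt_max ltxx/= subr_gt0 => h.
    have := hF z z1; have -> : P z = 0 by apply/eqP; rewrite eq_le P1 P0.
    rewrite mul0r => F1; have := le_lt_trans (mulr_ge0 c0 (P0 z)) h.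
    by rewrite ltNge F1.
  rewrite -EFinD -EFinM !lee_fin => wr.
  rewrite /g ge_max mulr_ge0//= lerBlDr.
  apply: (le_trans (hF z z1)).
  by rewrite [c * _]mulrC -mulrDr ler_wpM2l// addrC.
have fin := depth_integrable_lty iP mF P0 F0 Fz t0 hN hF hM.
have fing : (\int[mu2]_z (depth t z * g z)%:E < +oo)%E.
  apply: le_lt_trans fin; apply: ge0_le_integralR; [by meas|by meas| |].
    by move=> z; rewrite mulr_ge0 ?depth_ge0.
  by move=> z; rewrite ler_wpM2l ?depth_ge0.
have := schur_uniqueness (m := plane_measure) greenD_ge0 greenDC
  measurable_greenD mP mg md P0 g0 (depth_ge0 t) kappa1 hd hg fing.
have mdg : measurable_fun setT (fun z => (depth t z * g z)%:E) by apply/measurable_EFinP; meas.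
have -> : (\int[mu2]_z (depth t z * g z)%:E = \int[mu2]_z `|(depth t z * g z)%:E|)%E.
  by apply: eq_integral => z _; rewrite gee0_abs// lee_fin mulr_ge0 ?depth_ge0.
move=> I0; have := (ae_eq_integral_abs mu2 measurableT mdg).1 I0.
apply: filterS => z /(_ I) /= [] /eqP; rewrite mulf_eq0 => dg.
have [z2|z2] := leP z.2 1; first by rewrite Fz// mulr_ge0.
move: dg; rewrite (gt_eqF (depth_gt0 t0 z2))/= => /eqP gz.
by have := Fg z; rewrite gz add0r.
Qed.

End uniform_bound.

(** * Difference quotients at the boundary line *)

Section boundary_quotient.
Context {R : realType}.
Local Notation mu := (leb R).
Local Notation mu2 := (mu \x mu)%E.
Implicit Types (z : R * R) (P F : R * R -> R).

(** The closeness of [w] to [p] is asked only for arbitrarily large [n]: since the quotient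
    converges to [D], any such sequence of indices computes [D]. *)
Lemma quotient_limit_bound (w p : R -> R) (d U g k a D : R) : 0 <= a ->
  (forall h, 0 < h -> `|p h - U + h * g| <= k * h ^+ 2) ->
  (forall e : R, 0 < e -> forall n0 : nat, exists2 n, (n0 <= n)%N &
     `|w n.+1%:R^-1 - p n.+1%:R^-1| <= n.+1%:R^-1 * (a + e)) ->
  (w h - d) / h @[h --> 0^'+] --> D ->
  `|D| <= `|g| + a.
Proof.
move=> a0 hp hw hD.
pose h n : R := n.+1%:R^-1.
have h0 n : 0 < h n by rewrite invr_gt0.
have hn0 : h n @[n --> \oo] --> (0:R) by exact: cvg_harmonic.
have hq : (w (h n) - d) / h n @[n --> \oo] --> D.
  move/cvg_at_rightP : hD; apply.
  by split=> [n|//]; exact: h0.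
have near e : 0 < e -> exists n0 : nat, forall n, (n0 <= n)%N -> h n < e /\ `|D - (w (h n) - d) / h n| < e.
  move=> e0.
  have /cvgrPdist_lt/(_ e e0)[n1 _ H1] := hn0.
  have /cvgrPdist_lt/(_ e e0)[n2 _ H2] := hq.
  exists (maxn n1 n2) => n; rewrite geq_max => /andP[n1n n2n]; split; last exact: H2.
  have := H1 _ n1n; by rewrite /= sub0r normrN gtr0_norm.
have k0 : 0 <= k.
  have := hp 1 ltr01; rewrite expr1n mulr1; exact: le_trans.
(* Convergence of the quotient gives [w h - d = O(h)], while the first two hypotheses give
   [w h - U = O(h)] along infinitely many [h]; so [U - d] is arbitrarily small. *)
have Ud : U = d.
  apply/eqP; rewrite -subr_eq0 -normr_le0; apply/ler_addgt0Pl => e e0; rewrite addr0.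
  pose C := k + `|g| + (a + 1) + (`|D| + 1).
  have C0 : 0 < C by rewrite /C; have := normr_ge0 g; have := normr_ge0 D; lra.
  have m0 : 0 < Num.min 1 (e / C) by rewrite lt_min ltr01 divr_gt0.
  have [n0 Hn0] := near _ m0.
  have [n n0n wn] := hw 1 ltr01 n0.
  have [] := Hn0 n n0n; rewrite -/(h n) in wn *; move: (h0 n) wn; set t := h n => t0 wn.
  rewrite !lt_min => /andP[t1 te] /andP[q1 _].
  have := hp t t0; set E := p t - U + t * g => pE.
  have wd : `|w t - d| <= t * (`|D| + 1).
    have -> : w t - d = t * ((w t - d) / t) by rewrite mulrC divfK ?gt_eqF.
    rewrite normrM gtr0_norm// ler_wpM2l ?(ltW t0)//.
    move: q1; set q := (w t - d) / t => q1.
    have := ler_normD (q - D) D; rewrite subrK distrC; lra.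
  rewrite (_ : U - d = - E + t * g - (w t - p t) + (w t - d)); last by rewrite /E; ring.
  apply: (@le_trans _ _ (k * t ^+ 2 + t * `|g| + t * (a + 1) + t * (`|D| + 1))).
    apply: (le_trans (ler_normD _ _)); apply: lerD => //.
    apply: (le_trans (ler_normB _ _)); apply: lerD => //.
    apply: (le_trans (ler_normD _ _)); apply: lerD; first by rewrite normrN.
    by rewrite normrM gtr0_norm.
  apply: (@le_trans _ _ (t * C)).
    rewrite /C expr2 mulrCA -!mulrDr ler_wpM2l ?(ltW t0)//.
    by rewrite !lerD2r ler_piMr// ltW.
  by rewrite -ler_pdivlMr// ltW.
apply/ler_addgt0Pl => e e0.
have e4 : 0 < e / 4 by rewrite divr_gt0.
have m0 : 0 < Num.min (e / 4) (e / 4 / (k + 1)).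
  by rewrite lt_min e4 divr_gt0// ltr_wpDl.
have [n0 Hn0] := near _ m0.
have [n n0n wn] := hw _ e4 n0.
have [] := Hn0 n n0n; rewrite -/(h n) in wn *; move: (h0 n) wn; set t := h n => t0 wn.
rewrite !lt_min => /andP[_ tk] /andP[q1 _].
have tk' : k * t <= e / 4.
  move: tk; rewrite ltr_pdivlMr ?ltr_wpDl// mulrDr mulr1 => tk.
  rewrite mulrC; apply: ltW; apply: le_lt_trans tk; by rewrite lerDl ltW.
have wd : `|(w t - d) / t| <= `|g| + a + e / 4 + e / 4.
  rewrite normrM normfV (gtr0_norm t0) ler_pdivrMr//.
  have := hp t t0; set E := p t - U + t * g => pE.
  rewrite (_ : w t - d = (w t - p t) + E - t * g); last by rewrite /E Ud; ring.
  apply: (@le_trans _ _ (t * (a + e / 4) + k * t ^+ 2 + t * `|g|)).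
    apply: (le_trans (ler_normB _ _)); apply: lerD.
      by apply: (le_trans (ler_normD _ _)); apply: lerD.
    by rewrite normrM gtr0_norm.
  rewrite expr2 mulrA -[leRHS]mulrC [k * t * t]mulrC -!mulrDr ler_wpM2l ?(ltW t0)//; lra.
have := ler_normD (D - (w t - d) / t) ((w t - d) / t); rewrite subrK; lra.
Qed.

(* The part of the difference quotient of the potential of [P] coming from the
   strip where the Poisson kernel does not control [green / h]. *)
Definition strip_part P (x : R) (n : nat) : \bar R :=
  (\int[mu2]_z (n.+1%:R * (if (z.2 - 1 < 2 * n.+1%:R^-1)%R
     then greenD (x, (1 + n.+1%:R^-1)%R) z * P z else 0%R))%:E)%E.

Lemma strip_part_negligible P : mu2.-integrable setT (EFin \o P) ->
  (forall z, 0 <= P z) -> (forall z, z.2 <= 1 -> P z = 0) ->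
  {ae mu, forall x, limn_einf (strip_part P x) = 0%E}.
Proof.
move=> iP P0 Pz; have mP := integrable_mfun iP.
have f0 n x z : 0 <= n.+1%:R * (if z.2 - 1 < 2 * n.+1%:R^-1 then greenD (x, 1 + n.+1%:R^-1) z * P z else 0).
  by rewrite mulr_ge0//; case: ifP => // _; rewrite mulr_ge0 ?greenD_ge0.
have s0 n x : (0 <= strip_part P x n)%E by apply: integral_ge0 => z _; rewrite lee_fin.
have mg n : measurable_fun setT (fun xz : R * (R * R) => n.+1%:R *
   (if xz.2.2 - 1 < 2 * n.+1%:R^-1 then greenD (xz.1, 1 + n.+1%:R^-1) xz.2 * P xz.2 else 0)).
  by rewrite /greenD /green/=; meas.
have ms n : measurable_fun setT (fun x => strip_part P x n).
  apply: (@measurable_integral2 _ _ _ _ _ plane_measure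
    (fun x z => (n.+1%:R * (if z.2 - 1 < 2 * n.+1%:R^-1 then greenD (x, 1 + n.+1%:R^-1) z * P z else 0))%:E)).
    by apply/measurable_EFinP; exact: mg.
  by move=> x z; rewrite lee_fin.
(* After Tonelli, integrating the Green function in [x] gives at most [2 h], which cancels the
   factor [n.+1 = 1 / h]. *)
have bd n : (\int[mu]_x strip_part P x n <= \int[mu2]_z (2 * (if (z.2 - 1 < 2 * n.+1%:R^-1)%R then P z else 0%R))%:E)%E.
  rewrite (@tonelliC _ _ _ _ _ mu plane_measure (fun x z =>
    (n.+1%:R * (if z.2 - 1 < 2 * n.+1%:R^-1 then greenD (x, 1 + n.+1%:R^-1) z * P z else 0))%:E)); last 2 first.
  - by apply/measurable_EFinP; exact: mg.
  - by move=> x z; rewrite lee_fin.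
  apply: ge0_le_integral => //.
  - by move=> z _; apply: integral_ge0 => x _; rewrite lee_fin.
  - apply: (@measurable_integral1 _ _ _ _ _ mu).
      by apply/measurable_EFinP; exact: mg.
    by move=> x z; rewrite lee_fin.
  - by apply/measurable_EFinP; meas.
  move=> z _; case: ifP => zn; last first.
    by rewrite (eq_integral (cst 0%E)) ?integral0 ?mulr0// => x _; rewrite mulr0.
  have [z1|z1] := leP z.2 1.
    by rewrite Pz// (eq_integral (cst 0%E)) ?integral0 ?mulr0// => x _; rewrite !mulr0.
  have h1 : 1 < 1 + n.+1%:R^-1 :> R by rewrite ltrDl invr_gt0.
  rewrite [leLHS](_ : _ = \int[mu]_x ((n.+1%:R * P z)%:E * (green x (1 + n.+1%:R^-1) z.1 z.2)%:E))%E; last first.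
    by apply: eq_integral => x _; rewrite /greenD /= h1 z1/= -EFinM; congr EFin; ring.
  rewrite ge0_integralZl//; last 3 first.
  - by apply/measurable_EFinP; rewrite /green; meas.
  - by move=> x _; rewrite lee_fin green_ge0.
  - by rewrite lee_fin mulr_ge0.
  have hz : z.2 - 1 <= 2 * (1 + n.+1%:R^-1 - 1) by rewrite addrAC subrr add0r ltW.
  apply: (@le_trans _ _ ((n.+1%:R * P z)%:E * (2 * (1 + n.+1%:R^-1 - 1))%:E)%E).
    by apply: lee_wpmul2l; [rewrite lee_fin mulr_ge0|exact: integral_green_le].
  rewrite -EFinM lee_fin le_eqVlt; apply/orP; left; apply/eqP.
  have : (n.+1%:R : R) != 0 by rewrite pnatr_eq0.
  by rewrite addrAC subrr add0r; move: (n.+1%:R : R) => m m0; field.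
have cv0 : (\int[mu]_x limn_einf (strip_part P x) = 0)%E.
  apply/eqP; rewrite eq_le; apply/andP; split; last first.
    apply: integral_ge0 => x _; rewrite limn_einf_lim; apply: lime_ge; first exact: is_cvg_einfs.
    by near=> n; apply: le_ereal_inf_tmp => _ [m _ <-].
  apply: (le_trans (fatou mu measurableT ms (fun n x _ => s0 n x))).
  apply/lee_addgt0Pr => e e0; rewrite add0e.
  have /open_ereal_lt' e2 : (0 < (e / 2)%:E)%E by rewrite lte_fin divr_gt0.
  have [n0 _ Hn0] := cvg_integral_strip 2 iP Pz e2.
  rewrite leNgt; apply/negP => he.
  have nn : forall n, (n0 <= n)%N -> (\int[mu]_x strip_part P x n < e%:E)%E.
    move=> n n0n; apply: (le_lt_trans (bd n)).
    under eq_integral do rewrite EFinM.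
    rewrite ge0_integralZl_EFin//; last 2 first.
    - by move=> z _; rewrite lee_fin; case: ifP.
    - by apply/measurable_EFinP; meas.
    have := Hn0 n n0n; rewrite /= => H.
    apply: (@lt_le_trans _ _ (2%:E * (e / 2)%:E)%E); first by rewrite lte_pmul2l.
    by rewrite -EFinM lee_fin mulrC divfK.
  move: he; apply/negP; rewrite -leNgt limn_einf_lim; apply: lime_le; first exact: is_cvg_einfs.
  near=> n; apply: (@le_trans _ _ (\int[mu]_x strip_part P x n)%E).
    by apply: ereal_inf_lbound; exists n => /=.
  by apply: ltW; apply: nn; near: n; exact: nbhs_infty_ge.
have L0 x : (0 <= limn_einf (strip_part P x))%E.
  rewrite limn_einf_lim; apply: lime_ge; first exact: is_cvg_einfs.
  by near=> n; apply: le_ereal_inf_tmp => _ [m _ <-].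
have mL : measurable_fun setT (fun x => limn_einf (strip_part P x)).
  have -> : (fun x => limn_einf (strip_part P x)) =
      (fun x => - limn_esup (fun n => - strip_part P x n))%E.
    apply/funext => x; rewrite -limn_einfN; congr limn_einf.
    by apply/funext => n /=; rewrite oppeK.
  apply: measurableT_comp => //; apply: measurable_fun_limn_esup => n.
  exact: measurableT_comp.
have {}cv0 : (\int[mu]_x `|limn_einf (strip_part P x)| = 0)%E.
  by rewrite -cv0; apply: eq_integral => x _; rewrite gee0_abs.
have := (ae_eq_integral_abs mu measurableT mL).1 cv0.
by apply: filterS => x /(_ I).
Unshelve. all: end_near. Qed.

(** Up to the factor [pi], the balayage of [P] onto the boundary line, that is, formally, the normal
    derivative of its Green potential. [constL] is the [L^2] norm of this function for [|p|]. *)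
Definition sweep P (x : R) : \bar R :=
  (\int[mu2]_z ((z.2 - 1) / ((x - z.1) ^+ 2 + (1 - z.2) ^+ 2) * P z)%:E)%E.

Let sweep_ge0 P x z : (forall z, 0 <= P z) -> (forall z, z.2 <= 1 -> P z = 0) ->
  0 <= (z.2 - 1) / ((x - z.1) ^+ 2 + (1 - z.2) ^+ 2) * P z.
Proof.
move=> P0 Pz; have [z1|z1] := leP z.2 1; first by rewrite Pz// mulr0.
by rewrite mulr_ge0// divr_ge0 ?subr_ge0 ?(ltW z1)// addr_ge0 ?sqr_ge0.
Qed.

(** The plane is cut at depth [2 h]: beyond it [green_le_poisson] with [e = 1] gives the constant
    [(2 / 1)^2 / pi = 4 / pi], and the rest is [strip_part]. *)
Lemma green_potential_bound P F c x n : measurable_fun setT P ->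
  (forall z, 0 <= P z) -> (forall z, z.2 <= 1 -> P z = 0) ->
  measurable_fun setT F -> (forall z, 0 <= F z) -> 0 <= c ->
  {ae mu2, forall z, F z <= c * P z} ->
  (\int[mu2]_z (greenD (x, 1 + n.+1%:R^-1)%R z * F z)%:E <=
   (c * n.+1%:R^-1)%:E * ((4 / pi)%:E * sweep P x + strip_part P x n))%E.
Proof.
move=> mP P0 Pz mF F0 c0 FP; set h : R := n.+1%:R^-1.
have h0 : 0 < h by rewrite invr_gt0.
have m1 := measurable_greenD1 (x, 1 + h).
apply: (@le_trans _ _ (\int[mu2]_z (c * (greenD (x, 1 + h) z * P z))%:E)%E).
  apply: ae_ge0_le_integral => //.
  - by move=> z _; rewrite lee_fin mulr_ge0 ?greenD_ge0.
  - by apply/measurable_EFinP; meas.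
  - by move=> z _; rewrite lee_fin mulr_ge0// mulr_ge0 ?greenD_ge0.
  - by apply/measurable_EFinP; meas.
  have FF : Filter (nbhs (almost_everywhere mu2)).
    exact: (ae_filter_ringOfSetsType (plane_measure (R := R))).
  move: FP; apply: filterS => z Fz _; rewrite lee_fin mulrCA ler_wpM2l ?greenD_ge0//.
have s0 z := @sweep_ge0 P x z P0 Pz.
have t0 z : 0 <= n.+1%:R * (if z.2 - 1 < 2 * h then greenD (x, 1 + h) z * P z else 0).
  by rewrite mulr_ge0//; case: ifP => // _; rewrite mulr_ge0 ?greenD_ge0.
have ms : measurable_fun setT (fun z : R * R => (z.2 - 1) / ((x - z.1) ^+ 2 + (1 - z.2) ^+ 2) * P z).
  by meas.
have mt : measurable_fun setT (fun z : R * R => n.+1%:R * (if z.2 - 1 < 2 * h then greenD (x, 1 + h) z * P z else 0)).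
  by meas.
have p4 : 0 <= 4 / pi :> R by rewrite divr_ge0 ?pi_ge0.
have ch : 0 <= c * h by rewrite mulr_ge0// ltW.
rewrite /sweep /strip_part -[X in (_ * (_ + X))%E]mul1e.
rewrite -(@ge0_integral_lin _ _ _ mu2 _ _ (4 / pi) 1) => //.
rewrite -ge0_integralZl_EFin//; last 2 first.
- by move=> z _; rewrite lee_fin mul1r addr_ge0// mulr_ge0.
- by apply/measurable_EFinP; meas.
under [leRHS]eq_integral do rewrite -EFinM.
apply: ge0_le_integralR; [by meas|by meas| |].
  by move=> z; rewrite mulr_ge0// mulr_ge0 ?greenD_ge0.
move=> z; rewrite mul1r -[leRHS]mulrA ler_wpM2l// -/h.
have [z1|z1] := leP z.2 1.
  by rewrite Pz// !mulr0 add0r; case: ifP => _; rewrite !mulr0.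
rewrite mulrDr; case: ifP => zh.
  rewrite -[leLHS]add0r lerD//; first by rewrite mulr_ge0 ?(ltW h0)// mulr_ge0.
  rewrite [leRHS]mulrA (_ : h * n.+1%:R = 1) ?mul1r//.
  by rewrite mulVf// pnatr_eq0.
rewrite !mulr0 addr0 !mulrA ler_wpM2r// /greenD /= ltrDl h0 z1 /=.
have h1 : 1 < 1 + h by rewrite ltrDl.
have hz : (1 + 1) * (1 + h - 1) <= z.2 - 1.
  by rewrite addrAC subrr add0r leNgt; exact: negbT.
apply: (le_trans (green_le_poisson x z.1 ltr01 h1 hz)).
rewrite addrAC subrr add0r divr1 le_eqVlt; apply/orP; left; apply/eqP; ring.
Qed.

Lemma boundary_derivative_bound P F c (w : R -> R -> R) (d U g D : R -> R) (k : R) :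
  mu2.-integrable setT (EFin \o P) ->
  (forall z, 0 <= P z) -> (forall z, z.2 <= 1 -> P z = 0) ->
  measurable_fun setT F -> (forall z, 0 <= F z) -> 0 <= c ->
  {ae mu2, forall z, F z <= c * P z} ->
  (forall x h, 0 < h -> `|poissonE d x h - U x + h * g x| <= k * h ^+ 2) ->
  (forall x h, 0 < h -> (`|w x (1 + h)%R - poissonE d x h|%:E <=
    \int[mu2]_z (greenD (x, 1 + h)%R z * F z)%:E)%E) ->
  {ae mu, forall x, (w x (1 + h) - d x) / h @[h --> 0^'+] --> D x} ->
  {ae mu, forall x, (sweep P x < +oo)%E} ->
  {ae mu, forall x, `|D x| <= `|g x| + c * (4 / pi) * fine (sweep P x)}.
Proof.
move=> iP P0 Pz mF F0 c0 FP hp hw hD hS; have mP := integrable_mfun iP.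
have hL := strip_part_negligible iP P0 Pz.
have FF : Filter (nbhs (almost_everywhere mu)).
  exact: (ae_filter_ringOfSetsType (leb R)).
apply: filterS3 hD hS hL => x Dx Sx Lx.
have p4 : 0 <= 4 / pi :> R by rewrite divr_ge0 ?pi_ge0.
have S0 : (0 <= sweep P x)%E by apply: integral_ge0 => z _; rewrite lee_fin sweep_ge0.
have SE : sweep P x = (fine (sweep P x))%:E by rewrite fineK// ge0_fin_numE.
have s0 : 0 <= fine (sweep P x) by rewrite fine_ge0.
apply: (@quotient_limit_bound (fun h => w x (1 + h)) (poissonE d x) (d x) (U x) (g x) k) => //.
- by apply: mulr_ge0 => //; exact: mulr_ge0.
- exact: hp.
move=> e e0 n0.
(* The strip enters with the factor [c], and [c (e / (c + 1)) <= e] also when [c = 0]. *)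
have ec : 0 < e / (c + 1) by rewrite divr_gt0// ltr_wpDl.
have : (limn_einf (strip_part P x) < (e / (c + 1))%:E)%E by rewrite Lx lte_fin.
move=> /(limn_einf_lt n0)[n n0n Ln]; exists n => //.
have h0 : 0 < n.+1%:R^-1 :> R by rewrite invr_gt0.
rewrite -lee_fin; apply: (le_trans (hw x _ h0)).
apply: (le_trans (green_potential_bound x n mP P0 Pz mF F0 c0 FP)).
apply: (@le_trans _ _ ((c * n.+1%:R^-1)%:E * ((4 / pi * fine (sweep P x)) + e / (c + 1))%:E)%E).
  apply: lee_wpmul2l; first by rewrite lee_fin mulr_ge0// ltW.
  by rewrite [X in (_ * X + _)%E]SE -EFinM [leRHS]EFinD; apply: leeD => //; exact: ltW.
have ce : c * (e / (c + 1)) <= e.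
  by rewrite mulrA ler_pdivrMr ?ltr_wpDl// [leLHS]mulrC ler_wpM2l ?(ltW e0)// lerDl.
rewrite -EFinM lee_fin; move: (_ / pi) (n.+1%:R^-1) (e / _) h0 ce => r t q t0 ce.
rewrite [leLHS](_ : _ = t * (c * r * fine (sweep P x) + c * q)); last by ring.
by rewrite ler_wpM2l ?(ltW t0)// lerD2l.
Qed.

End boundary_quotient.

(** * Iterated integrals on the half-plane, and the constants [K] and [L] *)

Section half_plane_integrals.
Context {R : realType}.
Local Notation mu := (leb R).
Local Notation mu2 := (mu \x mu)%E.
Implicit Types (z : R * R) (phi : R -> R) (G : R -> R -> R).

Lemma in_upper z : (z \in upper) = (1 < z.2).
Proof.
apply/idP/idP => [|z1]; rewrite inE /upper/= in_itv/= andbT; first by case.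
by split.
Qed.

Lemma measurable_upper : measurable (@upper R).
Proof. by apply: measurableX => //. Qed.

Lemma integrable_upper (g : R * R -> R) :
  mu2.-integrable upper (fun z => (g z)%:E) ->
  mu2.-integrable setT (EFin \o (fun z => if 1 < z.2 then g z else 0)).
Proof.
move=> ig; have := (@integrable_mkcond _ _ _ mu2 _ _ measurable_upper).1 ig.
apply: eq_integrable => // z _.
by rewrite patchE in_upper /=; case: ifP.
Qed.

(** The iterated real integral replaces each inner integral by its finite part. By Fubini the inner
    integrals are finite for almost every [xi], so the value is that of the plane integral. *)
Lemma Rintegral_upper G :
  mu2.-integrable upper (fun z => (G z.1 z.2)%:E) ->
  \int[mu]_xi \int[mu]_(eta in `]1, +oo[) G xi eta =
  fine (\int[mu2]_z (if 1 < z.2 then G z.1 z.2 else 0)%:E)%E.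
Proof.
move=> /integrable_upper iG.
rewrite -(integral12_prod_meas1 iG); congr fine.
have iF := integrable_fubini_F iG.
have mF := measurable_fubini_F iG.
have E xi : (\int[mu]_(eta in `]1, +oo[) G xi eta)%:E = (fine (fubini_F mu (EFin \o (fun z => if 1 < z.2 then G z.1 z.2 else 0)) xi))%:E.
  rewrite /fubini_F Rintegral_mkcond; congr (fine _)%:E.
  apply: eq_integral => eta _; rewrite patchE /= .
  by rewrite mem_setE in_itv/= andbT; case: ifP.
under [LHS]eq_integral do rewrite E.
apply: ae_eq_integral => //.
- by apply/measurable_EFinP; apply: (measurableT_comp _ mF); exact: fine_measurable.
- by have := integrable_ae measurableT iF; apply: filterS => x /(_ I) fx _; rewrite fineK.
Qed.

Lemma integrable_poissonE phi x h : 0 < h -> mu.-integrable setT (EFin \o phi) ->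
  mu.-integrable setT (EFin \o (fun xi => green_eta x (1 + h) xi 1 * phi xi)).
Proof.
move=> h0 iphi; have mphi := integrable_mfun iphi.
have E xi : green_eta x (1 + h) xi 1 = pi^-1 * (h / ((x - xi) ^+ 2 + h ^+ 2)).
  rewrite green_eta1E ?ltrDl//; by rewrite addrAC subrr add0r.
have D0 xi : 0 < (x - xi) ^+ 2 + h ^+ 2 by rewrite ltr_wpDl ?sqr_ge0// exprn_gt0.
have := @integrable_bddM _ _ _ mu (fun xi => pi^-1 * (h / ((x - xi) ^+ 2 + h ^+ 2))) phi (pi^-1 * h^-1).
move=> H; have {}H := H _ _ iphi.
apply: eq_integrable (H _ _) => //.
- by move=> xi _ /=; rewrite E mulrC.
- by meas.
- move=> xi; rewrite ger0_norm; last by rewrite mulr_ge0 ?invr_ge0 ?pi_ge0// divr_ge0// ltW.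
  rewrite ler_wpM2l ?invr_ge0 ?pi_ge0// ler_pdivrMr// mulrDr expr2 mulKf ?gt_eqF//.
  by rewrite lerDr mulr_ge0 ?invr_ge0 ?(ltW h0)// sqr_ge0.
Qed.

Lemma poissonEB phi1 phi2 x h : 0 < h ->
  mu.-integrable setT (EFin \o phi1) -> mu.-integrable setT (EFin \o phi2) ->
  poissonE (fun y => phi1 y - phi2 y) x h = poissonE phi1 x h - poissonE phi2 x h.
Proof.
move=> h0 i1 i2; rewrite /poissonE.
rewrite -(RintegralB measurableT (integrable_poissonE x h0 i1) (integrable_poissonE x h0 i2)).
by apply: eq_Rintegral => y _; rewrite mulrBr.
Qed.

Definition onD (p : R -> R -> R) z : R := if 1 < z.2 then `|p z.1 z.2| else 0.

Lemma onD_ge0 p z : 0 <= onD p z.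
Proof. by rewrite /onD; case: ifP. Qed.

Lemma onD_eq0 p z : z.2 <= 1 -> onD p z = 0.
Proof. by rewrite /onD ltNge => ->. Qed.

Lemma integrable_onD p : mu2.-integrable upper (fun z => (p z.1 z.2)%:E) ->
  mu2.-integrable setT (EFin \o onD p).
Proof.
move=> /integrable_upper /integrable_norm; apply: eq_integrable => // z _.
by rewrite /onD /=; case: ifP => //; rewrite normr0.
Qed.

Lemma constK_green p z : mu2.-integrable upper (fun z => (p z.1 z.2)%:E) ->
  1 < z.2 ->
  (\int[mu2]_z' (greenD z z' * onD p z')%:E <= constK p)%E.
Proof.
move=> ip z1; have mp := integrable_mfun (integrable_onD ip).
have m1 := measurable_greenD1 z.
apply: ereal_sup_ubound; exists z; first by rewrite /upper/= in_itv/= z1.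
pose k xi eta : R := greenD z (xi, eta) * onD p (xi, eta).
have kE (z' : R * R) : k z'.1 z'.2 = greenD z z' * onD p z' by case: z'.
have mk : measurable_fun setT (fun z' : R * R => (k z'.1 z'.2)%:E).
  by under eq_fun do rewrite kE; apply/measurable_EFinP; meas.
have k0 xi eta : (0 <= (k xi eta)%:E)%E by rewrite lee_fin mulr_ge0 ?greenD_ge0 ?onD_ge0.
under [RHS]eq_integral do rewrite -kE.
rewrite (tonelli_prod mu mu mk k0).
apply: eq_integral => xi _; rewrite integral_mkcond; apply: eq_integral => eta _.
rewrite patchE mem_setE in_itv/= andbT /k /greenD /onD /= z1 /=.
by case: ifP => //; rewrite mul0r.
Qed.

Lemma sweepE p x : mu2.-integrable upper (fun z => (p z.1 z.2)%:E) ->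
  (\int[mu]_(eta in `]1%R, +oo[) \int[mu]_xi
     ((eta - 1) / ((x - xi) ^+ 2 + (1 - eta) ^+ 2) * `|p xi eta|)%:E)%E = sweep (onD p) x.
Proof.
move=> ip; have mp := integrable_mfun (integrable_onD ip).
pose k xi eta : R := (eta - 1) / ((x - xi) ^+ 2 + (1 - eta) ^+ 2) * onD p (xi, eta).
have kE (z : R * R) : k z.1 z.2 = (z.2 - 1) / ((x - z.1) ^+ 2 + (1 - z.2) ^+ 2) * onD p z.
  by case: z.
have mk : measurable_fun setT (fun z : R * R => (k z.1 z.2)%:E).
  by under eq_fun do rewrite kE; apply/measurable_EFinP; meas.
have k0 xi eta : (0 <= (k xi eta)%:E)%E.
  rewrite lee_fin /k; have [e1|e1] := leP eta 1; first by rewrite onD_eq0// mulr0.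
  by rewrite mulr_ge0 ?onD_ge0// divr_ge0 ?subr_ge0 ?(ltW e1)// addr_ge0 ?sqr_ge0.
rewrite /sweep; under [RHS]eq_integral do rewrite -kE.
rewrite (tonelli_prod mu mu mk k0) (tonelliC mu mu mk k0) integral_mkcond.
apply: eq_integral => eta _; rewrite patchE mem_setE in_itv/= andbT.
case: ifP => e1; first by apply: eq_integral => xi _; rewrite /k /onD/= e1.
by rewrite (eq_integral (cst 0%E)) ?integral0// => xi _; rewrite /k /onD/= e1 mulr0.
Qed.

Lemma measurable_sweep p : mu2.-integrable upper (fun z => (p z.1 z.2)%:E) ->
  measurable_fun setT (sweep (onD p)) /\ forall x, (0 <= sweep (onD p) x)%E.
Proof.
move=> ip; have mp := integrable_mfun (integrable_onD ip).
have k0 x (z : R * R) : (0 <= ((z.2 - 1) / ((x - z.1) ^+ 2 + (1 - z.2) ^+ 2) * onD p z)%:E)%E.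
  rewrite lee_fin; have [e1|e1] := leP z.2 1; first by rewrite onD_eq0// mulr0.
  by rewrite mulr_ge0 ?onD_ge0// divr_ge0 ?subr_ge0 ?(ltW e1)// addr_ge0 ?sqr_ge0.
have mk : measurable_fun setT (fun xz : R * (R * R) =>
    (xz.2.2 - 1) / ((xz.1 - xz.2.1) ^+ 2 + (1 - xz.2.2) ^+ 2) * onD p xz.2).
  by move: (onD p) mp => P mP; meas.
split; last by move=> x; apply: integral_ge0.
rewrite /sweep; apply: (@measurable_integral2 _ _ _ _ _ plane_measure (fun (x : R) z =>
  ((z.2 - 1) / ((x - z.1) ^+ 2 + (1 - z.2) ^+ 2) * onD p z)%:E)) => //.
by apply/measurable_EFinP; exact: mk.
Qed.

Lemma constL_sweep p : mu2.-integrable upper (fun z => (p z.1 z.2)%:E) ->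
  (constL p < +oo)%E -> (\int[mu]_x (sweep (onD p) x ^+ 2) < +oo)%E.
Proof.
move=> ip; rewrite /constL; under eq_integral do rewrite sweepE//.
exact: lty_poweRy.
Qed.

End half_plane_integrals.

(** * The difference of two solutions and of their source terms *)

Section solution_difference.
Context {R : realType}.
Local Notation mu := (leb R).
Local Notation mu2 := (mu \x mu)%E.
Implicit Types (z : R * R) (phi : R -> R) (u p : R -> R -> R) (f : R -> R -> R -> R).

Definition sourceD f u1 u2 : R * R -> R :=
  onD (fun xi eta => f xi eta (u1 xi eta) - f xi eta (u2 xi eta)).

Lemma sourceD_lipschitz f p u1 u2 z :
  (forall xi eta zeta1 zeta2 : R, 0 < eta ->
    `|f xi eta zeta1 - f xi eta zeta2| <= `|p xi eta| * `|zeta1 - zeta2|) ->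
  1 < z.2 -> sourceD f u1 u2 z <= onD p z * `|u1 z.1 z.2 - u2 z.1 z.2|.
Proof.
by move=> lip z1; rewrite /sourceD /onD z1; apply: lip; exact: lt_trans z1.
Qed.

Let green_sourceD f phi1 phi2 u1 u2 x y : 1 < y ->
  solution f phi1 u1 -> solution f phi2 u2 ->
  let D z := if 1 < z.2 then green x y z.1 z.2 *
    (f z.1 z.2 (u1 z.1 z.2) - f z.1 z.2 (u2 z.1 z.2)) else 0 in
  [/\ mu2.-integrable setT (EFin \o D),
    (forall z, greenD (x, y) z * sourceD f u1 u2 z = `|D z|) &
    (u1 x y - u2 x y = poissonE phi1 x (y - 1) - poissonE phi2 x (y - 1) -
      fine (\int[mu2]_z (D z)%:E)%E)%R].
Proof.
move=> y1 s1 s2 D.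
have [/[dup] j1 /integrable_upper i1 e1] := s1 x y y1.
have [/[dup] j2 /integrable_upper i2 e2] := s2 x y y1.
have DE z : D z = (if 1 < z.2 then green x y z.1 z.2 * f z.1 z.2 (u1 z.1 z.2) else 0) -
    (if 1 < z.2 then green x y z.1 z.2 * f z.1 z.2 (u2 z.1 z.2) else 0).
  by rewrite /D; case: ifP => _; [rewrite mulrBr|rewrite subr0].
have iD : mu2.-integrable setT (EFin \o D).
  have := integrableB measurableT i1 i2.
  by apply: eq_integrable => // z _ /=; rewrite DE EFinB.
split => //.
  move=> z; rewrite /sourceD /greenD /onD /D /= y1 /=.
  case: ifP => z1; last by rewrite mulr0 normr0.
  by rewrite normrM (ger0_norm (green_ge0 _ _ y1 z1)).
rewrite e1 e2 /opA.
rewrite (Rintegral_upper (G := fun xi eta => green x y xi eta * f xi eta (u1 xi eta)) j1).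
rewrite (Rintegral_upper (G := fun xi eta => green x y xi eta * f xi eta (u2 xi eta)) j2).
have -> : (\int[mu2]_z (D z)%:E = \int[mu2]_z (if 1 < z.2 then green x y z.1 z.2 * f z.1 z.2 (u1 z.1 z.2) else 0)%:E -
    \int[mu2]_z (if 1 < z.2 then green x y z.1 z.2 * f z.1 z.2 (u2 z.1 z.2) else 0)%:E)%E.
  by rewrite -(integralB measurableT i1 i2); apply: eq_integral => z _; rewrite DE EFinB.
rewrite (fineB (integrable_fin_num measurableT i1) (integrable_fin_num measurableT i2)).
rewrite /poissonE (_ : 1 + (y - 1) = y); last by ring.
by ring.
Qed.

(** [f] is an arbitrary function: measurability is extracted from the integrability contained in
    [solution], at the single point [(0, 2)]. There the Green function vanishes by convention, so
    the value at this point is set apart. *)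
Lemma measurable_sourceD f phi1 phi2 u1 u2 :
  solution f phi1 u1 -> solution f phi2 u2 -> measurable_fun setT (sourceD f u1 u2).
Proof.
move=> s1 s2; have y2 : 1 < 2 :> R by rewrite ltr1n.
have [iD gD _] := green_sourceD 0 y2 s1 s2.
move: iD gD; set D := (fun z => if _ then _ else _) => iD gD.
have mD := integrable_mfun iD.
(* Only [green * f] is known to be measurable: divide by [green]. *)
have -> : sourceD f u1 u2 = fun z => if (z.1 == 0) && (z.2 == 2) then sourceD f u1 u2 (0, 2)
    else `|D z / green 0 2 z.1 z.2|.
  apply/funext => z; case: ifPn => z0.
    by case: z z0 => a b /= /andP[/eqP -> /eqP ->].
  have [z1|z1] := leP z.2 1.
    by rewrite /sourceD onD_eq0// /D ltNge z1/= mul0r normr0.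
  rewrite normrM -gD /greenD/= y2 z1/=.
  have g0 : 0 < green 0 2 z.1 z.2.
    have V0 : 0 < (0 - z.1) ^+ 2 + (2 - z.2) ^+ 2.
      rewrite lt_def addr_ge0 ?sqr_ge0// andbT paddr_eq0 ?sqr_ge0// !sqrf_eq0 !subr_eq0.
      by apply: contra z0 => /andP[/eqP <- /eqP <-]; rewrite !eqxx.
    apply: lt_le_trans (green_ge y2 z1 V0).
    rewrite mulr_gt0 ?invr_gt0 ?pi_gt0// divr_gt0 ?mulr_gt0 ?subr_gt0//.
    by rewrite ltr_wpDl ?sqr_ge0// exprn_gt0//; lra.
  by rewrite normfV (gtr0_norm g0) mulrAC mulfV ?mul1r// gt_eqF.
apply: measurable_fun_ifT.
- by apply: measurable_and; apply: measurable_fun_eqr; meas.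
- by meas.
- apply: measurable_fun_norm; apply: measurable_funM => //; apply: measurable_funV.
  by rewrite /green; meas.
Qed.

Lemma solution_difference f phi1 phi2 u1 u2 :
  mu.-integrable setT (EFin \o phi1) -> mu.-integrable setT (EFin \o phi2) ->
  solution f phi1 u1 -> solution f phi2 u2 ->
  (forall z, 1 < z.2 -> (\int[mu2]_z' (greenD z z' * sourceD f u1 u2 z')%:E < +oo)%E) /\
  (forall x h, 0 < h ->
    (`|u1 x (1 + h)%R - u2 x (1 + h)%R - poissonE (fun x => phi1 x - phi2 x) x h|%:E <=
     \int[mu2]_z' (greenD (x, 1 + h)%R z' * sourceD f u1 u2 z')%:E)%E).
Proof.
move=> i1 i2 s1 s2; split.
  move=> [x y] y1; have [iD gD _] := green_sourceD x y1 s1 s2.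
  under eq_integral do rewrite gD.
  by have /integrable_lty := integrable_norm iD; apply.
move=> x h h0; have h1 : 1 < 1 + h by rewrite ltrDl.
have [iD gD ->] := green_sourceD x h1 s1 s2.
under [leRHS]eq_integral do rewrite gD.
rewrite (_ : 1 + h - 1 = h); last by ring.
rewrite (poissonEB _ h0 i1 i2) addrAC subrr add0r normrN.
move: iD; set D := (fun z => if _ then _ else _) => iD.
have := EFin_normr_Rintegral measurableT iD; rewrite /Rintegral => ->.
by apply: le_abse_integral => //; apply/measurable_EFinP; exact: integrable_mfun iD.
Qed.

End solution_difference.

(** * Hoelder stability for data of bounded spectral size *)

Section stability.
Context {R : realType}.
Local Notation mu := (leb R).
Local Notation mu2 := (mu \x mu)%E.
Implicit Types (phi psi : R -> R) (u p : R -> R -> R) (f : R -> R -> R -> R).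

Lemma spaceJ_sub_le1 u1 u2 : spaceJ u1 -> spaceJ u2 ->
  exists M : R, forall z : R * R, 1 < z.2 -> M < Num.sqrt (z.1 ^+ 2 + z.2 ^+ 2) ->
    `|u1 z.1 z.2 - u2 z.1 z.2| <= 1.
Proof.
move=> [_ J1] [_ J2]; have e0 : 0 < 2^-1 :> R by rewrite invr_gt0.
have [M0 [_ HM]] := filterI (J1 _ e0) (J2 _ e0).
have [H1 H2] := HM (M0 + 1) (ltac:(by rewrite ltrDl)).
exists (M0 + 1) => z z1 zM.
have := H1 _ _ z1 zM; have := H2 _ _ z1 zM.
have := ler_normB (u1 z.1 z.2) (u2 z.1 z.2); lra.
Qed.

(** Bessel's inequality once more, now with functions of the frequency as input; each of [A] and [B]
    contributes [2 pi c], and the prefactor [(2 pi)^-2 <= 1/4] absorbs the cross term. *)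
Lemma inverseT_L2 (A B : R -> R) (c : R) : mu.-integrable setT (EFin \o A) ->
  mu.-integrable setT (EFin \o B) ->
  (\int[mu]_z (A z ^+ 2)%:E <= c%:E)%E -> (\int[mu]_z (B z ^+ 2)%:E <= c%:E)%E ->
  (\int[mu]_x (inverseT A B x ^+ 2)%:E <= (4 * pi * c)%:E)%E.
Proof.
move=> iA iB hA hB.
have [mAc mAs] := measurable_trigT iA; have [mBc mBs] := measurable_trigT iB.
have q0 : 0 <= (2 * pi)^-1 :> R by rewrite invr_ge0 mulr_ge0 ?pi_ge0.
have q1 : (2 * pi)^-1 <= 2^-1 :> R.
  by rewrite lef_pV2 ?posrE ?mulr_gt0 ?pi_gt0//; have := pi_ge2 R; lra.
apply: (@le_trans _ _ (\int[mu]_x (1 * (cosT A x ^+ 2 + sinT A x ^+ 2) + 1 * (cosT B x ^+ 2 + sinT B x ^+ 2))%:E)%E).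
  apply: ge0_le_integralR; [by rewrite /inverseT; meas|by meas| |].
    by move=> x; rewrite sqr_ge0.
  move=> x; rewrite /inverseT exprMn !mul1r.
  have := sqr_ge0 (cosT A x - sinT B x); have := sqr_ge0 (cosT A x + sinT B x).
  have := sqr_ge0 (sinT A x); have := sqr_ge0 (cosT B x).
  have : (2 * pi)^-1 ^+ 2 <= 4^-1 :> R.
    by rewrite (_ : 4^-1 = 2^-1 ^+ 2); [rewrite ler_sqr ?nnegrE|field].
  move: ((2 * pi)^-1 ^+ 2) => q; nra.
rewrite ge0_integral_lin//; last 4 first.
- by meas.
- by meas.
- by move=> x; rewrite addr_ge0 ?sqr_ge0.
- by move=> x; rewrite addr_ge0 ?sqr_ge0.
rewrite !mul1e (_ : 4 * pi * c = 2 * pi * c + 2 * pi * c); last by ring.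
have p0 : (0 <= (2 * pi)%:E :> \bar R)%E by rewrite lee_fin mulr_ge0 ?pi_ge0.
rewrite EFinD; apply: leeD; rewrite EFinM.
  by apply: (le_trans (bessel_inequality iA)); exact: lee_wpmul2l.
by apply: (le_trans (bessel_inequality iB)); exact: lee_wpmul2l.
Qed.

(** [C] is fixed before the data and depends only on [p] and [Q]. The bound [4 r^2] is the one for
    two data that both lie within [r] of the same measurement. *)
Lemma stability f p Q :
  mu2.-integrable upper (fun z : R * R => (p z.1 z.2)%:E) ->
  (forall xi eta zeta1 zeta2 : R, 0 < eta ->
    `|f xi eta zeta1 - f xi eta zeta2| <= `|p xi eta| * `|zeta1 - zeta2|) ->
  (constK p < 1)%E -> (constL p < +oo)%E -> 0 <= Q ->
  exists2 C, 0 <= C & forall phi1 phi2 u1 u2 psi1 psi2 r,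
    let d := fun x => phi1 x - phi2 x in
    mu.-integrable setT (EFin \o phi1) -> mu.-integrable setT (EFin \o phi2) ->
    spaceJ u1 -> spaceJ u2 -> solution f phi1 u1 -> solution f phi2 u2 ->
    normal_derivative phi1 u1 psi1 -> normal_derivative phi2 u2 psi2 ->
    measurable_fun setT psi1 -> measurable_fun setT psi2 -> 0 < r ->
    (\int[mu]_x (d x ^+ 2)%:E <= (4 * r ^+ 2)%:E)%E ->
    (\int[mu]_z (cosT d z ^+ 2 * expR (2 * `|z|))%:E <= Q%:E)%E ->
    (\int[mu]_z (sinT d z ^+ 2 * expR (2 * `|z|))%:E <= Q%:E)%E ->
    (\int[mu]_x ((psi1 x - psi2 x) ^+ 2)%:E <= (C * r)%:E)%E.
Proof.
move=> ip lip K1 Loo Q0.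
have iP := integrable_onD ip; have P0 := @onD_ge0 _ p; have Pz := @onD_eq0 _ p.
have mP := integrable_mfun iP.
have y2 : 1 < (0 : R, 2 : R).2 by rewrite /= ltr1n.
have K0 : (0 <= constK p)%E.
  apply: le_trans (constK_green ip y2); apply: integral_ge0 => z _.
  by rewrite lee_fin mulr_ge0 ?greenD_ge0 ?onD_ge0.
have KE : constK p = (fine (constK p))%:E.
  by rewrite fineK// ge0_fin_numE// (lt_trans K1)// ltry.
set K := fine (constK p) in KE.
have K01 : 0 <= K < 1 by move: K0 K1; rewrite KE !lee_fin lte_fin => -> ->.
have hK z : (\int[mu2]_z' (greenD z z' * onD p z')%:E <= K%:E)%E.
  have [z1|z1] := leP z.2 1; last by rewrite -KE; exact: constK_green.
  rewrite (eq_integral (cst 0%E)); last by move=> z' _; rewrite /greenD ltNge z1/= mul0r.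
  by rewrite integral0 lee_fin; case/andP: K01.
have [mS S0] := measurable_sweep ip.
have Soo := constL_sweep ip Loo.
have mS2 : measurable_fun setT (fun x => sweep (onD p) x ^+ 2)%E.
  by under eq_fun do rewrite expe2; exact: emeasurable_funM.
have S20 x : (0 <= sweep (onD p) x ^+ 2)%E by rewrite expe_ge0.
pose s x : R := fine (sweep (onD p) x).
have ms : measurable_fun setT s by apply: (measurableT_comp _ mS); exact: fine_measurable.
pose S := fine (\int[mu]_x (sweep (onD p) x ^+ 2))%E.
have SE : (\int[mu]_x (sweep (onD p) x ^+ 2) = S%:E)%E.
  by rewrite fineK// ge0_fin_numE// integral_ge0.
have S_ge0 : 0 <= S by rewrite fine_ge0// integral_ge0.
(* Where [sweep] is infinite, [fine] returns 0, so the comparison still holds. *)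
have hs2 : (\int[mu]_x (s x ^+ 2)%:E <= S%:E)%E.
  rewrite -SE; apply: ge0_le_integral => //.
  - by move=> x _; rewrite lee_fin sqr_ge0.
  - by apply/measurable_EFinP; meas.
  move=> x _; rewrite /s; case: (sweep _ x) (S0 x) => [a||]//= a0.
    by rewrite expr0n leey.
have hS : {ae mu, forall x, (sweep (onD p) x < +oo)%E}.
  have i2 : mu.-integrable setT (fun x => sweep (onD p) x ^+ 2)%E.
    apply/integrableP; split => //.
    by under eq_integral do rewrite gee0_abs//.
  have := integrable_ae measurableT i2; apply: filterS => x /(_ I).
  by case: (sweep _ x) (S0 x) => [a||]//= _; rewrite ?ltry.
(* The [2 pi] of Bessel's inequality times the 4 of [4 r^2]. *)
pose c0 : R := 8 * pi.
have c00 : 0 <= c0 by rewrite mulr_ge0 ?pi_ge0.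
(* Two transforms give [delta <= 2 (c0 + Q + 1) sqrt r]; then come [1 / (1 - K)] for the source and
   [4 / pi] for its normal derivative. *)
pose m := 2 * (c0 + Q + 1) / (1 - K) * (4 / pi).
have K1' : 0 <= (1 - K)^-1 by rewrite invr_ge0 subr_ge0 ltW//; case/andP: K01.
have m_ge0 : 0 <= m.
  apply: mulr_ge0; last by rewrite divr_ge0 ?pi_ge0.
  by apply: mulr_ge0 => //; apply: mulr_ge0 => //; rewrite !addr_ge0.
exists (2 * (4 * pi * (c0 + Q)) + 2 * (m ^+ 2 * S)).
  apply: addr_ge0; apply: mulr_ge0 => //; last by apply: mulr_ge0 => //; exact: sqr_ge0.
  by apply: mulr_ge0; [rewrite mulr_ge0 ?pi_ge0|exact: addr_ge0].
move=> phi1 phi2 u1 u2 psi1 psi2 r d i1 i2 J1 J2 s1 s2 n1 n2 mpsi1 mpsi2 r0 hd hA hB.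
have id : mu.-integrable setT (EFin \o d) := integrableB measurableT i1 i2.
have md := integrable_mfun id.
have [mA mB] := measurable_trigT id.
have bes := bessel_inequality id.
have c0E : ((2 * pi)%:E * \int[mu]_x (d x ^+ 2)%:E <= (c0 * r ^+ 2)%:E)%E.
  rewrite (_ : c0 * r ^+ 2 = 2 * pi * (4 * r ^+ 2)); last by rewrite /c0; ring.
  by rewrite [leRHS]EFinM; apply: lee_wpmul2l => //; rewrite lee_fin mulr_ge0 ?pi_ge0.
have hA2 : (\int[mu]_z (cosT d z ^+ 2)%:E <= (c0 * r ^+ 2)%:E)%E.
  apply: le_trans c0E; apply: le_trans bes; apply: ge0_le_integralR; [by meas|by meas| |].
    by move=> z; rewrite sqr_ge0.
  by move=> z; rewrite lerDl sqr_ge0.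
have hB2 : (\int[mu]_z (sinT d z ^+ 2)%:E <= (c0 * r ^+ 2)%:E)%E.
  apply: le_trans c0E; apply: le_trans bes; apply: ge0_le_integralR; [by meas|by meas| |].
    by move=> z; rewrite sqr_ge0.
  by move=> z; rewrite lerDr sqr_ge0.
have [gA lA] := spectral_interpolation r0 c00 Q0 mA hA2 hA.
have [gB lB] := spectral_interpolation r0 c00 Q0 mB hB2 hB.
have hAoo := le_lt_trans hA (ltry Q); have hBoo := le_lt_trans hB (ltry Q).
have [hbd [k hk]] := poissonE_expansion id hAoo hBoo.
set delta := _ + _ in hbd.
have Rle (h : R -> R) (a : R) : 0 <= a -> (\int[mu]_z `|h z|%:E <= a%:E)%E -> \int[mu]_z `|h z| <= a.
  move=> a0 ha; rewrite /Rintegral -lee_fin fineK// ge0_fin_numE ?integral_ge0//.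
  exact: le_lt_trans (ltry a).
have sr0 : 0 <= Num.sqrt r by rewrite sqrtr_ge0.
have a0 : 0 <= (c0 + Q + 1) * Num.sqrt r by rewrite mulr_ge0 ?addr_ge0.
have hdelta : delta <= 2 * (c0 + Q + 1) * Num.sqrt r.
  rewrite -mulrA mulr_natl mulr2n; apply: lerD; exact: Rle.
have d0 : 0 <= delta by rewrite addr_ge0// Rintegral_ge0.
have [M hM] := spaceJ_sub_le1 J1 J2.
have [hN hw] := solution_difference i1 i2 s1 s2.
have mF := measurable_sourceD s1 s2.
have F0 : forall z, 0 <= sourceD f u1 u2 z := @onD_ge0 _ _.
have Fz : forall z : R * R, z.2 <= 1 -> sourceD f u1 u2 z = 0 := @onD_eq0 _ _.
have FP := contraction_uniform_bound (w := fun z => u1 z.1 z.2 - u2 z.1 z.2)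
  iP P0 Pz K01 hK mF F0 Fz d0 hN.
have {}FP : {ae mu2, forall z, sourceD f u1 u2 z <= delta / (1 - K) * onD p z}.
  apply: (FP M) => //.
  - move=> [x y] /= y1; have h0 : 0 < y - 1 by rewrite subr_gt0.
    have := hw x _ h0; rewrite (_ : 1 + (y - 1) = y); last by ring.
    move=> hwy; rewrite -(subrK (poissonE d x (y - 1)) (u1 x y - u2 x y)).
    apply: (@le_trans _ _ (`|u1 x y - u2 x y - poissonE d x (y - 1)| + `|poissonE d x (y - 1)|)%:E).
      by rewrite lee_fin ler_normD.
    by rewrite EFinD addeC; apply: leeD => //; rewrite lee_fin; exact: hbd.
  - by move=> z z1; exact: sourceD_lipschitz.
have FF : Filter (nbhs (almost_everywhere mu)).
  exact: (ae_filter_ringOfSetsType (leb R)).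
have hq : {ae mu, forall x, ((u1 x (1 + h) - u2 x (1 + h)) - d x) / h @[h --> 0^'+] --> psi1 x - psi2 x}.
  apply: filterS2 n1 n2 => x q1 q2.
  have -> : (fun h => (u1 x (1 + h) - u2 x (1 + h) - d x) / h) =
      (fun h => (u1 x (1 + h) - phi1 x) / h - (u2 x (1 + h) - phi2 x) / h).
    by apply/funext => h; rewrite -mulrBl /d; congr (_ / _); ring.
  exact: cvgB q1 q2.
have cK : 0 <= delta / (1 - K) by rewrite divr_ge0// subr_ge0 ltW//; case/andP: K01.
have main := boundary_derivative_bound
  (w := fun x y => u1 x y - u2 x y) (d := d) (D := fun x => psi1 x - psi2 x)
  (U := inverseT (cosT d) (sinT d))
  (g := inverseT (fun z => `|z| * cosT d z) (fun z => `|z| * sinT d z)) iP P0 Pz mF F0 cK FP hk hw hq hS.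
have iA1 : mu.-integrable setT (EFin \o (fun z => `|z| * cosT d z)).
  by have := integrable_expR_weight 1 mA hAoo; apply: eq_integrable => // z _ /=; rewrite expr1.
have iB1 : mu.-integrable setT (EFin \o (fun z => `|z| * sinT d z)).
  by have := integrable_expR_weight 1 mB hBoo; apply: eq_integrable => // z _ /=; rewrite expr1.
have g2 := inverseT_L2 iA1 iB1 gA gB.
set g := inverseT _ _ in g2 main.
have mg : measurable_fun setT g.
  have [? ?] := measurable_trigT iA1; have [? ?] := measurable_trigT iB1.
  by rewrite /g /inverseT; meas.
have mr0 : 0 <= 2 * m ^+ 2 * r := mulr_ge0 (mulr_ge0 (ler0n _ 2) (sqr_ge0 m)) (ltW r0).
apply: (@le_trans _ _ (\int[mu]_x (2 * g x ^+ 2 + (2 * m ^+ 2 * r) * s x ^+ 2)%:E)%E).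
  apply: ae_ge0_le_integral => //.
  - by move=> x _; rewrite lee_fin sqr_ge0.
  - by apply/measurable_EFinP; meas.
  - by move=> x _; rewrite lee_fin; apply: addr_ge0; apply: mulr_ge0 => //; exact: sqr_ge0.
  - by apply/measurable_EFinP; meas.
  move: main; apply: filterS => x hx _; rewrite lee_fin.
  have s0 : 0 <= s x by rewrite fine_ge0.
  have hc : delta / (1 - K) * (4 / pi) <= m * Num.sqrt r.
    rewrite [leRHS](_ : _ = 2 * (c0 + Q + 1) * Num.sqrt r / (1 - K) * (4 / pi)).
      by rewrite ler_wpM2r ?divr_ge0 ?pi_ge0// ler_wpM2r.
    by rewrite /m; ring.
  have : `|psi1 x - psi2 x| <= `|g x| + m * Num.sqrt r * s x.
    by apply: (le_trans hx); rewrite lerD2l ler_wpM2r.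
  have m0 : 0 <= m * Num.sqrt r * s x.
    by apply: mulr_ge0 => //; exact: mulr_ge0.
  rewrite -(real_normK (num_real (psi1 x - psi2 x))) -(real_normK (num_real (g x))).
  rewrite (_ : 2 * m ^+ 2 * r * s x ^+ 2 = 2 * (m * Num.sqrt r * s x) ^+ 2); last first.
    by rewrite !exprMn sqr_sqrtr ?(ltW r0)//; ring.
  move: (m * _ * s x) m0 => b b0 h1.
  have := normr_ge0 (psi1 x - psi2 x); have := normr_ge0 (g x).
  move: (`|psi1 x - psi2 x|) (`|g x|) h1 => X Y h1 Y0 X0.
  apply: (@le_trans _ _ ((Y + b) ^+ 2)); first by rewrite ler_sqr ?nnegrE ?addr_ge0.
  by rewrite -subr_ge0 (_ : _ - _ = (Y - b) ^+ 2) ?sqr_ge0//; ring.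
rewrite ge0_integral_lin//; last 4 first.
- by meas.
- by meas.
- by move=> x; rewrite sqr_ge0.
- by move=> x; rewrite sqr_ge0.
apply: (@le_trans _ _ (2%:E * (4 * pi * ((c0 + Q) * r))%:E + (2 * m ^+ 2 * r)%:E * S%:E)%E).
  by apply: leeD; apply: lee_wpmul2l => //; rewrite lee_fin.
rewrite -!(EFinM, EFinD) lee_fin le_eqVlt; apply/orP; left; apply/eqP; ring.
Qed.

End stability.

(** * Choice of the regularized datum and its derivative *)

Section regularization.
Context {R : realType}.
Local Notation mu := (leb R).
Implicit Types (phi psi : R -> R) (u p : R -> R -> R) (f : R -> R -> R -> R).

Lemma integral_sqr_ae (g h : R -> R) : measurable_fun setT g -> measurable_fun setT h ->
  {ae mu, forall x, g x = h x} -> (\int[mu]_x (g x ^+ 2)%:E = \int[mu]_x (h x ^+ 2)%:E)%E.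
Proof.
move=> mg mh gh; apply: ae_eq_integral => //.
- by apply/measurable_EFinP; meas.
- by apply/measurable_EFinP; meas.

- have FF : Filter (nbhs (almost_everywhere mu)) by exact: (ae_filter_ringOfSetsType mu).
  by move: gh; apply: filterS => x /= -> _.
Qed.

(** The values of the regularization are classes, so the exact derivative must be turned into one
    before it can compete as a candidate. *)
Lemma L2_class psi : psi \in Lfun mu 2%:E ->
  exists g : L2 R, {ae mu, forall x, g x = psi x}.
Proof.
move=> hpsi; have mpsi : measurable_fun setT (psi : R -> measurableTypeR R).
  by move: hpsi; rewrite inE => /andP[+ _]; rewrite inE.
pose F : {mfun measurableTypeR R >-> measurableTypeR R} :=
  HB.pack psi (isMeasurableFun.Build _ _ (measurableTypeR R) (measurableTypeR R) psi mpsi).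
have FF : Filter (nbhs (almost_everywhere mu)) by exact: (ae_filter_ringOfSetsType mu).
pose g0 : {mfun_ mu, measurableTypeR R >-> measurableTypeR R} := \pi%qT F.
have ae0 : {ae mu, forall x, g0 x = psi x}.
  have : repr g0 == F %[mod {mfun_ mu, measurableTypeR R >-> measurableTypeR R}]%qT by rewrite reprK.
  by rewrite eqmodE => /asboolP; apply: filterS => x; exact.
have fin : finite_norm mu 2%:E g0.
  have mg : measurable_fun setT (g0 : R -> R) by exact: (@measurable_funPT _ _ _ _ (repr g0)).
  have i2 := Lfun2_integrable_sqr hpsi.
  have e : (\int[mu]_x ((g0 x : R) ^+ 2)%:E = \int[mu]_x (psi x ^+ 2)%:E)%E.
    by apply: integral_sqr_ae => //; exact: ae0.
  rewrite /finite_norm; apply: (@lty_poweRy _ _ 2) => //.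
  rewrite poweR_Lnorm//.
  have := integrable_lty measurableT i2; rewrite -e; congr (_ < _)%E.
  by apply: eq_integral => x _ /=; rewrite powR_mulrn// real_normK ?num_real.
pose g : L2 R := HB.pack g0 (isFinLebesgue.Build _ _ _ mu _ (lee1n 2) g0 fin).
by exists g.
Qed.

Lemma measurable_L2 (g : L2 R) : measurable_fun setT (g : R -> R).
Proof.
exact: (@measurable_funPT _ _ _ _ (repr (g : {mfun_ mu, measurableTypeR R >-> measurableTypeR R}))).
Qed.

Lemma normL2_sqr (h : R -> R) : (normL2 h `^ 2 = \int[mu]_x (h x ^+ 2)%:E)%E.
Proof.
rewrite /normL2 poweR_Lnorm//; apply: eq_integral => x _ /=.
by rewrite powR_mulrn// real_normK ?num_real.
Qed.

Lemma normL2_lt (h : R -> R) (a : R) : (normL2 h < a%:E)%E ->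
  (\int[mu]_x (h x ^+ 2)%:E <= (a ^+ 2)%:E)%E.
Proof.
move=> ha; rewrite -normL2_sqr.
have N0 : (0 <= normL2 h)%E by exact: Lnorm_ge0.
have a0 : 0 <= a by rewrite -lee_fin; apply: (le_trans N0); exact: ltW.
have -> : ((a ^+ 2)%:E = a%:E `^ 2)%E by rewrite poweR_EFin powR_mulrn.
by apply: gt0_ler_poweR => //; rewrite ?in_itv/= ?leey ?andbT ?lee_fin//; exact: ltW.
Qed.

Lemma normL2_le (h : R -> R) (a : R) : 0 <= a ->
  (\int[mu]_x (h x ^+ 2)%:E <= a%:E)%E -> (normL2 h <= (Num.sqrt a)%:E)%E.
Proof.
move=> a0 ha.
have N0 : (0 <= normL2 h)%E by exact: Lnorm_ge0.
have I0 : (0 <= \int[mu]_x (h x ^+ 2)%:E)%E.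
  by apply: integral_ge0 => x _; rewrite lee_fin sqr_ge0.
have -> : normL2 h = ((\int[mu]_x (h x ^+ 2)%:E) `^ 2^-1)%E.
  by rewrite -normL2_sqr -poweRrM mulfV// poweRe1.
rewrite -powR12_sqrt// -poweR_EFin.
by apply: gt0_ler_poweR => //; rewrite ?invr_ge0// in_itv/= leey andbT ?lee_fin.
Qed.

Definition spectral_le (n : nat) phi : Prop :=
  (\int[mu]_z (cosT phi z ^+ 2 * expR (2 * `|z|))%:E <= n%:R%:E)%E /\
  (\int[mu]_z (sinT phi z ^+ 2 * expR (2 * `|z|))%:E <= n%:R%:E)%E.

Lemma spectral_le_leq n n' phi : (n <= n')%N -> spectral_le n phi -> spectral_le n' phi.
Proof.
by move=> nn [h1 h2]; split; [apply: le_trans h1 _|apply: le_trans h2 _]; rewrite lee_fin ler_nat.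
Qed.

Lemma weighted_lty (A : R -> R) : (fun z => (Num.sqrt (2 * pi))^-1 * A z * expR `|z|) \in Lfun mu 2%:E ->
  (\int[mu]_z (A z ^+ 2 * expR (2 * `|z|))%:E < +oo)%E.
Proof.
move=> /Lfun2_integrable_sqr /(integrableZR (2 * pi)) /(integrable_lty measurableT).
congr (_ < _)%E; apply: eq_integral => z _ /=; congr EFin.
have p0 : 0 < 2 * pi :> R by rewrite mulr_gt0 ?pi_gt0.
rewrite !exprMn exprVn sqr_sqrtr ?(ltW p0)// expRM_natl !mulrA mulfV ?gt_eqF//.
by rewrite mul1r.
Qed.

Lemma L2C_spectral_le phi : L2C (exp_weight (fourier phi)) -> exists n, spectral_le n phi.
Proof.
move=> [hre him].
have hA : (\int[mu]_z (cosT phi z ^+ 2 * expR (2 * `|z|))%:E < +oo)%E.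
  apply: weighted_lty.
  suff -> : (fun z => (Num.sqrt (2 * pi))^-1 * cosT phi z * expR `|z|) =
      (fun z => complex.Re (exp_weight (fourier phi) z)) by [].
  by apply/funext => z; rewrite /exp_weight /fourier /=; rewrite /cosT; ring.
have hB : (\int[mu]_z (sinT phi z ^+ 2 * expR (2 * `|z|))%:E < +oo)%E.
  under eq_integral do rewrite -sqrrN.
  apply: (@weighted_lty (fun z => - sinT phi z)).
  suff -> : (fun z => (Num.sqrt (2 * pi))^-1 * - sinT phi z * expR `|z|) =
      (fun z => complex.Im (exp_weight (fourier phi) z)) by [].
  by apply/funext => z; rewrite /exp_weight /fourier /=; rewrite /sinT; ring.
have ex (I : \bar R) : (0 <= I)%E -> (I < +oo)%E -> exists n : nat, (I <= n%:R%:E)%E.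
  case: I => [r||]// r0 _; exists (Num.trunc r).+1.
  by rewrite lee_fin ltW// truncnS_gt.
have pos (A : R -> R) : (0 <= \int[mu]_z (A z ^+ 2 * expR (2 * `|z|))%:E)%E.
  by apply: integral_ge0 => z _; rewrite lee_fin mulr_ge0 ?sqr_ge0 ?expR_ge0.
have [n1 h1] := ex _ (pos _) hA; have [n2 h2] := ex _ (pos _) hB.
exists (maxn n1 n2); split.
  by apply: (le_trans h1); rewrite lee_fin ler_nat leq_maxl.
by apply: (le_trans h2); rewrite lee_fin ler_nat leq_maxr.
Qed.

Lemma trigTB phi1 phi2 z : mu.-integrable setT (EFin \o phi1) ->
  mu.-integrable setT (EFin \o phi2) ->
  cosT (fun x => phi1 x - phi2 x) z = cosT phi1 z - cosT phi2 z /\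
  sinT (fun x => phi1 x - phi2 x) z = sinT phi1 z - sinT phi2 z.
Proof.
move=> i1 i2; split.
  rewrite /cosT -(RintegralB measurableT (integrable_cosM z i1) (integrable_cosM z i2)).
  by apply: eq_Rintegral => x _; rewrite mulrBl.
rewrite /sinT -(RintegralB measurableT (integrable_sinM z i1) (integrable_sinM z i2)).
by apply: eq_Rintegral => x _; rewrite mulrBl.
Qed.

Lemma integral_sqrB_le (a b w : R -> R) (s t : R) :
  measurable_fun setT a -> measurable_fun setT b -> measurable_fun setT w ->
  (forall x, 0 <= w x) ->
  (\int[mu]_x (a x ^+ 2 * w x)%:E <= s%:E)%E -> (\int[mu]_x (b x ^+ 2 * w x)%:E <= t%:E)%E ->
  (\int[mu]_x ((a x - b x) ^+ 2 * w x)%:E <= (2 * s + 2 * t)%:E)%E.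
Proof.
move=> ma mb mw w0 hs ht.
apply: (@le_trans _ _ (\int[mu]_x (2 * (a x ^+ 2 * w x) + 2 * (b x ^+ 2 * w x))%:E)%E).
  apply: ge0_le_integralR; [by meas|by meas| |].
    by move=> x; rewrite mulr_ge0 ?sqr_ge0.
  move=> x; rewrite !mulrA -mulrDl ler_wpM2r//.
  by have := sqr_ge0 (a x + b x); nra.
rewrite ge0_integral_lin//; last 4 first.
- by meas.
- by meas.
- by move=> x; rewrite mulr_ge0 ?sqr_ge0.
- by move=> x; rewrite mulr_ge0 ?sqr_ge0.
rewrite [leRHS]EFinD; apply: leeD; rewrite [leRHS]EFinM; exact: lee_wpmul2l.
Qed.

Definition admissible f (n : nat) phi psi : Prop := exists u,
  [/\ mu.-integrable setT (EFin \o phi), spaceJ u, solution f phi u,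
    normal_derivative phi u psi & spectral_le n phi].

(** Neither [p] nor the exact datum occurs here: a choice among candidates depends on [f], [eps] and
    the measurement [v] alone. *)
Definition candidate f (eps : R) (v : L2 R) (n : nat) (g : L2 R) : Prop :=
  exists phi, admissible f n phi g /\ (normL2 (fun x => (v x : R) - phi x)%R < eps%:E)%E.

Lemma candidate_leq f eps v n n' g : (n <= n')%N ->
  candidate f eps v n g -> candidate f eps v n' g.
Proof.
move=> nn [phi [[u [h1 h2 h3 h4 h5]] h6]]; exists phi; split => //.
by exists u; split => //; exact: spectral_le_leq h5.
Qed.

(* Minimality of the spectral size replaces the unknown bound on the exact datum:
   the chosen datum is as regular as any datum compatible with [v]. *)
Lemma best_candidate f : exists Reg : R -> L2 R -> L2 R,
  forall eps v n g, candidate f eps v n g -> candidate f eps v n (Reg eps v).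
Proof.
have ex (ev : R * L2 R) : exists g0, forall n g,
    candidate f ev.1 ev.2 n g -> candidate f ev.1 ev.2 n g0.
  have [[n0 [g1 c1]]|no] := pselect (exists n g, candidate f ev.1 ev.2 n g); last first.
    (* Without any candidate the value is arbitrary; the measurement itself is returned. *)
    by exists ev.2 => n g c; exfalso; apply: no; exists n, g.
  have exP : exists n, `[< exists g, candidate f ev.1 ev.2 n g >].
    by exists n0; apply/asboolP; exists g1.
  case: (ex_minnP exP) => m /asboolP[g0 c0] mmin; exists g0 => n g c.
  by apply: candidate_leq c0; apply: mmin; apply/asboolP; exists g.
have [F HF] := choice ex.
by exists (fun eps v => F (eps, v)) => eps v; exact: (HF (eps, v)).
Qed.

End regularization.

Theorem lemma1 (R : realType) (f : R -> R -> R -> R) :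
  exists Reg : R -> L2 R -> L2 R,
  forall p : R -> R -> R,
    (leb R \x leb R)%E.-integrable upper (fun z => (p z.1 z.2)%:E) ->
    (forall xi eta zeta1 zeta2 : R, 0 < eta ->
      `|f xi eta zeta1 - f xi eta zeta2| <= `|p xi eta| * `|zeta1 - zeta2|) ->
    (constK p < 1)%E ->
    (constL p < +oo)%E ->
  forall (phi : R -> R) (u : R -> R -> R) (psi : R -> R) (Psi : R -> R[i]),
    phi \in Lfun (leb R) 1%E ->
    phi \in Lfun (leb R) +oo%E ->
    L2C (exp_weight (fourier phi)) ->
    spaceJ u ->
    solution f phi u ->
    normal_derivative phi u psi ->
    is_plancherel psi Psi ->
    L2C (exp_weight Psi) ->
  exists C : R, 0 < C /\
    forall (eps : R) (phi_eps : L2 R), 0 < eps < 1 ->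
      (normL2 (fun x => (phi_eps x : R) - phi x)%R < eps%:E)%E ->
      (normL2 (fun x => (Reg eps phi_eps x : R) - psi x)%R <
        (C * eps `^ 2^-1)%R%:E)%E.

Proof.
have [Reg HReg] := best_candidate f; exists Reg => p ip lip K1 Lfin.
move=> phi u psi Psi phi1 _ hphi uJ su dpsi [psi2 _ _] _.
have iphi : (leb R).-integrable setT (EFin \o phi) by apply/Lfun1_integrable.
have mpsi : measurable_fun setT psi 
  by move: psi2; rewrite inE => /andP[+ _]; rewrite inE.
have [g gpsi] := L2_class psi2.
have [n hn] := L2C_spectral_le hphi.
have dg : normal_derivative phi u g.
  have FF : Filter (nbhs (almost_everywhere (leb R))) by exact: (ae_filter_ringOfSetsType (leb R)).
  by move: dpsi gpsi; apply: filterS2 => x d ->.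
(* The weighted bound for a difference of two data, each of spectral size [n], by
   [(a - b)^2 <= 2 a^2 + 2 b^2]. *)
have Q0 : 0 <= 2 * n%:R + 2 * n%:R :> R by rewrite addr_ge0 ?mulr_ge0.
have [C0 C00 HC] := stability ip lip K1 Lfin Q0.
(* The added 1 makes [C] positive and the final inequality strict, even when [C0 = 0]. *)
exists (Num.sqrt C0 + 1); split; first by rewrite ltr_wpDl ?sqrtr_ge0.
move=> eps v /andP[eps0 _] hv.
(* The exact datum, with the class [g] of its derivative, is a candidate of size [n]; hence the
   chosen one is also of size [n], a number independent of [eps] and [v]. *)
have [phi' [[u' [iphi' uJ' su' dg' [hc' hs']]] hv']] : candidate f eps v n (Reg eps v).
  by apply: (HReg eps v n g); exists phi; split => //; exists u.
have mphi : measurable_fun setT phi by exact: integrable_mfun iphi.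
have mphi' : measurable_fun setT phi' by exact: integrable_mfun iphi'.
have mv := measurable_L2 v; have mR := measurable_L2 (Reg eps v).
have me : measurable_fun setT (fun z : R => expR (2 * `|z|)) by meas.
have e0 (z : R) : 0 <= expR (2 * `|z|) by exact: expR_ge0.
have hd : (\int[leb R]_x ((phi' x - phi x) ^+ 2)%:E <= (4 * eps ^+ 2)%:E)%E.
  have le2 (q : R -> R) : (normL2 (fun x => (v x : R) - q x)%R < eps%:E)%E ->
      (\int[leb R]_x (((v x : R) - q x) ^+ 2 * 1)%:E <= (eps ^+ 2)%:E)%E.
    by move=> /normL2_lt; under [in X in _ -> X]eq_integral do rewrite mulr1.
  have mvB (q : R -> R) : measurable_fun setT q -> measurable_fun setT (fun x => (v x : R) - q x).
    by move=> mq; apply: measurable_funB.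
  have := integral_sqrB_le (mvB _ mphi) (mvB _ mphi') (measurable_cst (1 : R)) (fun=> ler01)
    (le2 _ hv) (le2 _ hv').
  congr (_ <= _)%E; last by congr EFin; ring.
  by apply: eq_integral => x _; congr EFin; rewrite /cst /=; ring.
have hdc : (\int[leb R]_z (cosT (fun x => phi' x - phi x) z ^+ 2 * expR (2 * `|z|))%:E
    <= (2 * n%:R + 2 * n%:R)%:E)%E.
  under eq_integral do rewrite (trigTB _ iphi' iphi).1.
  exact: (integral_sqrB_le (measurable_trigT iphi').1 (measurable_trigT iphi).1 me e0 hc' hn.1).
have hds : (\int[leb R]_z (sinT (fun x => phi' x - phi x) z ^+ 2 * expR (2 * `|z|))%:E
    <= (2 * n%:R + 2 * n%:R)%:E)%E.
  under eq_integral do rewrite (trigTB _ iphi' iphi).2.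
  exact: (integral_sqrB_le (measurable_trigT iphi').2 (measurable_trigT iphi).2 me e0 hs' hn.2).
have := HC _ _ _ _ _ _ _ iphi' iphi uJ' uJ su' su dg' dpsi mR mpsi eps0 hd hdc hds.
move=> /(normL2_le (mulr_ge0 C00 (ltW eps0))) h; apply: (le_lt_trans h).
by rewrite lte_fin sqrtrM// powR12_sqrt ?(ltW eps0)// ltr_pM2r ?sqrtr_gt0// ltrDl.
Qed.
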